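(* Let $\phi$ be a pair potential on $\mathbb{R}^d$ and $z>0$. Suppose that either $\phi$ satisfies (I), (SS), (LR) and $\mu\in\mathcal{G}^t(z,\phi)$, or $\phi$ satisfies (P), (I) and $\mu\in\mathcal{G}(z,\phi)$. Then $(\mathcal{E},D(\mathcal{E}))$ is a Dirichlet form on $L^2(\Gamma,\mu)$.
   Context: Configuration space. $\Gamma$ is the set of all locally finite subsets $\gamma\subset\mathbb{R}^d$, $d\in\mathbb{N}$; $\gamma$ is identified with the Radon measure $\sum_{x\in\gamma}\varepsilon_x$, $\gamma_\Lambda:=\gamma\cap\Lambda$, $\langle f,\gamma\rangle:=\sum_{x\in\gamma}f(x)$. $\Gamma$ carries the vague topology (weakest topology making $\gamma\mapsto\langle f,\gamma\rangle$ continuous for all $f\in\mathcal{D}:=C_0(\mathbb{R}^d)$, the continuous real functions with compact support) and its Borel $\sigma$-algebra $\mathcal{B}(\Gamma)$. We write $x$ for $\{x\}$. For $\Lambda\subset\mathbb{R}^d$, $\Gamma_\Lambda:=\{\gamma\in\Gamma:\gamma\subset\Lambda\}$. Gibbs measures. A pair potential is a Borel function $\phi:\mathbb{R}^d\to\mathbb{R}\cup\{+\infty\}$ with $\phi(-x)=\phi(x)\in\mathbb{R}$ for $x\ne0$. For $x\notin\gamma$, $E(x,\gamma):=\sum_{y\in\gamma}\phi(x-y)$ if $\sum_{y\in\gamma}|\phi(x-y)|<\infty$ and $+\infty$ otherwise. For $z>0$, $\mathcal{G}(z,\phi)$ is the set of probability measures $\mu$ on $(\Gamma,\mathcal{B}(\Gamma))$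 with $$\int_\Gamma\mu(d\gamma)\int_{\mathbb{R}^d}\gamma(dx)F(\gamma,x)=\int_\Gamma\mu(d\gamma)\int_{\mathbb{R}^d}z\,dx\,e^{-E(x,\gamma)}F(\gamma\cup x,x)$$ for all measurable $F:\Gamma\times\mathbb{R}^d\to[0,+\infty]$. For $r\in\mathbb{Z}^d$, $Q_r:=\{x:r^i-\frac12\le x^i<r^i+\frac12\}$, $\gamma_r:=\gamma\cap Q_r$; $\Lambda_N$ is the cube of side length $2N-1$ centered at the origin (a union of $(2N-1)^d$ cubes $Q_r$). $\mathcal{G}^t(z,\phi)$ is the set of tempered $\mu\in\mathcal{G}(z,\phi)$, i.e. those supported by $\bigcup_{n\ge1}S_n$, $S_n:=\{\gamma\in\Gamma:\forall N\in\mathbb{N}\ \sum_{r\in\Lambda_N\cap\mathbb{Z}^d}|\gamma_r|^2\le n^2|\Lambda_N\cap\mathbb{Z}^d|\}$. Conditions. (SS): there are $A>0,B\ge0$ such that for $\gamma\in\Gamma_{\Lambda_N}$ for some $N$, $\sum_{\{x,y\}\subset\gamma}\phi(x-y)\ge\sum_{r\in\mathbb{Z}^d}(A|\gamma_r|^2-B|\gamma_r|)$. (LR): there is a decreasing positive function $a:\mathbb{N}\to\mathbb{R}_+$ ($\mathbb{N}$ including $0$ here) with $\sum_{r\in\mathbb{Z}^d}a(\|r\|)<\infty$ ($\|\cdot\|$ the maximum norm) such that for any disjoint finite unions $\Lambda',\Lambda''$ of cubes $Q_r$ and $\gamma'\in\Gamma_{\Lambda'},\gamma''\in\Gamma_{\Lambda''}$,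 $\sum_{x\in\gamma',y\in\gamma''}\phi(x-y)\ge-\sum_{r',r''\in\mathbb{Z}^d}a(\|r'-r''\|)|\gamma'_{r'}||\gamma''_{r''}|$. (I): $\int_{\mathbb{R}^d}|1-e^{-\phi(x)}|dx<\infty$. (P): $\phi\ge0$ on $\mathbb{R}^d$. Form. $\mathcal{F}C_b^\infty(\mathcal{D},\Gamma)$ is the set of ($\mu$-classes of) functions $F(\gamma)=g_F(\langle\varphi_1,\gamma\rangle,\dots,\langle\varphi_N,\gamma\rangle)$, $N\in\mathbb{N}$, $\varphi_i\in\mathcal{D}$, $g_F\in C_b^\infty(\mathbb{R}^N)$ (smooth, bounded with all derivatives). $D^-_xF(\gamma):=F(\gamma\setminus x)-F(\gamma)$. The form $\mathcal{E}(F,G):=\int_\Gamma\mu(d\gamma)\int_{\mathbb{R}^d}\gamma(dx)D^-_xF(\gamma)D^-_xG(\gamma)$ on $\mathcal{F}C_b^\infty(\mathcal{D},\Gamma)$ is well defined and closable on $L^2(\Gamma,\mu)$; $(\mathcal{E},D(\mathcal{E}))$ is its closure. A (symmetric) Dirichlet form is a densely defined, closed, nonnegative symmetric bilinear form such that $F\in D(\mathcal{E})$ implies $g(F):=(0\vee F)\wedge1\in D(\mathcal{E})$ and $\mathcal{E}(g(F),g(F))\le\mathcal{E}(F,F)$. *)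

(* Defs.v *)
From HB Require Import structures.
From mathcomp Require Import all_boot all_order all_algebra finmap.
From mathcomp Require Import all_classical all_reals all_analysis measurable_realfun.

Set Implicit Arguments.
Unset Strict Implicit.
Unset Printing Implicit Defensive.
Import Order.TTheory GRing.Theory Num.Theory.
Import numFieldNormedType.Exports.

Local Open Scope classical_set_scope.
Local Open Scope ring_scope.

(* R^d carries its Borel sigma-algebra. *)
HB.instance Definition _ (R : realType) (d : nat) :=
  Measurable.copy 'rV[R]_d (g_sigma_algebraType (@open 'rV[R]_d)).

Section lebesgue_rV.
Variable R : realType.

Definition rV_cons n (p : 'rV[R]_n * R) : 'rV[R]_n.+1 :=
  \row_i oapp (fun j => p.1 0 j) p.2 (unlift ord0 i).

Definition rat_ball n (k : 'rV[rat]_n * nat) : set 'rV[R]_n :=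
  ball (map_mx ratr k.1 : 'rV[R]_n) k.2.+1%:R^-1.

Lemma open_bigcup_rat_ball n (U : set 'rV[R]_n) : open U ->
  U = \bigcup_(k in [set k | rat_ball k `<=` U]) rat_ball k.
Proof.
move=> oU; apply/seteqP; split=> [x Ux|x [k /= kU xk]]; last exact: kU.
have /nbhs_ballP[e /= e0 xeU] : nbhs x U by exact: open_nbhs_nbhs.
have [m me] : exists m, m.+1%:R^-1 < e / 2.
  have e20 : 0 < e / 2 by rewrite divr_gt0.
  near \oo => m; exists m; near: m.
  exact: near_infty_natSinv_lt (PosNum e20).
have /choice[q xq] : forall i, exists q : rat, `|ratr q - x 0 i| < m.+1%:R^-1 :> R.
  move=> i.
  have [q] : exists q, ratr q \in `]x 0 i - m.+1%:R^-1, x 0 i + m.+1%:R^-1[.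
    by apply: rat_in_itvoo; rewrite ltrBlDr -addrA ltrDl addr_gt0 ?invr_gt0.
  by rewrite in_itv/= => /andP[q1 q2]; exists q; rewrite distrC ltr_distlC q1 q2.
have bq : rat_ball (\row_i q i, m) x.
  split=> [|i j]; first by rewrite /= invr_gt0.
  by rewrite !mxE (ord1 i); exact: xq.
exists (\row_i q i, m) => //= y qy; apply: xeU.
have -> : e = e / 2 + e / 2 by rewrite -splitr.
apply: (@ball_triangle _ _ (map_mx ratr (\row_i q i) : 'rV[R]_n)).
  by apply: ball_sym; apply: le_ball bq; exact: ltW.
by apply: le_ball qy; exact: ltW.
Unshelve. all: by end_near. Qed.

Lemma measurable_coord n (j : 'I_n) :
  measurable_fun [set: 'rV[R]_n] (fun x : 'rV[R]_n => x 0 j).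
Proof.
apply: (measurability _ (RGenOpens.measurableE R)) => _ [_ [a [b ->] <-]].
rewrite setTI; apply: sub_sigma_algebra.
by apply: open_comp; [move=> ? _; exact: coord_continuous|exact: interval_open].
Qed.

Lemma measurable_rV_cons n : measurable_fun setT (@rV_cons n).
Proof.
apply: (@measurability _ _ _ _ _ _ (@open 'rV[R]_n.+1)) => // _ [U oU <-].
rewrite setTI (open_bigcup_rat_ball oU) bigcup_mkcond preimage_bigcup.
apply: countable_bigcupT_measurable => // k; case: ifPn => _; last first.
  by rewrite preimage_set0.
rewrite (_ : _ @^-1` _ = \bigcap_(i in [set: 'I_n.+1])
    (fun p => rV_cons p 0 i) @^-1` ball (ratr (k.1 0 i) : R) k.2.+1%:R^-1); last first.
  apply/seteqP; split=> [p [_ kp] i _|p kp].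
    by have := kp 0 i; rewrite mxE.
  split=> [|i j]; first by rewrite /= invr_gt0.
  by rewrite mxE (ord1 i); exact: kp.
apply: fin_bigcap_measurable => // i _; rewrite -[X in measurable X]setTI.
suff : measurable_fun setT (fun p : 'rV[R]_n * R => rV_cons p 0 i).
  by apply => //; exact: measurable_ball.
have -> : (fun p : 'rV[R]_n * R => rV_cons p 0 i) =
    if unlift ord0 i is Some j then (fun p => p.1 0 j) else snd.
  by apply/funext => p; rewrite mxE; case: unlift.
case: unlift => [j|]; last exact: measurable_snd.
exact: measurableT_comp (measurable_coord j) measurable_fst.
Qed.

(* Lebesgue measure on R^n: the product of n copies of the one-dimensional
   one, carried to row vectors by rV_cons. *)
Fixpoint lebesgue_rV n : {measure set 'rV[R]_n -> \bar R} :=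
  if n is m.+1 then
    measure_function_pushforward__canonical__measure_function_Measure
      (lebesgue_rV m \x lebesgue_measure)%E (@measurable_rV_cons m)
  else \d_(0 : 'rV[R]_0).

Lemma lebesgue_rV_box n (a b : 'rV[R]_n) : (forall i, a 0 i <= b 0 i) ->
  lebesgue_rV n [set x : 'rV[R]_n | forall i, a 0 i <= x 0 i < b 0 i] =
  (\prod_(i < n) (b 0 i - a 0 i))%:E.
Proof.
elim: n a b => [|n IH] a b ab.
  rewrite big_ord0 /= diracE mem_set//; by case.
rewrite big_ord_recl /= /pushforward.
pose a' : 'rV[R]_n := \row_i a 0 (lift ord0 i).
pose b' : 'rV[R]_n := \row_i b 0 (lift ord0 i).
have -> : @rV_cons n @^-1` [set x : 'rV[R]_n.+1 | forall i, a 0 i <= x 0 i < b 0 i] =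
    [set x : 'rV[R]_n | forall i, a' 0 i <= x 0 i < b' 0 i] `*` `[a 0 ord0, b 0 ord0[%classic.
  apply/seteqP; split => [[y x] /= H|[y x] /= [H1 H2] i].
    split; last by rewrite in_itv/=; have := H ord0; rewrite !mxE unlift_none.
    by move=> i; have := H (lift ord0 i); rewrite !mxE liftK.
  rewrite mxE; case: unliftP => [j ->|->] /=; last by move: H2; rewrite in_itv.
  by have := H1 j; rewrite !mxE.
have mbox : measurable [set x : 'rV[R]_n | forall i, a' 0 i <= x 0 i < b' 0 i].
  rewrite (_ : [set _ | _] = \bigcap_(i in [set: 'I_n])
    (fun x : 'rV[R]_n => x 0 i) @^-1` `[a' 0 i, b' 0 i[%classic); last first.
    apply/seteqP; split=> x /= H i; first by move=> _; rewrite /= in_itv/=.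
    by have := H i I; rewrite /= in_itv.
  apply: fin_bigcap_measurable => // i _; rewrite -[X in measurable X]setTI.
  exact: measurable_coord.
rewrite product_measure1E// IH; last by move=> i; rewrite !mxE.
have leb1 : lebesgue_measure `[a 0 ord0, b 0 ord0[%classic =
    (b 0 ord0 - a 0 ord0)%:E.
  rewrite lebesgue_measure_itv /= lte_fin; case: ltP => // ba.
  rewrite (_ : b 0 ord0 = a 0 ord0) ?subrr//.
  by apply/eqP; rewrite eq_le ba ab.
rewrite EFinM muleC; congr (_ * _)%E; first exact: leb1.
by congr EFin; apply: eq_bigr => i _; rewrite !mxE.
Qed.

End lebesgue_rV.

Section configurations.
Context {R : realType} {d : nat}.

Definition locally_finite (A : set 'rV[R]_d) :=
  forall K : set 'rV[R]_d, compact K -> finite_set (A `&` K).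

Record config := Config {
  points :> set 'rV[R]_d;
  config_locally_finite : locally_finite points }.

Lemma locally_finite0 : locally_finite set0.
Proof. by move=> K _; rewrite set0I; exact: finite_set0. Qed.

Lemma locally_finiteU1 (g : config) x : locally_finite (g `|` [set x]).
Proof.
move=> K cK; rewrite setIUl finite_setU; split.
  exact: config_locally_finite.
exact/finite_setIl/finite_set1.
Qed.

Lemma locally_finiteD1 (g : config) x : locally_finite (g `\ x).
Proof.
move=> K cK; apply: (sub_finite_set _ (@config_locally_finite g K cK)).
by move=> y [[? _] ?].
Qed.

Definition add_point (g : config) x := Config (locally_finiteU1 g x).
Definition del_point (g : config) x := Config (locally_finiteD1 g x).

HB.instance Definition _ := gen_eqMixin config.
HB.instance Definition _ := gen_choiceMixin config.
HB.instance Definition _ := isPointed.Build config (Config locally_finite0).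

(* The space of test functions: continuous with compact support. *)
Definition test_fun (f : 'rV[R]_d -> R) :=
  continuous f /\ compact (closure [set x | f x != 0]).

(* A finite sum when f is a test function. *)
Definition pairing (f : 'rV[R]_d -> R) (g : config) : R := \sum_(x \in points g) f x.

(* The coarsest topology making [pairing f] continuous for every test function
   f: the preimages of open sets form a subbase. *)
Definition vague_subbase : set (set config) :=
  [set pairing fU.1 @^-1` fU.2 | fU in
    [set fU : ('rV[R]_d -> R) * set R | test_fun fU.1 /\ open fU.2]].

HB.instance Definition _ := isSubBaseTopological.Build config vague_subbase id.
HB.instance Definition _ :=
  Measurable.copy config (g_sigma_algebraType (@open config)).

End configurations.
Arguments config : clear implicits.

Section gibbs_measures.
Context {R : realType} {d : nat}.
Local Notation V := 'rV[R]_d.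
Local Notation Zd := 'rV[int]_d.
Implicit Types (phi : V -> \bar R) (g : config R d) (r : Zd).

Record pair_potential phi : Prop := PairPotential {
  potential_measurable : measurable_fun setT phi;
  potential_gtNy : forall x, (-oo < phi x)%E;
  potential_even : forall x, phi (- x) = phi x;
  potential_fin : forall x, x != 0 -> phi x \is a fin_num }.

(* The energy of a point x with a configuration. The case distinction makes
   both esums below finite. For x in g, which is a Lebesgue-null set of x,
   the value is not used. *)
Definition energy phi (x : V) g : \bar R :=
  if (\esum_(y in points g) `|phi (x - y)%R| < +oo)%E then
    (\esum_(y in points g) maxe (phi (x - y)%R) 0 -
     \esum_(y in points g) maxe (- phi (x - y)%R) 0)%E
  else +oo%E.

Definition gibbs (z : R) phi (mu : probability (config R d) R) :=
  forall F : config R d * V -> \bar R,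
    measurable_fun setT F -> (forall p, 0 <= F p)%E ->
    (\int[mu]_g (\esum_(x in points g) F (g, x)) =
     \int[mu]_g \int[lebesgue_rV R d]_x
       (z%:E * expeR (- energy phi x g) * F (add_point g x, x)))%E.

Definition unit_cube r : set V :=
  [set x | forall i, (r 0 i)%:~R - 2^-1 <= x 0 i < (r 0 i)%:~R + 2^-1].

(* The cube of side length 2N-1 centered at the origin; half-open, so that it
   is a union of unit cubes. *)
Definition cube (N : nat) : set V :=
  [set x | forall i, - (N%:R - 2^-1) <= x 0 i < N%:R - 2^-1].

Definition cube_lattice (N : nat) : set Zd :=
  [set r | cube N (map_mx intr r)].

Definition cube_count g r : nat := #|` fset_set (points g `&` unit_cube r)|.

Definition tempered_level (n : nat) : set (config R d) :=
  [set g | forall N : nat, (0 < N)%N ->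
    \sum_(r \in cube_lattice N) ((cube_count g r)%:R ^+ 2 : R) <=
      n%:R ^+ 2 * #|` fset_set (cube_lattice N)|%:R :> R].

Definition tempered_gibbs (z : R) phi (mu : probability (config R d) R) :=
  gibbs z phi mu /\
  {ae mu, forall g, exists2 n : nat, (0 < n)%N & tempered_level n g}.

(* The sum over unordered pairs {x, y} is half the sum over ordered pairs of
   distinct points, since phi is even. *)
Definition superstable phi :=
  exists A B : R, [/\ 0 < A, 0 <= B &
    forall (N : nat) g, (0 < N)%N -> points g `<=` cube N ->
      ((\sum_(r \in [set: Zd])
          (A * (cube_count g r)%:R ^+ 2 - B * (cube_count g r)%:R))%R%:E <=
       (2^-1)%:E * \sum_(p \in [set p : V * V |
            [/\ points g p.1, points g p.2 & p.1 != p.2]]) phi (p.1 - p.2)%R)%E].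

Definition lattice_norm r : nat := \max_(i < d) absz (r 0%R i).

Definition lower_regular phi :=
  exists a : nat -> R,
  [/\ forall m n, (m <= n)%N -> a n <= a m,
      forall n, 0 < a n,
      (\esum_(r in [set: Zd]) (a (lattice_norm r))%:E < +oo)%E &
      forall (I' I'' : set Zd) (g' g'' : config R d),
        finite_set I' -> finite_set I'' ->
        let L' := \bigcup_(r in I') unit_cube r in
        let L'' := \bigcup_(r in I'') unit_cube r in
        L' `&` L'' = set0 -> points g' `<=` L' -> points g'' `<=` L'' ->
        ((- \sum_(p \in [set: Zd * Zd]) (a (lattice_norm (p.1 - p.2)) *
             (cube_count g' p.1)%:R * (cube_count g'' p.2)%:R))%R%:E <=
         \sum_(p \in points g' `*` points g'') phi (p.1 - p.2)%R)%E].

Definition mayer_integrable phi :=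
  (\int[lebesgue_rV R d]_x `|1 - expeR (- phi x)| < +oo)%E.

Definition repulsive phi := forall x, (0 <= phi x)%E.

End gibbs_measures.

Section smooth_bounded.
Context {R : realType} {N : nat}.

Definition iter_partial (s : seq 'I_N) (h : 'rV[R]_N -> R) : 'rV[R]_N -> R :=
  foldr (fun i k x => 'D_(delta_mx 0 i) k x) h s.

Definition smooth_bounded (h : 'rV[R]_N -> R) :=
  forall s : seq 'I_N, (forall x, differentiable (iter_partial s h) x) /\
    exists M : R, forall x, `|iter_partial s h x| <= M.

End smooth_bounded.

(* A function T -> R stands for its class in L^2(mu). *)
Section forms_L2.
Context {disp : measure_display} {T : measurableType disp} {R : realType}.
Variable mu : {measure set T -> \bar R}.
Implicit Types (F G H : T -> R) (dom : set (T -> R)).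

Definition L2dist F G : \bar R := 'N[mu]_2%:E [EFin \o (F \- G)].

Definition L2cvg (Fn : nat -> T -> R) F :=
  L2dist (Fn n) F @[n --> \oo] --> 0%E.

Definition L2cauchy (Fn : nat -> T -> R) :=
  forall e : R, 0 < e -> exists k, forall m n, (k <= m)%N -> (k <= n)%N ->
    (L2dist (Fn m) (Fn n) < e%:E)%E.

Definition form_cauchy (E : (T -> R) -> (T -> R) -> R) (Fn : nat -> T -> R) :=
  forall e : R, 0 < e -> exists k, forall m n, (k <= m)%N -> (k <= n)%N ->
    E (Fn m \- Fn n) (Fn m \- Fn n) < e.

Definition approximates dom (E : (T -> R) -> (T -> R) -> R)
    (Fn : nat -> T -> R) F :=
  [/\ forall n, dom (Fn n), L2cvg Fn F & form_cauchy E Fn].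

(* The closure of (dom, E). For a closable form the limit below does not depend
   on the approximating sequences; nothing here presupposes closability. *)
Definition closure_dom dom (E : (T -> R) -> (T -> R) -> R) : set (T -> R) :=
  [set F | F \in Lfun mu 2%:E /\ exists Fn, approximates dom E Fn F].

Definition closure_form dom (E : (T -> R) -> (T -> R) -> R) F G : R :=
  xget 0 [set l | forall Fn Gn, approximates dom E Fn F ->
    approximates dom E Gn G -> E (Fn n) (Gn n) @[n --> \oo] --> l].

(* Closedness is completeness of dom for E(F,G) + (F,G)_{L^2(mu)}. *)
Record dirichlet_form dom (E : (T -> R) -> (T -> R) -> R) : Prop := {
  form_dom_L2 : forall F, dom F -> F \in Lfun mu 2%:E;
  form_ae : forall F G, dom F -> G \in Lfun mu 2%:E -> F = G %[ae mu] ->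
    dom G /\ forall H, dom H -> E F H = E G H;
  form_dom0 : dom (cst 0);
  form_dom_linear : forall (a : R) F G, dom F -> dom G ->
    dom (fun x => a * F x + G x);
  form_linear : forall (a : R) F G H, dom F -> dom G -> dom H ->
    E (fun x => a * F x + G x) H = a * E F H + E G H;
  form_sym : forall F G, dom F -> dom G -> E F G = E G F;
  form_ge0 : forall F, dom F -> 0 <= E F F;
  form_dense : forall F, F \in Lfun mu 2%:E ->
    forall e : R, 0 < e -> exists2 G, dom G & (L2dist F G < e%:E)%E;
  form_closed : forall Fn : nat -> T -> R, (forall n, dom (Fn n)) ->
    L2cauchy Fn -> form_cauchy E Fn ->
    exists F, [/\ dom F, L2cvg Fn F &
      E (Fn n \- F) (Fn n \- F) @[n --> \oo] --> (0 : R)];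
  form_markov : forall F, dom F ->
    let cutF := fun x => Num.min (Num.max 0 (F x)) 1 in
    dom cutF /\ E cutF cutF <= E F F }.

End forms_L2.

Section glauber_form.
Context {R : realType} {d : nat}.
Implicit Types F G : config R d -> R.

Definition FCb : set (config R d -> R) :=
  [set F | exists N : nat, (0 < N)%N /\
    exists (f : 'I_N -> 'rV[R]_d -> R) (h : 'rV[R]_N -> R),
    [/\ forall i, test_fun (f i), smooth_bounded h &
        forall g, F g = h (\row_i pairing (f i) g)]].

Definition Dminus F g x : R := F (del_point g x) - F g.

(* For F and G in FCb, the inner sum has finitely many nonzero terms, since
   removing x changes no pairing unless x is in the support of a test
   function. *)
Definition pre_form (mu : probability (config R d) R) F G : R :=
  \int[mu]_g \sum_(x \in points g) (Dminus F g x * Dminus G g x).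

Definition glauber_dom (mu : probability (config R d) R) : set (config R d -> R) :=
  closure_dom mu FCb (pre_form mu).

Definition glauber_form (mu : probability (config R d) R) :
    (config R d -> R) -> (config R d -> R) -> R :=
  closure_form mu FCb (pre_form mu).

End glauber_form.

(* Main.v *)
Require Import Defs.
From HB Require Import structures.
From mathcomp Require Import all_boot all_order all_algebra finmap.
From mathcomp Require Import all_classical all_reals all_analysis measurable_realfun.
From mathcomp Require Import ring lra zify.

(* The form is the L^2(nu)-norm of the difference operator
   D F (g, x) = F (g \ x) - F g for the Campbell measure nu(dg, dx) = mu(dg) g(dx).
   By the Gibbs identity, mu-null sets of configurations are nu-null under both
   (g, x) |-> g and (g, x) |-> g \ x, so D is defined on mu-classes, and contractions
   of F contract D F pointwise: this gives closability and the Markov property.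
   What remains is that cylinder functions have D F in L^2(nu), that is, that the
   expected number of points in a cube is finite. For superstable potentials this is
   Ruelle's argument: for tempered configurations with many points near the origin
   some large cube carries a dense configuration with little boundary interaction;
   superstability makes its energy large, whereas iterating the Gibbs identity bounds
   the exponential moments of the energy of the points in a cube. *)

Set Implicit Arguments.
Unset Strict Implicit.
Unset Printing Implicit Defensive.
Import Order.TTheory GRing.Theory Num.Theory.
Import numFieldNormedType.Exports.

Local Open Scope classical_set_scope.
Local Open Scope ring_scope.

(** Lower regularity provides no rate of decay for [a], so the cube with small boundary interaction
    is not sought along a fixed sequence of sizes. All sizes are averaged with the decrements of a
    weight [w] such that convolving [a] with the differences of [w] yields at most a small multiple
    of [w]; temperedness makes the [w]-weighted total finite, so that it can be absorbed. The cube
    found depends on the configuration, and a sum over all sizes replaces the choice: on a box of n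
    cells the exponential moment is at most exp(c n) with c = z e^B, and the density threshold is
    taken large enough to leave exp(-n). The unit contraction is not smooth, hence does not preserve
    cylinder functions. It is a combination of absolute values, and sqrt(F^2 + e^2) approximates |F|
    by a smooth 1-Lipschitz function of F, so that [D] of the approximations is dominated by [D F].
    The vague topology is given by a subbase only. Writing its open sets as countable unions of sets
    defined by point counts in balls reduces measurability of maps into configurations, such as
    deletion of a point, to such counts. *)

Lemma lt_EFin_lty {R : realType} (x : \bar R) (e : R) : (x < e%:E -> x < +oo)%E.
Proof. by move=> xe; exact: lt_le_trans xe (leey _). Qed.

(** * Square-integrable functions: norm, inner product, subsequences, completeness *)

Section L2_facts.
Context {disp : measure_display} {T : measurableType disp} {R : realType}.
Variable m : {measure set T -> \bar R}.
Implicit Types f g h : T -> R.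

Local Notation N2 f := ('N[m]_2%:E [EFin \o f%R])%E.

Lemma N2_ge0 f : (0 <= N2 f)%E. Proof. exact: Lnorm_ge0. Qed.
Local Hint Resolve N2_ge0 : core.

Definition L2 f := f \in Lfun m 2%:E.

Lemma L2P f : L2 f <-> measurable_fun setT f /\ (N2 f < +oo)%E.
Proof. by rewrite /L2 inE; split => [/andP[/[!inE]]|[? ?]] //; apply/andP; rewrite !inE. Qed.

Lemma L2norm_sqr f : ((N2 f) `^ 2 = \int[m]_x ((f x) ^+ 2)%:E)%E.
Proof.
rewrite poweR_Lnorm//; apply: eq_integral => x _ /=.
by congr (_%:E); rewrite powR_mulrn ?normr_ge0// real_normK// num_real.
Qed.

Lemma L2norm_lt f (e : R) : 0 < e ->
  (N2 f < e%:E)%E = (\int[m]_x ((f x) ^+ 2)%:E < (e ^+ 2)%:E)%E.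
Proof.
move=> e0; rewrite -L2norm_sqr.
have -> : ((e ^+ 2)%:E = e%:E `^ 2 :> \bar R)%E.
  by rewrite poweR_EFin powR_mulrn// ltW.
apply/idP/idP.
  move=> fe; have ff : (N2 f)%E \is a fin_num by rewrite ge0_fin_numE ?Lnorm_ge0//; exact: lt_EFin_lty fe.
  move: fe; rewrite -(fineK ff) !poweR_EFin !lte_fin => fe.
  by apply: gt0_ltr_powR => //; rewrite nnegrE ?fine_ge0// ltW.
apply: contraTT; rewrite -!leNgt => le.
by apply: gt0_ler_poweR le; rewrite ?in_itv/= ?leey ?N2_ge0 ?lee_fin ?ler0n ?(ltW e0).
Qed.

Lemma L2norm_lty f :
  (N2 f < +oo)%E = (\int[m]_x ((f x) ^+ 2)%:E < +oo)%E.
Proof.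
rewrite -L2norm_sqr; apply/idP/idP => [|h]; first exact: poweR_lty.
exact: lty_poweRy h.
Qed.

Lemma L2normB f g : N2 (f \- g) = N2 (g \- f).
Proof.
rewrite -(oppe_Lnorm m (EFin \o (f \- g))); congr Lnorm; apply/funext => x /=.
by rewrite opprB.
Qed.

Lemma L2_triangle f g h : measurable_fun setT f -> measurable_fun setT g ->
  measurable_fun setT h -> (N2 (f \- h) <= N2 (f \- g) + N2 (g \- h))%E.
Proof.
move=> mf mg mh.
have -> : f \- h = (f \- g) \+ (g \- h).
  by apply/funext => x /=; rewrite addrA subrK.
by apply: minkowski_EFin; rewrite ?ler1n//; exact: measurable_funB.
Qed.

Lemma L2_measurable f : L2 f -> measurable_fun setT f.
Proof. by move=> /L2P[]. Qed.

Lemma L2_lin (a : R) f g : L2 f -> L2 g -> L2 (fun x => a * f x + g x).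
Proof.
move=> /L2P[mf lf] /L2P[mg lg]; apply/L2P; split.
  by apply: measurable_funD => //; exact: measurable_funM.
have mZ : measurable_fun setT (fun x => a * f x) by exact: measurable_funM.
have /le_lt_trans -> // := @minkowski_EFin _ _ _ m (fun x => a * f x) g 2 mZ mg (ler1n _ 2).
rewrite lte_add_pinfty// L2norm_lty.
under eq_integral do rewrite exprMn EFinM.
rewrite ge0_integralZl//=; first last.
- by rewrite lee_fin sqr_ge0.
- by move=> x _; rewrite lee_fin sqr_ge0.
- exact/measurable_EFinP/measurable_funX.
by rewrite lte_mul_pinfty// ?lee_fin ?sqr_ge0//; rewrite -L2norm_lty.
Qed.

Lemma L2_cst0 : L2 (cst 0).
Proof. by apply/L2P; split => //; rewrite Lnorm0// eqe gt_eqF. Qed.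

Lemma L2B f g : L2 f -> L2 g -> L2 (f \- g).
Proof.
move=> lf lg; have := L2_lin (-1) lg lf; congr L2.
by apply/funext => x /=; rewrite mulN1r addrC.
Qed.

Lemma L2_prod_int f g : L2 f -> L2 g ->
  m.-integrable setT (EFin \o (fun x => f x * g x)).
Proof. by move=> lf lg; apply/Lfun1_integrable; exact: Lfun2_mul_Lfun1. Qed.

Lemma L2_near f g : L2 f -> measurable_fun setT g -> (N2 (g \- f) < +oo)%E -> L2 g.
Proof.
move=> lf mg gf; have lgf : L2 (g \- f).
  by apply/L2P; split => //; apply: measurable_funB => //; exact: L2_measurable.
have := L2_lin 1 lgf lf; congr L2.
by apply/funext => x /=; rewrite mul1r subrK.
Qed.

Definition L2form f g : R := \int[m]_x (f x * g x).

Lemma L2form_lin (a : R) f g h : L2 f -> L2 g -> L2 h ->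
  L2form (fun x => a * f x + g x) h = a * L2form f h + L2form g h.
Proof.
move=> lf lg lh; rewrite /L2form.
under eq_Rintegral do rewrite mulrDl -mulrA.
rewrite RintegralD//.
- by rewrite RintegralZl//; exact: L2_prod_int.
- have := L2_prod_int (L2_lin a lf L2_cst0) lh.
  by apply: eq_integrable => // x _ /=; rewrite addr0 mulrA.
- exact: L2_prod_int.
Qed.

Lemma L2form_sym f g : L2form f g = L2form g f.
Proof. by apply: eq_Rintegral => x _; rewrite mulrC. Qed.

Lemma L2form_norm f : L2 f -> (L2form f f)%:E = (\int[m]_x ((f x) ^+ 2)%:E)%E.
Proof.
move=> lf; rewrite /L2form /Rintegral fineK.
  by apply: eq_integral => x _; rewrite expr2.
exact/integrable_fin_num/L2_prod_int.
Qed.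

Lemma L2form_lt f (e : R) : 0 < e -> L2 f ->
  (L2form f f < e ^+ 2) = (N2 f < e%:E)%E.
Proof. by move=> e0 lf; rewrite L2norm_lt// -L2form_norm// lte_fin. Qed.

Lemma L2form_ge0 f : 0 <= L2form f f.
Proof. by apply: Rintegral_ge0 => x _; rewrite -expr2 sqr_ge0. Qed.

Lemma L2_cauchy_schwarz f g : L2 f -> L2 g ->
  (`|(L2form f g)%:E| <= N2 f * N2 g)%E.
Proof.
move=> lf lg; have [mf _] := (L2P f).1 lf; have [mg _] := (L2P g).1 lg.
have /integrableP[mfg ffg] := L2_prod_int lf lg.
rewrite /L2form /Rintegral fineK; last exact/integrable_fin_num/L2_prod_int.
apply: (le_trans (le_abse_integral _ _ _)) => //.
rewrite -Lnorm1; apply: hoelder => //.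
by rewrite [RHS](splitr 1) !mul1r.
Qed.

Lemma Rcvg0P (u : nat -> R) : (forall e : R, 0 < e -> exists k, forall n, (k <= n)%N -> `|u n| <= e) ->
  u n @[n --> \oo] --> (0 : R).
Proof.
move=> h; apply/cvgr0Pnorm_le => e e0; have [k hk] := h e e0.
by exists k.
Qed.

Lemma L2cvg_lt (F : nat -> T -> R) f :
  (N2 (F n \- f) @[n --> \oo] --> 0)%E <->
  (forall e : R, 0 < e -> exists k, forall n, (k <= n)%N -> (N2 (F n \- f) < e%:E)%E).
Proof.
split=> [|h].
  move=> /fine_cvgP[[k1 _ f1]] /cvgr0Pnorm_lt h e e0.
  have [k2 _ f2] := h e e0.
  exists (maxn k1 k2) => n; rewrite geq_max => /andP[n1 n2].
  have := f2 n n2; rewrite /= ger0_norm ?fine_ge0//.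
  by rewrite -lte_fin fineK//; exact: f1.
apply/fine_cvgP; split.
  have [k hk] := h 1 ltr01; exists k => // n /= kn.
  by rewrite ge0_fin_numE// (lt_trans (hk n kn))// ltry.
apply: Rcvg0P => e e0; have [k hk] := h e e0; exists k => n kn /=.
rewrite ger0_norm ?fine_ge0// -lee_fin fineK; first exact/ltW/hk.
by rewrite ge0_fin_numE// (lt_trans (hk n kn))// ltry.
Qed.

Lemma L2form_cvg (F G : nat -> T -> R) f g : (forall n, L2 (F n)) ->
  (forall n, L2 (G n)) -> L2 f -> L2 g ->
  (N2 (F n \- f) @[n --> \oo] --> 0)%E -> (N2 (G n \- g) @[n --> \oo] --> 0)%E ->
  L2form (F n) (G n) @[n --> \oo] --> L2form f g.
Proof.
move=> lF lG lf lg /L2cvg_lt cF /L2cvg_lt cG.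
apply/cvgrPdistC_le => e e0.
have [_ fg] := (L2P g).1 lg; have [_ ff] := (L2P f).1 lf.
pose c := 1 + fine (N2 f) + fine (N2 g).
have c1 : 1 <= c by rewrite /c -addrA lerDl addr_ge0 ?fine_ge0.
have c0 : 0 < c by rewrite (lt_le_trans ltr01).
pose e' := Num.min 1 (e / (2 * c)).
have e'0 : 0 < e' by rewrite lt_min ltr01 divr_gt0// mulr_gt0.
have [k1 h1] := cF e' e'0; have [k2 h2] := cG e' e'0.
exists (maxn k1 k2) => // n /=; rewrite geq_max => /andP[n1 n2].
have lFf := L2B (lF n) lf; have lGg := L2B (lG n) lg.
have -> : L2form (F n) (G n) - L2form f g =
    L2form (F n \- f) (G n) + L2form f (G n \- g).
  have -> : L2form (F n) (G n) = L2form (F n \- f) (G n) + L2form f (G n).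
    rewrite -[L2form (F n \- f) _]mul1r -L2form_lin//.
    by congr L2form; apply/funext => x /=; rewrite mul1r subrK.
  have -> : L2form f (G n) = L2form f (G n \- g) + L2form f g.
    rewrite !(L2form_sym f) -[L2form (G n \- g) _]mul1r -L2form_lin//.
    by congr L2form; apply/funext => x /=; rewrite mul1r subrK.
  by rewrite addrA addrK.
apply: (le_trans (ler_normD _ _)).
have gn : (N2 (G n) <= c%:E)%E.
  have -> : G n = (G n \- g) \+ g by apply/funext => x /=; rewrite subrK.
  apply: (le_trans (minkowski_EFin _ _ _ _)); rewrite ?ler1n//; try exact: L2_measurable.
  rewrite /c [leRHS]EFinD; apply: leeD; last by rewrite fineK// ge0_fin_numE.
  apply: (le_trans (ltW (h2 n n2))); rewrite lee_fin /e' ge_min; apply/orP; left.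
  by rewrite lerDl fine_ge0.
have fc : (N2 f <= c%:E)%E.
  rewrite -(@fineK _ (N2 f)) ?ge0_fin_numE// lee_fin /c.
  by rewrite [1 + _]addrC -addrA lerDl addr_ge0// fine_ge0.
have -> : e = e / 2 + e / 2 by rewrite -splitr.
have ee : c * e' <= e / 2.
  apply: (@le_trans _ _ (c * (e / (2 * c)))); first by rewrite ler_pM2l// ge_min lexx orbT.
  by rewrite invfM [leLHS]mulrC -!mulrA mulVf ?gt_eqF// mulr1.
apply: lerD; rewrite (le_trans _ ee)// -lee_fin.
  apply: (le_trans (L2_cauchy_schwarz lFf (lG n))).
  rewrite muleC EFinM; apply: lee_pmul => //; exact/ltW/h1.
apply: (le_trans (L2_cauchy_schwarz lf lGg)).
by rewrite EFinM; apply: lee_pmul => //; exact/ltW/h2.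
Qed.

End L2_facts.

Lemma cvg_geometric_bound {R : realType} (u : nat -> R) (l M : R) :
  (forall k, `|u k - l| <= M * 2^-1 ^+ k) -> u k @[k --> \oo] --> l.
Proof.
move=> hM; apply/(subr_cvg0 (F := \oo)); apply/(norm_cvg0P (F := \oo)).
apply: (@squeeze_cvgr _ _ _ _ (cst 0) (fun k => M * 2^-1 ^+ k)).
- by apply: nearW => k /=; rewrite normr_ge0 hM.
- exact: cvg_cst.
- by apply: cvg_geometric; rewrite ger0_norm// invf_lt1// ltr1n.
Qed.

Section L2_convergence.
Context {disp : measure_display} {T : measurableType disp} {R : realType}.
Variable m : {measure set T -> \bar R}.
Implicit Types f g h : T -> R.

Local Notation N2 f := ('N[m]_2%:E [EFin \o f%R])%E.

(** Norms below this rate survive the weights 4^k: the k-th integral in [fast_sum] is at most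
    4^(k+1) 64^-(k+1) = 16^-(k+1), below the summable 2^-(k+1). *)
Definition fast (k : nat) : R := (8^-1) ^+ k.+1.

Lemma fast_gt0 k : 0 < fast k.
Proof. by rewrite exprn_gt0// invr_gt0. Qed.

(** Finiteness of this sum at x gives |D k x| <= c 2^-k, hence almost everywhere convergence; being
    integrable, it also dominates the squares of all [D k] at once. *)
Definition fast_sum (D : nat -> T -> R) (x : T) : \bar R :=
  (\sum_(k <oo) (4 ^+ k * (D k x) ^+ 2)%:E)%E.

Lemma fast_sum_integrable (D : nat -> T -> R) :
  (forall k, measurable_fun setT (D k)) ->
  (forall k, (N2 (D k) < (fast k)%:E)%E) ->
  m.-integrable setT (fast_sum D).
Proof.
move=> mD hD.
have mk k : measurable_fun setT (fun x => (4 ^+ k * (D k x) ^+ 2)%:E).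
  by apply/measurable_EFinP/measurable_funM => //; exact: measurable_funX.
have k0 k x : (0 <= (4 ^+ k * (D k x) ^+ 2)%:E)%E.
  by rewrite lee_fin mulr_ge0// ?sqr_ge0// exprn_ge0.
have S0 x : (0 <= fast_sum D x)%E by apply: nneseries_ge0 => k _ _; exact: k0.
apply/integrableP; split.
  by apply: (ge0_emeasurable_sum (P := xpredT)) => k *; [exact: k0|exact: mk].
under eq_integral do rewrite gee0_abs//.
rewrite integral_nneseries//.
apply: (@le_lt_trans _ _ (\sum_(k <oo) (1 / (2 ^ k.+1)%:R)%:E)%E); last first.
  by apply: (le_lt_trans (epsilon_trick0 _ ler01)); rewrite ltry.
apply: lee_nneseries => [k _ _|k _]; first by apply: integral_ge0 => x _; exact: k0.
under eq_integral do rewrite EFinM.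
rewrite ge0_integralZl//; first last.
- by move=> x _; rewrite lee_fin sqr_ge0.
- by apply/measurable_EFinP/measurable_funX.
have := hD k; rewrite (L2norm_lt m _ (fast_gt0 k)) => /ltW h.
apply: (@le_trans _ _ ((4 ^+ k)%:E * (fast k ^+ 2)%:E)%E).
  by apply: lee_pmul => //; rewrite ?lee_fin ?exprn_ge0// integral_ge0// => x _; rewrite lee_fin sqr_ge0.
rewrite -EFinM lee_fin mul1r natrX -exprVn.
apply: (@le_trans _ _ (4 ^+ k.+1 * fast k ^+ 2)).
  by rewrite ler_wpM2r ?sqr_ge0// exprS ler_peMl ?exprn_ge0// ler1n.
rewrite /fast -exprM mulnC exprM -exprMn lerXn2r ?nnegrE//; lra.
Qed.

Lemma fast_sum_ge D x k : ((4 ^+ k * (D k x) ^+ 2)%:E <= fast_sum D x)%E.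
Proof.
rewrite /fast_sum (@nneseriesD1 _ _ k xpredT)//= => [|i _]; last first.
  by rewrite lee_fin mulr_ge0// ?sqr_ge0// exprn_ge0.
rewrite leeDl// nneseries_ge0// => i _ _.
by rewrite lee_fin mulr_ge0// ?sqr_ge0// exprn_ge0.
Qed.

Lemma fast_ae_bound (D : nat -> T -> R) :
  (forall k, measurable_fun setT (D k)) ->
  (forall k, (N2 (D k) < (fast k)%:E)%E) ->
  {ae m, forall x, exists M : R, forall k, `|D k x| <= M * 2^-1 ^+ k}.
Proof.
move=> mD hD.
have := integrable_ae measurableT (fast_sum_integrable mD hD).
apply: filterS => x /(_ Logic.I) Sfin.
exists (Num.sqrt (fine (fast_sum D x))) => k.
have h : 4 ^+ k * (D k x) ^+ 2 <= fine (fast_sum D x).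
  by rewrite -lee_fin fineK//; exact: fast_sum_ge.
have : Num.sqrt (4 ^+ k * (D k x) ^+ 2) <= Num.sqrt (fine (fast_sum D x)).
  by rewrite ler_wsqrtr.
rewrite sqrtrM ?exprn_ge0// sqrtr_sqr.
have -> : 4 ^+ k = (2 ^+ k) ^+ 2 :> R.
  by rewrite -exprM mulnC exprM; congr (_ ^+ _); rewrite expr2; ring.
by rewrite sqrtr_sqr ger0_norm ?exprn_ge0// exprVn ler_pdivlMr ?exprn_gt0// mulrC.
Qed.

(** Of the indices only [k <= phi k] is recorded, which suffices to transfer bounds valid beyond a
    rank. *)
Lemma L2_ae_subseq (F : nat -> T -> R) f :
  (forall n, measurable_fun setT (F n)) -> measurable_fun setT f ->
  (N2 (F n \- f) @[n --> \oo] --> 0)%E ->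
  exists phi : nat -> nat, [/\ forall k, (k <= phi k)%N,
    forall k, (N2 (F (phi k) \- f) < (fast k)%:E)%E &
    {ae m, forall x, F (phi k) x @[k --> \oo] --> f x}].
Proof.
move=> mF mf /L2cvg_lt cF.
have /choice[phi hphi] k : exists n, (k <= n)%N /\ (N2 (F n \- f) < (fast k)%:E)%E.
  have [n hn] := cF _ (fast_gt0 k); exists (maxn k n); rewrite leq_maxl; split=> //.
  exact/hn/leq_maxr.
exists phi; split=> [k|k|]; try by case: (hphi k).
have mD k : measurable_fun setT (F (phi k) \- f) by exact: measurable_funB.
have := fast_ae_bound mD (fun k => (hphi k).2).
apply: filterS => x [M hM].
exact: (cvg_geometric_bound hM).
Qed.

Lemma L2_fatou (F : nat -> T -> R) f (c : R) : 0 < c ->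
  (forall n, measurable_fun setT (F n)) -> measurable_fun setT f ->
  (exists k0, forall k, (k0 <= k)%N -> (N2 (F k) < c%:E)%E) ->
  {ae m, forall x, F k x @[k --> \oo] --> f x} -> (N2 f <= c%:E)%E.
Proof.
move=> c0 mF mf [k0 hk] aeF.
(* The norms are bounded only from rank [k0] on, hence the shift. *)
pose u k x := ((F (k + k0)%N x) ^+ 2)%:E.
have u0 k x : (0 <= u k x)%E by rewrite lee_fin sqr_ge0.
have mu k : measurable_fun setT (u k) by exact/measurable_EFinP/measurable_funX.
have Q : (\int[m]_x ((f x) ^+ 2)%:E <= (c ^+ 2)%:E)%E.
  apply: (@le_trans _ _ (\int[m]_x limn_einf (u ^~ x)))%E.
    apply: ae_ge0_le_integral => //.
    - by move=> x _; rewrite lee_fin sqr_ge0.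
    - exact/measurable_EFinP/measurable_funX.
    - move=> x _; rewrite limn_einf_lim; apply: lime_ge; first exact: is_cvg_einfs.
      by apply: nearW => n; apply: le_ereal_inf_tmp => _ [k _ <-].
    - apply: measurableT_comp => //.
      by apply: measurable_fun_limn_esup => n; exact: measurableT_comp.
    - apply: filterS aeF => x cx _.
      have /cvg_limn_einf_sup[-> _] : u k x @[k --> \oo] --> ((f x) ^+ 2)%:E.
        apply/cvg_EFin; first exact: nearW.
        have cx' : F (k + k0)%N x @[k --> \oo] --> f x.
          by move: cx; rewrite -(cvg_shiftn k0).
        rewrite (_ : fine \o _ = (fun k => F (k + k0)%N x * F (k + k0)%N x)).
          by rewrite expr2; exact: cvgM.
        by apply/funext => k; rewrite /= expr2.
      by [].
  apply: (le_trans (fatou _ _ _ _)) => //.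
  rewrite limn_einf_lim; apply: lime_le; first exact: is_cvg_einfs.
  apply: nearW => n; apply: (@le_trans _ _ (\int[m]_x u n x)%E).
    by apply: ereal_inf_lbound; exists n => /=.
  by apply: ltW; rewrite -L2norm_lt//; apply: hk; rewrite leq_addl.
rewrite leNgt; apply/negP => h.
move: Q; rewrite -L2norm_sqr leNgt => /negP; apply.
rewrite (_ : (c ^+ 2)%:E = c%:E `^ 2)%E; last first.
  by rewrite poweR_EFin powR_mulrn// ltW.
have [ff|] := boolP ((N2 f)%E \is a fin_num); last first.
  rewrite ge0_fin_numE ?Lnorm_ge0// -leNgt leye_eq => /eqP ->.
  by rewrite poweRyr// poweR_EFin ltry.
move: h; rewrite -(fineK ff) !poweR_EFin !lte_fin => h.
by apply: gt0_ltr_powR => //; rewrite nnegrE ?fine_ge0 ?N2_ge0 ?(ltW c0).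
Qed.

End L2_convergence.

Lemma sqr_le_2sqrD {R : realFieldType} (a b : R) :
  a ^+ 2 <= 2 * b ^+ 2 + 2 * (a - b) ^+ 2.
Proof.
by rewrite -subr_ge0 (_ : _ - _ = (a - 2 * b) ^+ 2) ?sqr_ge0//; ring.
Qed.

Lemma sqrB_le_2sqrD {R : realFieldType} (a b : R) :
  (a - b) ^+ 2 <= 2 * a ^+ 2 + 2 * b ^+ 2.
Proof.
by rewrite -subr_ge0 (_ : _ - _ = (a + b) ^+ 2) ?sqr_ge0//; ring.
Qed.

Section L2_completeness.
Context {disp : measure_display} {T : measurableType disp} {R : realType}.
Variable m : {measure set T -> \bar R}.
Implicit Types f g h : T -> R.

Local Notation N2 f := ('N[m]_2%:E [EFin \o f%R])%E.

Lemma cvg_of_geometric_steps (u : nat -> R) (M : R) :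
  (forall k, `|u k.+1 - u k| <= M * 2^-1 ^+ k) -> cvgn u.
Proof.
move=> hM.
have cs : cvgn (series (fun k => u k.+1 - u k)).
  apply: normed_cvg; apply: (@series_le_cvg _ _ (geometric M 2^-1)) => //.
  - by move=> k /=.
  - by move=> k; apply: (le_trans _ (hM k)).
  - by apply: is_cvg_geometric_series; rewrite ger0_norm// invf_lt1// ltr1n.
have -> : u = (fun n => u 0%N + series (fun k => u k.+1 - u k) n).
  by apply/funext => n; rewrite /series /= telescope_sumr// addrC subrK.
by apply: is_cvgD => //; exact: is_cvg_cst.
Qed.

Lemma L2_ae_limit (F : nat -> T -> R) :
  (forall n, measurable_fun setT (F n)) ->
  {ae m, forall x, cvgn (F ^~ x)} ->
  exists2 f : T -> R, measurable_fun setT f & {ae m, forall x, F k x @[k --> \oo] --> f x}.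
Proof.
move=> mF [N [mN N0 subN]].
(* Setting the functions to zero on the null set [N] makes them converge everywhere, as the
   measurability of a pointwise limit requires. *)
pose G k x := F k x * \1_(~` N) x.
have mG k : measurable_fun setT (G k) by apply: measurable_funM => //; exact/measurable_indic/measurableC.
have cG x : cvgn (G ^~ x).
  have [xN|xN] := pselect (N x).
    rewrite (_ : G ^~ x = cst 0); first exact: is_cvg_cst.
    by apply/funext => k; rewrite /G /= indicE memNset ?mulr0//; apply; exact: xN.
  rewrite (_ : G ^~ x = F ^~ x).
    by apply: contrapT => nc; apply: xN; apply: subN.
  by apply/funext => k; rewrite /G /= indicE mem_set ?mulr1.
exists (fun x => limn (G ^~ x)).
  by apply: (measurable_fun_cvg mG) => x _; exact: cG.
exists N; split => // x /= h; apply: contrapT => xN; apply: h.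
rewrite (_ : F ^~ x = G ^~ x); first exact: cG.
by apply/funext => k; rewrite /G /= indicE mem_set ?mulr1.
Qed.

Lemma riesz_fischer (F : nat -> T -> R) :
  (forall n, measurable_fun setT (F n)) ->
  (forall e : R, 0 < e -> exists k, forall p q, (k <= p)%N -> (k <= q)%N ->
    (N2 (F p \- F q) < e%:E)%E) ->
  exists2 f : T -> R, measurable_fun setT f & (N2 (F n \- f) @[n --> \oo] --> 0)%E.
Proof.
move=> mF cF.
have /choice[psi hpsi] k : exists n, forall p q, (n <= p)%N -> (n <= q)%N ->
    (N2 (F p \- F q) < (fast k)%:E)%E by apply: cF; exact: fast_gt0.
(* The partial sums make the indices nondecreasing while dominating both [k] and [psi k]. *)
pose phi k := (k + \sum_(i < k.+1) psi i)%N.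
have phi_psi k : (psi k <= phi k)%N.
  by rewrite /phi big_ord_recr/= addnA leq_addl.
have phi_k k : (k <= phi k)%N by exact: leq_addr.
have phiS k : (phi k <= phi k.+1)%N.
  by rewrite /phi addSn [X in (_ <= (_ + X).+1)%N]big_ord_recr/= addnA -addnS leq_addr.
have [f mf cf] : exists2 f : T -> R, measurable_fun setT f &
    {ae m, forall x, F (phi k) x @[k --> \oo] --> f x}.
  apply: (@L2_ae_limit (fun k => F (phi k))) => //.
  have mD k : measurable_fun setT (F (phi k.+1) \- F (phi k)) by exact: measurable_funB.
  have hD k : (N2 (F (phi k.+1) \- F (phi k)) < (fast k)%:E)%E.
    by apply: hpsi => //; exact: leq_trans (phi_psi k) (phiS k).
  have := fast_ae_bound mD hD.
  by apply: filterS => x [M hM]; exact: (cvg_of_geometric_steps hM).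
exists f => //; apply/L2cvg_lt => e e0.
have [K hK] := cF (e / 2) (divr_gt0 e0 (ltr0n _ 2)).
exists K => n Kn; apply: (@le_lt_trans _ _ (e / 2)%:E); last first.
  by rewrite lte_fin gtr_pMr// invf_lt1// ltr1n.
apply: (@L2_fatou _ _ _ m (fun k => F n \- F (phi k))); first by rewrite divr_gt0.
- by move=> k; exact: measurable_funB.
- exact: measurable_funB.
- by exists K => k Kk; apply: hK => //; exact: leq_trans Kk (phi_k k).
- apply: filterS cf => x cx; apply: cvgB => //; exact: cvg_cst.
Qed.

(** The dominating functions [H k] may vary: as they converge fast in L^2, their squares are all
    below the integrable function 2 h^2 + 2 S, with S the [fast_sum] of [H k - h]. For absolute
    values the differences of a converging sequence, and not one fixed function, are the available
    bounds. *)
Lemma L2_dominated_cvg (G H : nat -> T -> R) g h :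
  (forall k, measurable_fun setT (G k)) -> measurable_fun setT g ->
  (forall k, measurable_fun setT (H k)) -> L2 m h ->
  (forall k, (N2 (H k \- h) < (fast k)%:E)%E) ->
  (forall k x, `|G k x| <= `|H k x|) ->
  {ae m, forall x, G k x @[k --> \oo] --> g x} ->
  (N2 (G k \- g) @[k --> \oo] --> 0)%E.
Proof.
move=> mG mg mH lh hD GH cG.
have mh := L2_measurable lh.
have mD k : measurable_fun setT (H k \- h) by exact: measurable_funB.
have iS := fast_sum_integrable mD hD.
pose S := fast_sum (fun k => H k \- h).
(* The constant comes from (G k - g)^2 <= 2 (G k)^2 + 2 g^2, where each square is at most 2 h^2 + 2
   S. *)
pose dom x := ((8 * (h x) ^+ 2)%:E + 8%:E * S x)%E.
have idom : m.-integrable setT dom.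
  apply: integrableD => //; last exact: integrableZl.
  have := integrableZl measurableT 8 (L2_prod_int lh lh).
  by apply: eq_integrable => // x _ /=; rewrite -EFinM expr2.
have Hb k x : (((H k x) ^+ 2)%:E <= (2 * (h x) ^+ 2)%:E + 2%:E * S x)%E.
  apply: (@le_trans _ _ ((2 * (h x) ^+ 2)%:E + 2%:E * ((H k x - h x) ^+ 2)%:E))%E.
    by rewrite -EFinM -EFinD lee_fin sqr_le_2sqrD.
  apply: leeD => //; apply: lee_wpmul2l => //.
  apply: le_trans (fast_sum_ge (fun k => H k \- h) x k).
  by rewrite lee_fin ler_peMl ?sqr_ge0// exprn_ege1// ler1n.
have mGg k : measurable_fun setT (fun x => (((G k \- g) x) ^+ 2)%:E).
  by apply/measurable_EFinP/measurable_funX/measurable_funB.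
have [] := @dominated_convergence _ _ _ m _ measurableT
  (fun k x => (((G k \- g) x) ^+ 2)%:E) (cst 0%E) dom mGg _ _ idom _ => //.
- apply: filterS cG => x cx _.
  apply/cvg_EFin; first exact: nearW.
  have c0 : (G k x - g x) @[k --> \oo] --> (0 : R).
    by apply/(subr_cvg0 (F := \oo)).
  rewrite (_ : fine \o _ = (fun k => (G k x - g x) * (G k x - g x))).
    by rewrite -[X in _ --> X](mulr0 (0 : R)); exact: cvgM.
  by apply/funext => k; rewrite /= expr2.
- apply: filterS cG => x cx k _.
  rewrite gee0_abs ?lee_fin ?sqr_ge0//.
  have Gb j : (((G j x) ^+ 2)%:E <= (2 * (h x) ^+ 2)%:E + 2%:E * S x)%E.
    apply: le_trans (Hb j x).
    by rewrite lee_fin -[leLHS]real_normK ?num_real// -[leRHS]real_normK ?num_real// lerXn2r ?nnegrE.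
  have gb : (((g x) ^+ 2)%:E <= (2 * (h x) ^+ 2)%:E + 2%:E * S x)%E.
    have cx2 : ((G j x) ^+ 2)%:E @[j --> \oo] --> ((g x) ^+ 2)%:E.
      apply/cvg_EFin; first exact: nearW.
      rewrite (_ : fine \o _ = (fun k => G k x * G k x)).
        by rewrite expr2; exact: cvgM.
      by apply/funext => j; rewrite /= expr2.
    rewrite -(cvg_lim _ cx2)//; apply: lime_le; first by apply/cvg_ex; exists ((g x) ^+ 2)%:E.
    exact: nearW.
  apply: (@le_trans _ _ (2%:E * ((G k x) ^+ 2)%:E + 2%:E * ((g x) ^+ 2)%:E)%E).
    by rewrite -!EFinM -EFinD lee_fin /= sqrB_le_2sqrD.
  have S0 : (0 <= S x)%E by apply: (le_trans _ (fast_sum_ge _ x 0%N)); rewrite lee_fin mulr_ge0// sqr_ge0.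
  apply: (@le_trans _ _ (2%:E * ((2 * (h x) ^+ 2)%:E + 2%:E * S x) + 2%:E * ((2 * (h x) ^+ 2)%:E + 2%:E * S x)))%E.
    by apply: leeD; apply: lee_wpmul2l.
  rewrite /dom; move: (S x) S0 => [s|//|//] _; last first.
    by rewrite [X in (_ <= _ + X)%E]gt0_muley ?lte_fin// addey// leey.
  rewrite -!(EFinM, EFinD) lee_fin; lra.
- move=> _ cI _; apply/L2cvg_lt => e e0.
  move: cI => /fine_cvgP[[k1 _ f1]] /cvgr0Pnorm_lt /(_ _ (exprn_gt0 2 e0))[k2 _ f2].
  exists (maxn k1 k2) => n; rewrite geq_max => /andP[n1 n2].
  have := f2 n n2; rewrite /= ger0_norm; last by rewrite fine_ge0// integral_ge0.
  rewrite L2norm_lt// -lte_fin fineK; last exact: f1.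
  congr (_ < _)%E; apply: eq_integral => x _.
  by rewrite /= subr0 ger0_norm// sqr_ge0.
Qed.

End L2_completeness.

Lemma lte_half {R : realType} (x y : \bar R) (e : R) :
  (x < (e / 2)%:E -> y < (e / 2)%:E -> x + y < e%:E)%E.
Proof. by move=> xe ye; rewrite [in e%:E](splitr e) EFinD; exact: lteD. Qed.

Section L2_more.
Context {R : realType}.

Lemma L2cvg_cauchy d (U : measurableType d) (m : {measure set U -> \bar R})
    (f : nat -> U -> R) (g : U -> R) : (forall n, measurable_fun setT (f n)) ->
  measurable_fun setT g -> ('N[m]_2%:E [EFin \o (f n \- g)%R] @[n --> \oo] --> 0)%E ->
  forall e : R, 0 < e -> exists k, forall p q, (k <= p)%N -> (k <= q)%N ->
    ('N[m]_2%:E [EFin \o (f p \- f q)%R] < e%:E)%E.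
Proof.
move=> mf mg /L2cvg_lt c e e0; have [k hk] := c (e / 2) (divr_gt0 e0 (ltr0n _ 2)).
exists k => p q kp kq; apply: (le_lt_trans (L2_triangle m (mf p) mg (mf q))).
apply: lte_half; first exact: hk.
by rewrite L2normB; exact: hk.
Qed.

Lemma L2cvg_lin d (U : measurableType d) (m : {measure set U -> \bar R}) (a : R)
    (f g : nat -> U -> R) (f0 g0 : U -> R) :
  (forall n, L2 m (f n)) -> (forall n, L2 m (g n)) -> L2 m f0 -> L2 m g0 ->
  ('N[m]_2%:E [EFin \o (f n \- f0)%R] @[n --> \oo] --> 0)%E ->
  ('N[m]_2%:E [EFin \o (g n \- g0)%R] @[n --> \oo] --> 0)%E ->
  ('N[m]_2%:E [EFin \o ((fun x => a * f n x + g n x) \- (fun x => a * f0 x + g0 x))%R]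
    @[n --> \oo] --> 0)%E.
Proof.
move=> lf lg lf0 lg0 /L2cvg_lt cf /L2cvg_lt cg; apply/L2cvg_lt => e e0.
pose c := e / 2 / (`|a| + 1).
have c0 : 0 < c by rewrite /c !divr_gt0// ltr_wpDl.
have [k1 h1] := cf c c0; have [k2 h2] := cg (e / 2) (divr_gt0 e0 (ltr0n _ 2)).
exists (maxn k1 k2) => n; rewrite geq_max => /andP[n1 n2].
rewrite (_ : _ \- _ = (fun x => a * (f n \- f0) x) \+ (g n \- g0)); last first.
  by apply/funext => x /=; ring.
apply: (le_lt_trans (minkowski_EFin _ _ _ _)); rewrite ?ler1n//.
- by apply: measurable_funM => //; exact: (L2_measurable (L2B (lf n) lf0)).
- exact: (L2_measurable (L2B (lg n) lg0)).
apply: lte_half; last exact: h2.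
have lff := L2B (lf n) lf0.
have e20 : 0 < e / 2 by rewrite divr_gt0.
rewrite L2norm_lt//; under eq_integral do rewrite exprMn EFinM.
rewrite ge0_integralZl//=; first last.
- by rewrite lee_fin sqr_ge0.
- by move=> x _; rewrite lee_fin sqr_ge0.
- by apply/measurable_EFinP/measurable_funX; exact: L2_measurable lff.
have := h1 n n1; rewrite L2norm_lt// -L2form_norm//.
rewrite -EFinM !lte_fin => h.
apply: (@le_lt_trans _ _ ((`|a| + 1) ^+ 2 * L2form m (f n \- f0) (f n \- f0))).
  apply: ler_wpM2r; first exact: L2form_ge0.
  by rewrite -(@real_normK _ a) ?num_real// lerXn2r ?nnegrE ?addr_ge0// lerDl.
rewrite (_ : (e / 2) ^+ 2 = (`|a| + 1) ^+ 2 * c ^+ 2).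
  by rewrite ltr_pM2l// exprn_gt0// ltr_wpDl.
by rewrite -exprMn /c [X in _ = X ^+ 2]mulrC divfK// gt_eqF// ltr_wpDl.
Qed.

Lemma L2_le d (U : measurableType d) (m : {measure set U -> \bar R}) (f g : U -> R) :
  measurable_fun setT f -> L2 m g -> (forall x, `|f x| <= `|g x|) ->
  L2 m f /\ ('N[m]_2%:E [EFin \o f] <= 'N[m]_2%:E [EFin \o g])%E.
Proof.
move=> mf lg fg; have mg := L2_measurable lg.
have le : ('N[m]_2%:E [EFin \o f] <= 'N[m]_2%:E [EFin \o g])%E.
  rewrite unlock; apply: gt0_ler_poweR; rewrite ?in_itv/= ?leey ?integral_ge0//.
  apply: ge0_le_integral => //.
  - by apply/measurable_EFinP/(measurableT_comp (measurable_powR 2))/measurableT_comp.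
  - by apply/measurable_EFinP/(measurableT_comp (measurable_powR 2))/measurableT_comp.
  - by move=> x _ /=; rewrite lee_fin ge0_ler_powR// nnegrE.
split => //; apply/L2P; split => //.
by apply: (le_lt_trans le); have [] := (L2P m g).1 lg.
Qed.

End L2_more.

(** * Closure of the form of a difference operator *)

Section difference_form.
Context {d1 d2 : measure_display} {T : measurableType d1} {S : measurableType d2}
  {R : realType}.
Variables (mu : probability T R) (nu : {measure set S -> \bar R}) (tau pi : S -> T).
Hypothesis mtau : measurable_fun setT tau.
Hypothesis mpi : measurable_fun setT pi.
Hypothesis tau_null : forall N, measurable N -> mu N = 0%E -> nu (tau @^-1` N) = 0%E.
Hypothesis pi_null : forall N, measurable N -> mu N = 0%E -> nu (pi @^-1` N) = 0%E.
Implicit Types F G H : T -> R.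

(** In the application [nu] is the Campbell measure, [tau (g, x)] is g without x, and [pi (g, x)] is
    g. *)
Definition diff_op F : S -> R := fun s => F (tau s) - F (pi s).
Local Notation D := diff_op.
Local Notation M f := ('N[mu]_2%:E [EFin \o f%R])%E.
Local Notation N f := ('N[nu]_2%:E [EFin \o f%R])%E.

Variables (C : set (T -> R)) (E : (T -> R) -> (T -> R) -> R).
Hypothesis C_lin : forall a F G, C F -> C G -> C (fun x => a * F x + G x).
Hypothesis C_cst : forall a, C (cst a).
Hypothesis C_L2 : forall F, C F -> L2 mu F.
Hypothesis C_D : forall F, C F -> L2 nu (D F).
Hypothesis E_D : forall F G, C F -> C G -> E F G = L2form nu (D F) (D G).
Hypothesis C_dense : forall F, L2 mu F -> forall e : R, 0 < e ->
  exists2 G, C G & (M (F \- G) < e%:E)%E.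
Hypothesis C_abs : forall F, C F -> exists G : nat -> T -> R,
  [/\ forall k, C (G k), forall k x, `|G k x - `|F x| | <= 2^-1 ^+ k &
    forall k x y, `|G k x - G k y| <= `|F x - F y|].

Lemma diff_ae (P : T -> Prop) : {ae mu, forall x, P x} ->
  {ae nu, forall s, P (tau s) /\ P (pi s)}.
Proof.
move=> [B [mB B0 subB]]; exists (tau @^-1` B `|` pi @^-1` B); split.
- by apply: measurableU; rewrite -[X in measurable X]setTI; [exact: mtau|exact: mpi].
- rewrite measureU0; first exact: tau_null.
  + by rewrite -[X in measurable X]setTI; exact: mtau.
  + by rewrite -[X in measurable X]setTI; exact: mpi.
  + exact: pi_null.
- move=> s /= /not_andP[h|h]; [left|right]; exact: subB.
Qed.

Lemma measurable_D F : measurable_fun setT F -> measurable_fun setT (D F).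
Proof. by move=> mF; apply: measurable_funB; exact: measurableT_comp. Qed.

Lemma D_lin a F G : D (fun x => a * F x + G x) = (fun s => a * D F s + D G s).
Proof. by apply/funext => s; rewrite /D; ring. Qed.

Lemma D_sub F G : D (F \- G) = D F \- D G.
Proof. by apply/funext => s; rewrite /D /=; ring. Qed.

Lemma D_ae F G : F = G %[ae mu] -> D F = D G %[ae nu].
Proof. by move=> /diff_ae; apply: filterS => s /= [h1 h2] _; rewrite /D h1// h2. Qed.

Lemma D_cvg_ae (Fn : nat -> T -> R) F :
  {ae mu, forall x, Fn k x @[k --> \oo] --> F x} ->
  {ae nu, forall s, D (Fn k) s @[k --> \oo] --> D F s}.
Proof. by move=> /diff_ae; apply: filterS => s /= [h1 h2]; exact: cvgB. Qed.

Lemma C_sub F G : C F -> C G -> C (F \- G).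
Proof.
move=> CF CG; have := C_lin (-1) CG CF; congr C.
by apply/funext => x /=; ring.
Qed.

(* Closability: along a subsequence converging almost everywhere the differences
   converge nu-almost everywhere to those of the limit. *)
Lemma D_closed (Fn : nat -> T -> R) F :
  (forall n, L2 mu (Fn n)) -> measurable_fun setT F -> (forall n, L2 nu (D (Fn n))) ->
  (M (Fn n \- F) @[n --> \oo] --> 0)%E ->
  (forall e : R, 0 < e -> exists k, forall p q, (k <= p)%N -> (k <= q)%N ->
    (N (D (Fn p) \- D (Fn q)) < e%:E)%E) ->
  L2 nu (D F) /\ (N (D (Fn n) \- D F) @[n --> \oo] --> 0)%E.
Proof.
move=> lFn mF lDn cF cD.
have mFn n : measurable_fun setT (Fn n) by exact: L2_measurable (lFn n).
have [phi [phi_ge _ ae_phi]] := L2_ae_subseq mFn mF cF.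
have aeD := D_cvg_ae ae_phi.
have key e : 0 < e -> exists k, forall n, (k <= n)%N -> (N (D (Fn n) \- D F) <= e%:E)%E.
  move=> e0; have [K hK] := cD e e0; exists K => n Kn.
  apply: (@L2_fatou _ _ _ nu (fun k => D (Fn n) \- D (Fn (phi k)))) => //.
  - by move=> k; apply: measurable_funB; exact: measurable_D.
  - by apply: measurable_funB; exact: measurable_D.
  - by exists K => k Kk; apply: hK => //; exact: leq_trans Kk (phi_ge k).
  - by apply: filterS aeD => s cs; apply: cvgB => //; exact: cvg_cst.
split.
  have [k hk] := key 1 ltr01.
  apply: (L2_near (lDn k)); first exact: measurable_D.
  by rewrite L2normB (le_lt_trans (hk k (leqnn k)))// ltry.
apply/L2cvg_lt => e e0; have [k hk] := key (e / 2) (divr_gt0 e0 (ltr0n _ 2)).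
exists k => n kn; apply: (le_lt_trans (hk n kn)).
by rewrite lte_fin gtr_pMr// invf_lt1// ltr1n.
Qed.

Lemma form_cauchyP (Fn : nat -> T -> R) : (forall n, C (Fn n)) ->
  form_cauchy E Fn <->
  (forall e : R, 0 < e -> exists k, forall p q, (k <= p)%N -> (k <= q)%N ->
    (N (D (Fn p) \- D (Fn q)) < e%:E)%E).
Proof.
move=> CF; have key p q (e : R) : 0 < e ->
    (E (Fn p \- Fn q) (Fn p \- Fn q) < e ^+ 2) = (N (D (Fn p) \- D (Fn q)) < e%:E)%E.
  move=> e0; rewrite E_D; try exact: C_sub.
  by rewrite D_sub L2form_lt//; apply: L2B; exact: C_D.
split=> h e e0.
  have [k hk] := h (e ^+ 2) (exprn_gt0 2 e0); exists k => p q kp kq.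
  by rewrite -key//; exact: hk.
have se0 : 0 < Num.sqrt e by rewrite sqrtr_gt0.
have [k hk] := h _ se0; exists k => p q kp kq.
by rewrite -(@sqr_sqrtr _ e) ?ltW// key//; exact: hk.
Qed.

(** Closability turns the Cauchy condition on the form into convergence of [D (Fn n)] to [D F]; from
    here on the closure of the form is handled as the closure of the graph of [D]. *)
Lemma approximatesP (Fn : nat -> T -> R) F : L2 mu F ->
  approximates mu C E Fn F <->
  [/\ forall n, C (Fn n), (M (Fn n \- F) @[n --> \oo] --> 0)%E, L2 nu (D F) &
    (N (D (Fn n) \- D F) @[n --> \oo] --> 0)%E].
Proof.
move=> lF; split=> [[CF cF /(form_cauchyP CF) fc]|[CF cF lD cD]].
  have [lD cD] := D_closed (fun n => C_L2 (CF n)) (L2_measurable lF)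
    (fun n => C_D (CF n)) cF fc.
  by [].
split => //; apply/form_cauchyP => //; apply: L2cvg_cauchy cD.
  by move=> n; exact: L2_measurable (C_D (CF n)).
exact: L2_measurable lD.
Qed.

Local Notation dom := (closure_dom mu C E).
Local Notation form := (closure_form mu C E).

Lemma domP F : dom F <-> L2 mu F /\ L2 nu (D F) /\
  exists Fn, [/\ forall n, C (Fn n), (M (Fn n \- F) @[n --> \oo] --> 0)%E &
    (N (D (Fn n) \- D F) @[n --> \oo] --> 0)%E].
Proof.
split=> [[lF [Fn /(approximatesP _ lF)[CF cF lD cD]]]|[lF [lD [Fn [CF cF cD]]]]].
  by split=> //; split=> //; exists Fn.
by split=> //; exists Fn; apply/approximatesP.
Qed.

(** Along any approximating sequences the values of [E] converge to this number, so it belongs to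
    the set from which [xget] chooses; the sequences provided by membership in [dom] make it the
    only element. *)
Lemma formE F G : dom F -> dom G -> form F G = L2form nu (D F) (D G).
Proof.
move=> [lF [Fn aF]] [lG [Gn aG]]; rewrite /closure_form.
set P := (X in xget _ X).
have Pl : P (L2form nu (D F) (D G)).
  move=> {Fn aF Gn aG} Fn Gn /(approximatesP _ lF)[CF cF lDF cDF] /(approximatesP _ lG)[CG cG lDG cDG].
  rewrite (_ : (fun n => E (Fn n) (Gn n)) = (fun n => L2form nu (D (Fn n)) (D (Gn n)))).
    by apply: L2form_cvg => // n; exact: C_D.
  by apply/funext => n; rewrite E_D.
have := xgetPex 0 (ex_intro _ _ Pl) => Px.
exact: (cvg_unique _ (Px _ _ aF aG) (Pl _ _ aF aG)).
Qed.

(** Diagonal argument: each [Fn n] is replaced by a function of [C] within 2^-n of it in both norms,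
    so approximating sequences may themselves be taken in the closure. *)
Lemma dom_closed (Fn : nat -> T -> R) F : (forall n, dom (Fn n)) -> L2 mu F ->
  L2 nu (D F) -> (M (Fn n \- F) @[n --> \oo] --> 0)%E ->
  (N (D (Fn n) \- D F) @[n --> \oo] --> 0)%E -> dom F.
Proof.
move=> dF lF lD /L2cvg_lt cF /L2cvg_lt cD; apply/domP; split=> //; split=> //.
have /choice[Gn hG] n : exists G, [/\ C G, (M (G \- Fn n) < (2^-1 ^+ n)%:E)%E &
    (N (D G \- D (Fn n)) < (2^-1 ^+ n)%:E)%E].
  have /domP[_ [_ [Hn [CH /L2cvg_lt cH /L2cvg_lt cDH]]]] := dF n.
  have e0 : 0 < 2^-1 ^+ n :> R by rewrite exprn_gt0// invr_gt0.
  have [k1 h1] := cH _ e0; have [k2 h2] := cDH _ e0.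
  by exists (Hn (maxn k1 k2)); split=> //; [apply: h1|apply: h2]; rewrite ?leq_maxl ?leq_maxr.
have small (e : R) : 0 < e -> exists k, forall n, (k <= n)%N -> 2^-1 ^+ n < e.
  move=> e0; have : (2^-1 ^+ n : R) @[n --> \oo] --> (0 : R).
    rewrite (_ : (fun n => _) = geometric 1 2^-1); last by apply/funext => n; rewrite /geometric /= mul1r.
    by apply: cvg_geometric; rewrite ger0_norm// invf_lt1// ltr1n.
  move=> /cvgr0Pnorm_lt /(_ e e0)[k _ hk]; exists k => n kn.
  by have := hk n kn; rewrite /= ger0_norm// exprn_ge0.
have key d (U : measurableType d) (m : {measure set U -> \bar R}) (g f : nat -> U -> R) (h : U -> R) :
    (forall n, measurable_fun setT (g n)) -> (forall n, measurable_fun setT (f n)) ->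
    measurable_fun setT h ->
    (forall n, ('N[m]_2%:E [EFin \o (g n \- f n)%R] < (2^-1 ^+ n)%:E)%E) ->
    (forall e : R, 0 < e -> exists k, forall n, (k <= n)%N ->
      ('N[m]_2%:E [EFin \o (f n \- h)%R] < e%:E)%E) ->
    ('N[m]_2%:E [EFin \o (g n \- h)%R] @[n --> \oo] --> 0)%E.
  move=> mg mf mh gf fh; apply/L2cvg_lt => e e0.
  have e20 : 0 < e / 2 by rewrite divr_gt0.
  have [k1 h1] := small _ e20; have [k2 h2] := fh _ e20.
  exists (maxn k1 k2) => n; rewrite geq_max => /andP[n1 n2].
  apply: (le_lt_trans (L2_triangle m (mg n) (mf n) mh)).
  apply: lte_half; last exact: h2.
  by apply: (lt_trans (gf n)); rewrite lte_fin; exact: h1.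
have mFn n : measurable_fun setT (Fn n).
  by have /domP[/L2_measurable] := dF n.
have mGn n : measurable_fun setT (Gn n).
  by have [/C_L2/L2_measurable] := hG n.
exists Gn; split.
- by move=> n; have [] := hG n.
- apply: (key _ _ _ _ Fn) => //; first exact: L2_measurable lF.
  by move=> n; have [] := hG n.
- apply: (key _ _ _ (D \o Gn) (D \o Fn)) => //.
  + by move=> n; exact: measurable_D.
  + by move=> n; exact: measurable_D.
  + exact: L2_measurable lD.
  + by move=> n; have [] := hG n.
Qed.

Lemma C_dom F : C F -> dom F.
Proof.
move=> CF; apply/domP; split; first exact: C_L2.
split; first exact: C_D.
have c0 d (U : measurableType d) (m : {measure set U -> \bar R}) (g : U -> R) :
    ('N[m]_2%:E [EFin \o (g \- g)%R] @[n --> \oo] --> 0)%E.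
  rewrite (_ : EFin \o (g \- g) = cst 0%E); last by apply/funext => x /=; rewrite subrr.
  by rewrite Lnorm0 ?eqe ?gt_eqF//; exact: cvg_cst.
by exists (fun=> F); split => //; exact: c0.
Qed.

Lemma dom_lin a F G : dom F -> dom G -> dom (fun x => a * F x + G x).
Proof.
move=> /domP[lF [lDF [Fn [CF cF cDF]]]] /domP[lG [lDG [Gn [CG cG cDG]]]].
apply/domP; split; first exact: L2_lin.
split; first by rewrite D_lin; exact: L2_lin.
exists (fun n x => a * Fn n x + Gn n x); split.
- by move=> n; exact: C_lin.
- by apply: L2cvg_lin => // n; exact: C_L2.
- rewrite (_ : (fun n => _) = (fun n => 'N[nu]_2%:E[EFin \o ((fun x => a * D (Fn n) x + D (Gn n) x) \-
      (fun x => a * D F x + D G x))%R])%E).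
    by apply: L2cvg_lin => // n; exact: C_D.
  by apply/funext => n; rewrite !D_lin.
Qed.

(** The approximations of |F| in [C] increase no difference, so their images under [D] converge
    pointwise and are dominated by [D F]; here the dominating sequence is constant. *)
Lemma C_abs_dom F : C F -> dom (fun x => `|F x|).
Proof.
move=> CF; have [G [CG GF GL]] := C_abs CF.
have lF := C_L2 CF; have mF := L2_measurable lF.
have mA : measurable_fun setT (fun x => `|F x|) by exact: measurableT_comp.
have [lA _] := L2_le mA lF (fun x => ltac:(by rewrite normr_id)).
have cptw x : G k x @[k --> \oo] --> `|F x|.
  by apply: (@cvg_geometric_bound _ _ _ 1) => k; rewrite mul1r.
have DA : forall s, `|D (fun x => `|F x|) s| <= `|D F s|.
  by move=> s; exact: ler_dist_dist.
have [lDA _] := L2_le (measurable_D mA) (C_D CF) DA.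
apply/domP; split => //; split => //; exists G; split => //.
- apply/L2cvg_lt => e e0.
  have /cvgr0Pnorm_lt /(_ e e0)[k _ hk] : geometric 1 (2^-1 : R) k @[k --> \oo] --> (0 : R).
    by apply: cvg_geometric; rewrite ger0_norm// invf_lt1// ltr1n.
  exists k => n kn; rewrite L2norm_lt//.
  have mGA : measurable_fun setT (G n \- (fun x => `|F x|)).
    by apply: measurable_funB => //; exact: L2_measurable (C_L2 (CG n)).
  apply: (@le_lt_trans _ _ (\int[mu]_x ((2^-1 ^+ n) ^+ 2)%:E)%E).
    apply: ge0_le_integral => //.
    + by move=> x _; rewrite lee_fin; exact: sqr_ge0.
    + exact/measurable_EFinP/measurable_funX.
    + move=> x _; rewrite lee_fin -[leLHS]real_normK ?num_real//.
      by apply: lerXn2r (GF n x); rewrite nnegrE// exprn_ge0// invr_ge0.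
  rewrite integral_cst// [X in (_ * X < _)%E]probability_setT mule1 lte_fin.
  rewrite ltr_pXn2r ?nnegrE ?exprn_ge0 ?invr_ge0 ?(ltW e0)//.
  by have := hk n kn; rewrite /geometric /= mul1r ger0_norm// exprn_ge0.
- apply: (L2_dominated_cvg (H := fun=> D F) (h := D F)).
  + by move=> k; apply: measurable_D; exact: L2_measurable (C_L2 (CG k)).
  + exact: measurable_D.
  + by move=> k; exact: measurable_D.
  + exact: C_D.
  + move=> k; rewrite (_ : EFin \o (D F \- D F)%R = cst 0%E); last first.
      by apply/funext => x /=; rewrite subrr.
    by rewrite Lnorm0 ?eqe ?gt_eqF// lte_fin fast_gt0.
  + by move=> k s; exact: GL.
  + by apply: aeW => s; apply: cvgB; exact: cptw.
Qed.

(** Two successive extractions are made: the first for almost everywhere convergence of the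
    functions, the second for fast convergence of their images under [D], which then dominate the
    images of the absolute values. *)
Lemma dom_abs F : dom F -> dom (fun x => `|F x|).
Proof.
move=> /domP[lF [lDF [Fn [CF cF cD]]]].
have mF := L2_measurable lF.
have mFn n : measurable_fun setT (Fn n) by exact: L2_measurable (C_L2 (CF n)).
have [phi [phi_ge phi_fast ae_phi]] := L2_ae_subseq mFn mF cF.
have cD' : (N (D (Fn (phi n)) \- D F) @[n --> \oo] --> 0)%E.
  move/L2cvg_lt: cD => cD; apply/L2cvg_lt => e e0; have [k hk] := cD e e0.
  by exists k => n kn; apply: hk; exact: leq_trans kn (phi_ge n).
have [psi [psi_ge psi_fast _]] := L2_ae_subseq (F := fun n => D (Fn (phi n)))
  (fun n => measurable_D (mFn _)) (measurable_D mF) cD'.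
pose H k := Fn (phi (psi k)).
have aeH : {ae mu, forall x, H k x @[k --> \oo] --> F x}.
  apply: filterS ae_phi => x cx; apply: (cvg_comp psi _ _ cx).
  move=> A [n _ nA]; exists n => // k /= nk; apply: nA => /=.
  exact: leq_trans nk (psi_ge k).
have mA : measurable_fun setT (fun x => `|F x|) by exact: measurableT_comp.
have [lA _] := L2_le mA lF (fun x => ltac:(by rewrite normr_id)).
have DA G : forall s, `|D (fun x => `|G x|) s| <= `|D G s|.
  by move=> s; exact: ler_dist_dist.
have [lDA _] := L2_le (measurable_D mA) lDF (DA F).
apply: (@dom_closed (fun k x => `|H k x|)) => //.
- by move=> k; exact/C_abs_dom/CF.
- apply/L2cvg_lt => e e0; move/L2cvg_lt: cF => /(_ e e0)[k hk].
  exists k => n kn.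
  have lHF : L2 mu (H n \- F) by exact: L2B (C_L2 (CF _)) lF.
  have mHA : measurable_fun setT ((fun x => `|H n x|) \- (fun x => `|F x|)).
    by apply: measurable_funB => //; apply: measurableT_comp => //; exact: mFn.
  have [_ /le_lt_trans ->//] := L2_le mHA lHF (fun x => ler_dist_dist _ _).
  by apply: hk; apply: (leq_trans kn); exact: leq_trans (psi_ge n) (phi_ge _).
- apply: (L2_dominated_cvg (H := fun k => D (H k)) (h := D F)) => //.
  + by move=> k; apply: measurable_D; apply: measurableT_comp => //; exact: mFn.
  + exact: measurable_D.
  + by move=> k; apply: measurable_D; exact: mFn.
  + by apply: (@D_cvg_ae (fun k x => `|H k x|) (fun x => `|F x|)); apply: filterS aeH => x; exact: cvg_norm.
Qed.

(** Both truncations are linear in absolute values: max(0, F) = (F + |F|) / 2, then min(P, 1) = (P +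
    1 - |P - 1|) / 2, which uses that constants belong to [C]. *)
Lemma dom_cut F : dom F -> dom (fun x => Num.min (Num.max 0 (F x)) 1).
Proof.
move=> dF.
have dP : dom (fun x => Num.max 0 (F x)).
  have := dom_lin 2^-1 (dom_lin 1 dF (dom_abs dF)) (C_dom (C_cst 0)).
  congr dom; apply/funext => x /=; rewrite addr0 mul1r.
  by case: (lerP 0 (F x)) => F0; [rewrite ger0_norm//; lra|rewrite ltr0_norm//; lra].
pose P x := Num.max 0 (F x).
have dP1 : dom (fun x => 1 * P x + -1) by exact: dom_lin dP (C_dom (C_cst (-1))).
have := dom_lin 2^-1 (dom_lin (-1) (dom_abs dP1) (dom_lin 1 dP (C_dom (C_cst 1)))) (C_dom (C_cst 0)).
congr dom; apply/funext => x /=; rewrite -/(P x) addr0 !mul1r.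
by case: (lerP (P x) 1) => P1; lra.
Qed.

Lemma ler_dist_cut (a b : R) :
  `|Num.min (Num.max 0 a) 1 - Num.min (Num.max 0 b) 1| <= `|a - b|.
Proof.
have m01 : Num.min 0 1 = 0 :> R by rewrite min_l.
by case: (lerP 0 a) => a0; case: (lerP 0 b) => b0; rewrite ?m01;
  case: (lerP a 1) => a1; case: (lerP b 1) => b1; case: (ler0P (a - b)) => ab;
  try (rewrite ler_norml; apply/andP; split); lra.
Qed.

Lemma closure_dirichlet : dirichlet_form mu dom form.
Proof.
split.
- by move=> F [].
- move=> F G dF lG FG.
  (* A sequence approximating [F] also approximates [G], since the norms ignore null sets of [mu],
     and [D F], [D G] agree outside a null set of [nu]. *)
  have dG : dom G.
    have /domP[lF [lDF [Fn [CF cF cD]]]] := dF.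
    have mG := L2_measurable lG.
    have mF := L2_measurable lF.
    have mFn n : measurable_fun setT (Fn n) by exact: L2_measurable (C_L2 (CF n)).
    have eqN d (U : measurableType d) (m : {measure set U -> \bar R}) (f g h : U -> R) :
        measurable_fun setT f -> measurable_fun setT g -> measurable_fun setT h ->
        g = h %[ae m] ->
        'N[m]_2%:E[EFin \o (f \- g)%R]%E = 'N[m]_2%:E[EFin \o (f \- h)%R]%E.
      move=> mf mg mh gh; rewrite unlock; congr (_ `^ _)%E.
      have mm k : measurable_fun setT k -> measurable_fun setT (fun x => `|(EFin \o (f \- k)%R) x| `^ 2)%E.
        move=> mk; apply/measurable_EFinP/(measurableT_comp (measurable_powR 2)).
        by apply: measurableT_comp => //; exact: measurable_funB.
      apply: ge0_ae_eq_integral => //; try exact: mm.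
      + by move=> x _; exact: poweR_ge0.
      + by move=> x _; exact: poweR_ge0.
      + by apply: filterS gh => x /(_ Logic.I) /= -> _.
    have DFG : D F = D G %[ae nu] by exact: D_ae.
    apply/domP; split=> //; split.
      apply: (L2_near lDF); first exact: measurable_D.
      rewrite L2normB (eqN _ _ _ (D F) (D G) (D F))//; try exact: measurable_D; last exact: ae_eq_sym.
      rewrite (_ : _ \o _ = cst 0%E); last by apply/funext => x /=; rewrite subrr.
      by rewrite Lnorm0// eqe gt_eqF.
    exists Fn; split => //.
      by rewrite (_ : (fun n => _) = (fun n => M (Fn n \- F)))//; apply/funext => n; rewrite (eqN _ _ _ _ G F)//; exact: ae_eq_sym.
    rewrite (_ : (fun n => _) = (fun n => N (D (Fn n) \- D F)))//; apply/funext => n.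
    by rewrite (eqN _ _ _ _ (D G) (D F))//; try exact: measurable_D; exact: ae_eq_sym.
  split=> // H dH; rewrite !formE//.
  have /domP[_ [lDF _]] := dF; have /domP[_ [lDG _]] := dG; have /domP[_ [lDH _]] := dH.
  congr fine; apply: ae_eq_integral => //.
  + exact: measurable_int (L2_prod_int lDF lDH).
  + exact: measurable_int (L2_prod_int lDG lDH).
  + by apply: filterS (D_ae FG) => s /(_ Logic.I) /= -> _.
- exact: C_dom.
- by move=> a F G; exact: dom_lin.
- move=> a F G H dF dG dH; rewrite !formE//; last exact: dom_lin.
  have /domP[_ [lDF _]] := dF; have /domP[_ [lDG _]] := dG; have /domP[_ [lDH _]] := dH.
  by rewrite D_lin L2form_lin.
- by move=> F G dF dG; rewrite !formE// L2form_sym.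
- by move=> F dF; rewrite formE// L2form_ge0.
- move=> F lF e e0; have [G CG FG] := C_dense lF e0.
  by exists G => //; exact: C_dom.
(* Closedness: completeness of L^2(mu) provides the limit, and closedness of [D] identifies the
   limit of the differences. *)
- move=> Fn dF cF fcF.
  have mFn n : measurable_fun setT (Fn n) by have /domP[/L2_measurable] := dF n.
  have [F mF FnF] := riesz_fischer mFn cF.
  have lF : L2 mu F.
    move/L2cvg_lt: (FnF) => /(_ 1 ltr01)[k /(_ k (leqnn k)) hk].
    have /domP[lk _] := dF k.
    by apply: (L2_near lk) => //; rewrite L2normB; exact: lt_EFin_lty hk.
  have lFn n : L2 mu (Fn n) by have /domP[] := dF n.
  have lDn n : L2 nu (D (Fn n)) by have /domP[_ []] := dF n.
  have dB G H : dom G -> dom H -> dom (G \- H).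
    move=> dG dH; have := dom_lin (-1) dH dG; congr dom; apply/funext => x /=; ring.
  have cD (e : R) : 0 < e -> exists k, forall p q, (k <= p)%N -> (k <= q)%N ->
      (N (D (Fn p) \- D (Fn q)) < e%:E)%E.
    move=> e0; have [k hk] := fcF _ (exprn_gt0 2 e0); exists k => p q kp kq.
    have := hk p q kp kq; rewrite formE ?D_sub; [|exact: dB|exact: dB].
    by rewrite L2form_lt//; exact: L2B.
  have [lDF cDF] := D_closed lFn mF lDn FnF cD.
  have dF' : dom F by exact: dom_closed cDF.
  exists F; split => //.
  move/L2cvg_lt: cDF => cDF; apply: Rcvg0P => e e0.
  have se0 : 0 < Num.sqrt e by rewrite sqrtr_gt0.
  have [k hk] := cDF _ se0; exists k => n kn.
  rewrite formE ?D_sub; [|exact: dB|exact: dB].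
  rewrite ger0_norm ?L2form_ge0// ltW// -[ltRHS]sqr_sqrtr ?ltW//.
  by rewrite L2form_lt//; [exact: hk|exact: L2B].
(* The truncation is 1-Lipschitz, so the two forms are compared pointwise under the integral. *)
- move=> F dF cutF; have dc : dom cutF by exact: dom_cut.
  split=> //; rewrite !formE//.
  have /domP[_ [lDF _]] := dF; have /domP[_ [lDc _]] := dc.
  apply: le_Rintegral => //; try exact: L2_prod_int.
  move=> s _; rewrite -!expr2 -[leLHS]real_normK ?num_real// -[leRHS]real_normK ?num_real//.
  rewrite lerXn2r ?nnegrE//; exact: ler_dist_cut.
Qed.

End difference_form.

(** * Induction over square-integrable functions *)

Section simple_function_induction.
Import HBNNSimple.

(** Simple functions approximate the positive and negative parts from below, hence are dominated by
    them. The closure under limits carries a dominating function in L^2, so that an instance can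
    verify it by dominated convergence. *)
Lemma L2_induction {disp : measure_display} {T : measurableType disp} {R : realType}
    (m : {measure set T -> \bar R}) (P : set (T -> R)) :
  P (cst 0) -> (forall A, measurable A -> P (\1_A)) ->
  (forall (a : R) (F G : T -> R), P F -> P G -> P (fun x => a * F x + G x)) ->
  (forall (F : T -> R) (G : nat -> T -> R) (h : T -> R), L2 m h -> measurable_fun setT F ->
    (forall x, `|F x| <= `|h x|) -> (forall k, P (G k)) ->
    (forall k x, `|G k x| <= `|h x|) -> (forall x, G k x @[k --> \oo] --> F x) -> P F) ->
  forall F, L2 m F -> P F.
Proof.
move=> P_0 P_indic P_lin P_limit F.
have pos (f : T -> R) : L2 m f -> (forall g, 0 <= f g) -> P f.
  move=> lf f0; have mf := L2_measurable lf.
  have mEf : measurable_fun setT (EFin \o f) by exact/measurable_EFinP.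
  pose s_ := nnsfun_approx measurableT mEf; pose s (k : nat) : T -> R := s_ k.
  have cs g : (s k g)%:E @[k --> \oo] --> (f g)%:E.
    by apply: (cvg_nnsfun_approx measurableT mEf) => // g' _; rewrite lee_fin.
  have sf k g : s k g <= f g.
    have nd : nondecreasing_seq (fun k => s k g).
      by move=> i j ij; exact/lefP/nd_nnsfun_approx.
    have c : s k g @[k --> \oo] --> f g by have /fine_cvgP[] := cs g.
    rewrite -(cvg_lim _ c)//; apply: nondecreasing_cvgn_le => //.
    by apply/cvg_ex; exists (f g).
  apply: (P_limit f s f) => //.
  - move=> k; rewrite (_ : s k = (fun g => \sum_(y <- fset_set (range (s k)))
        y * \1_(s k @^-1` [set y]) g)); last first.
      by apply/funext => g; rewrite /s [LHS](fimfunE (s_ k)) fsbig_finite.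
    elim: (finmap.enum_fset _) => [|y l ih].
      rewrite (_ : (fun g => _) = cst 0); last by apply/funext => g; rewrite big_nil.
      exact: P_0.
    rewrite (_ : (fun g => _) = (fun g => y * \1_(s k @^-1` [set y]) g +
        \sum_(y <- l) y * \1_(s k @^-1` [set y]) g)); last by apply/funext => g; rewrite big_cons.
    by apply: P_lin => //; exact: P_indic.
  - by move=> k g; rewrite !ger0_norm.
  - by move=> g; have /fine_cvgP[] := cs g.
move=> lF; have mF := L2_measurable lF.
pose Fp g := Num.max (F g) 0; pose Q g := Num.max (- F g) 0.
have lP : L2 m Fp.
  apply: (L2_le _ lF _).1; first exact: measurable_maxr.
  by move=> g; rewrite /Fp ger0_norm ?le_max ?lexx ?orbT// ge_max normr_ge0 ler_norm.
have lQ : L2 m Q.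
  apply: (L2_le _ lF _).1; first by apply: measurable_maxr => //; exact: measurableT_comp.
  by move=> g; rewrite /Q ger0_norm ?le_max ?lexx ?orbT// ge_max normr_ge0 -normrN ler_norm.
rewrite (_ : F = (fun g => -1 * Q g + Fp g)).
  by apply: P_lin; apply: pos => // g; rewrite le_max lexx orbT.
by apply/funext => g; rewrite /Fp /Q /Num.max; case: ltP => h1; case: ltP => h2; lra.
Qed.

End simple_function_induction.

(** * Configurations, their counting measures, and measurability of point counts *)

Section configuration_basics.
Context {R : realType} {d : nat}.
Local Notation V := 'rV[R]_d.
Implicit Types (g : config R d) (f : V -> R) (x : V) (M : R).

Definition cball M : set V := [set x | `|x| <= M].

Lemma closed_cball M : closed (cball M).
Proof.
rewrite (_ : cball M = (fun x : V => `|x|) @^-1` [set y | y <= M])//.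
by apply: closed_comp => [x _|]; [exact: norm_continuous|exact: closed_le].
Qed.

Lemma compact_cball M : compact (cball M).
Proof.
apply: bounded_closed_compact; last exact: closed_cball.
exists M; split; first exact: num_real.
by move=> y My x /= xM; exact: le_trans xM (ltW My).
Qed.

Lemma finite_cball g M : finite_set (points g `&` cball M).
Proof. exact/config_locally_finite/compact_cball. Qed.

Definition supported_in f M := forall x, f x != 0 -> `|x| <= M.

Lemma test_funP f : test_fun f <-> continuous f /\ exists M, supported_in f M.
Proof.
split=> [[cf /compact_bounded[M [_ hM]]]|[cf [M hM]]]; split => //.
  exists (M + 1) => x fx; apply: (hM (M + 1)); first by rewrite ltrDl.
  exact: subset_closure.
apply: (@subclosed_compact _ _ (cball M)).
- exact: closed_closure.
- exact: compact_cball.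
- by rewrite [cball M](closure_id _).1; [apply: closure_subset => x /=; exact: hM|exact: closed_cball].
Qed.

Lemma pairingE f g M : supported_in f M ->
  pairing f g = \sum_(x <- fset_set (points g `&` cball M)) f x.
Proof.
move=> fM; rewrite /pairing -fsbig_finite; last exact: finite_cball.
apply/esym/fsbig_widen; first exact: subIsetl.
move=> x [gx] /= ngM; apply: contrapT => /eqP fx; apply: ngM; split => //.
exact: fM.
Qed.

Lemma supported_inW f M M' : M <= M' -> supported_in f M -> supported_in f M'.
Proof. by move=> MM fM x /fM/le_trans; apply. Qed.

Lemma open_pairing f (U : set R) : test_fun f -> open U ->
  open (pairing f @^-1` U : set (config R d)).
Proof.
move=> tf oU; exists [set pairing f @^-1` U]; last by rewrite bigcup_set1.
move=> _ ->; exists [fset (pairing f @^-1` U : set (config R d))]%fset.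
  by move=> A /fset1P ->; apply/mem_set; exists (f, U).
apply/seteqP; split=> [x h|x xU A /= /fset1P ->//].
by apply: (h (pairing f @^-1` U)) => /=; exact/fset1P.
Qed.

Lemma measurable_pairing f : test_fun f ->
  measurable_fun [set: config R d] (pairing f).
Proof.
move=> tf; apply: (measurability _ (RGenOpens.measurableE R)) => _ [_ [a [b ->] <-]].
rewrite setTI; apply: sub_sigma_algebra.
exact: (open_pairing tf (interval_open _ _)).
Qed.

End configuration_basics.

Section counting_measure_of_configuration.
Context {R : realType} {d : nat}.
Local Notation V := 'rV[R]_d.
Implicit Types (g : config R d) (x : V).

(** The integer part of the norm cuts a configuration into countably many finite sets, so that sums
    over it become series of finite sums and its counting measure a series of Dirac masses. *)
Definition layer (n : nat) : set V := [set x | Num.truncn `|x| = n].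

Lemma layer_cball n : layer n `<=` cball n.+1%:R.
Proof. by move=> x /= <-; rewrite /cball /= ltW// truncnS_gt. Qed.

Lemma bigcup_layer : \bigcup_n layer n = [set: V].
Proof. by apply/seteqP; split => // x _; exists (Num.truncn `|x|). Qed.

Definition layer_points g n : seq V := fset_set (points g `&` layer n).

Lemma finite_layer g n : finite_set (points g `&` layer n).
Proof.
apply: (sub_finite_set _ (finite_cball g n.+1%:R)).
by apply: setIS; exact: layer_cball.
Qed.

Lemma esum_layers g (a : V -> \bar R) : (forall x, 0 <= a x)%E ->
  (\esum_(x in points g) a x = \sum_(n <oo) \sum_(x <- layer_points g n) a x)%E.
Proof.
move=> a0; rewrite -{1}(setIT (points g)) -bigcup_layer setI_bigcupr.
rewrite esum_bigcupT//; last first.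
  by move=> i j _ _ [x [[_ +] [_ +]]] => /= <-.
rewrite -nneseries_esumT => [|n]; last exact: esum_ge0.
apply: eq_eseriesr => n _; rewrite esum_fset => [|//|//]; last exact: finite_layer.
by rewrite fsbig_finite//; exact: finite_layer.
Qed.

Definition cnt g : {measure set V -> \bar R} :=
  mseries (fun n => msum (fun i => \d_(nth 0 (layer_points g n) i)) (size (layer_points g n))) 0.

Lemma integral_cnt g (f : V -> \bar R) : (forall x, 0 <= f x)%E ->
  measurable_fun setT f -> (\int[cnt g]_x f x = \esum_(x in points g) f x)%E.
Proof.
move=> f0 mf; rewrite ge0_integral_measure_series// esum_layers//.
apply: eq_eseriesr => n _; rewrite ge0_integral_measure_sum//.
rewrite (big_nth 0) big_mkord; apply: eq_bigr => i _.
by rewrite integral_dirac// diracT mul1e.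
Qed.

Lemma cntE g (A : set V) : measurable A ->
  cnt g A = (\esum_(x in points g) (\1_A x)%:E)%E.
Proof.
move=> mA; rewrite -integral_cnt; last 2 first.
- by move=> x; rewrite lee_fin.
- exact/measurable_EFinP/measurable_indic.
by rewrite integral_indic// setIT.
Qed.

Lemma cnt_finite g (A : set V) M : measurable A -> A `<=` cball M ->
  cnt g A = (#|` fset_set (points g `&` A)|)%:R%:E.
Proof.
move=> mA AM; rewrite cntE//.
have fA : finite_set (points g `&` A).
  by apply: (sub_finite_set _ (finite_cball g M)); exact: setIS.
transitivity (\esum_(x in points g `&` A) (1 : \bar R))%E.
  rewrite esum_mkcondr; apply: eq_esum => x _.
  by rewrite indicE; case: (x \in A).
rewrite esum_fset// fsbig_finite// sumEFin /=.
by rewrite big_const_seq count_predT iter_addr addr0.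
Qed.

End counting_measure_of_configuration.

Section counting_measurability.
Context {R : realType} {d : nat}.
Local Notation V := 'rV[R]_d.
Implicit Types (g : config R d) (x : V) (B : set V).

(** Indicators that are pointwise limits of test functions with a common bound on the support:
    counts in such sets are limits of pairings, because all the sums then run over one fixed finite
    set. *)
Definition approximable B := exists (f : nat -> V -> R) (M : R),
  [/\ forall k, continuous (f k), forall k, supported_in (f k) M &
    forall x, f k x @[k --> \oo] --> (\1_B x : R)].

Lemma approximableI B1 B2 : approximable B1 -> approximable B2 -> approximable (B1 `&` B2).
Proof.
move=> [f1 [M1 [cf1 sf1 hf1]]] [f2 [M2 [cf2 sf2 hf2]]].
exists (fun k x => f1 k x * f2 k x), M1; split.
- by move=> k x; apply: continuousM; [exact: cf1|exact: cf2].
- by move=> k x; rewrite mulf_eq0 negb_or => /andP[+ _]; exact: sf1.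
- by move=> x; rewrite indicI; exact: cvgM.
Qed.

Lemma supported_limit B (f : nat -> V -> R) M :
  (forall k, supported_in (f k) M) -> (forall x, f k x @[k --> \oo] --> (\1_B x : R)) ->
  B `<=` cball M.
Proof.
move=> sf hf x Bx; rewrite /cball /= leNgt; apply/negP => xM.
have : f k x @[k --> \oo] --> (0 : R).
  rewrite (_ : f ^~ x = cst 0); first exact: cvg_cst.
  by apply/funext => k /=; have [//|/sf] := eqVneq (f k x) 0; rewrite leNgt xM.
move=> h0; have e : (\1_B x : R) = 0 by exact: (cvg_unique _ (hf x) h0).
by move/eqP: e; rewrite indicE mem_set// oner_eq0.
Qed.

Lemma approximable_bounded B : approximable B -> exists M, B `<=` cball M.
Proof. by move=> [f [M [_ sf hf]]]; exists M; exact: supported_limit hf. Qed.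

(** Vanishes outside the open ball and tends to its indicator as k grows, since k (r - |x - q|)
    eventually exceeds 1 inside. *)
Definition tent (q : V) (r : R) (k : nat) x : R :=
  Num.min 1 (k%:R * Num.max 0 (r - `|x - q|)).

Lemma continuous_tent q r k : continuous (tent q r k).
Proof.
move=> x; apply: (@continuous_min _ _ (cst 1) (fun x => k%:R * Num.max 0 (r - `|x - q|))).
  exact: cst_continuous.
apply: (@continuousM _ _ (cst k%:R) (fun x => Num.max 0 (r - `|x - q|))); first exact: cst_continuous.
apply: (@continuous_max _ _ (cst 0) (fun x => r - `|x - q|)); first exact: cst_continuous.
apply: (@continuousB _ _ _ (cst r) (fun x => `|x - q|)); first exact: cst_continuous.
apply: (@continuous_comp _ _ _ (fun x => x - q) (fun x => `|x|)); last exact: norm_continuous.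
by apply: (@continuousB _ _ _ id (cst q)); [exact: cvg_id|exact: cst_continuous].
Qed.

Lemma approximable_ball q r : approximable (ball q r).
Proof.
exists (tent q r), (`|q| + r); split.
- by move=> k; exact: continuous_tent.
- move=> k x; rewrite /tent; case: (lerP 0 (r - `|x - q|)) => h.
    move=> _; rewrite -(subrK q x) (le_trans (ler_normD _ _))// addrC lerD2l.
    by rewrite subr_ge0 in h.
  by rewrite mulr0 min_r// eqxx.
- move=> x; rewrite indicE; have [xB|xB] := boolP (x \in (ball q r : set V)).
    have h : 0 < r - `|x - q|.
      by move: xB; rewrite inE -ball_normE /= subr_gt0 distrC.
    apply/cvg_ballP => e e0; exists (Num.truncn (r - `|x - q|)^-1).+1 => // k /= kn.
    rewrite /tent max_r ?ltW// min_l; first exact: ballxx.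
    rewrite -ler_pdivrMr// mul1r.
    apply: (le_trans (ltW (truncnS_gt _))).
    by rewrite ler_nat.
  rewrite (_ : (fun k => tent q r k x) = cst 0); first exact: cvg_cst.
  apply/funext => k; rewrite /tent max_l ?mulr0 ?min_r//.
  rewrite subr_le0 leNgt; apply: contra xB => h.
  by rewrite inE -ball_normE /= distrC.
Qed.

Lemma cvg_sum_seq (s : seq V) (f : nat -> V -> R) (h : V -> R) :
  (forall x, f k x @[k --> \oo] --> h x) ->
  \sum_(x <- s) f k x @[k --> \oo] --> \sum_(x <- s) h x.
Proof.
move=> fh; elim: s => [|y s ih].
  by under eq_fun do rewrite big_nil; rewrite big_nil; exact: cvg_cst.
by under eq_fun do rewrite big_cons; rewrite big_cons; exact: cvgD.
Qed.

Lemma cnt_approx g B (f : nat -> V -> R) M : measurable B ->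
  (forall k, supported_in (f k) M) -> (forall x, f k x @[k --> \oo] --> (\1_B x : R)) ->
  (pairing (f k) g)%:E @[k --> \oo] --> cnt g B.
Proof.
move=> mB sf hf.
have BM : B `<=` cball M by exact: supported_limit hf.
have -> : cnt g B = (\sum_(x <- fset_set (points g `&` cball M)) (\1_B x : R))%:E.
  rewrite cntE// -sumEFin -fsbig_finite; last exact: finite_cball.
  rewrite -esum_fset//; last exact: finite_cball.
  rewrite esum_mkcondr; apply: eq_esum => x _; case: ifPn => //.
  by rewrite notin_setE indicE => nM; rewrite memNset// => /BM.
apply/cvg_EFin; first exact: nearW.
rewrite (_ : fine \o _ = (fun k => \sum_(x <- fset_set (points g `&` cball M)) f k x)).
  exact: cvg_sum_seq.
by apply/funext => k /=; exact: pairingE.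
Qed.

Lemma approximable_measurable_cnt B : measurable B -> approximable B ->
  measurable_fun [set: config R d] (fun g => cnt g B).
Proof.
move=> mB [f [M [cf sf hf]]].
apply: (@emeasurable_fun_cvg _ _ _ _ (fun k g => (pairing (f k) g)%:E)).
  move=> k; have tf : test_fun (f k) by apply/test_funP; split=> //; exists M.
  by apply/measurable_EFinP; exact: (measurable_pairing tf).
by move=> g _; exact: cnt_approx hf.
Qed.

Lemma measurable_ball_rV (q : V) r : measurable (ball q r : set V).
Proof. by apply: sub_sigma_algebra; exact: ball_open. Qed.

Lemma ball0_cvg_setT : \bigcup_n (ball (0 : V) n.+1%:R) = setT.
Proof.
apply/seteqP; split=> // x _; exists (Num.truncn `|x|) => //.
by rewrite -ball_normE /= sub0r normrN truncnS_gt.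
Qed.

(** Dynkin argument on the open approximable sets, which contain the rational balls and so generate
    the Borel sets. Intersecting with a fixed ball keeps the counts finite, as the step for
    complements subtracts them. *)
Lemma measurable_cnt B : measurable B ->
  measurable_fun [set: config R d] (fun g => cnt g B).
Proof.
move=> mB; pose bl n := ball (0 : V) n.+1%:R.
have mbl n : measurable (bl n) by exact: measurable_ball_rV.
have fin g n A : measurable A -> cnt g (A `&` bl n) \is a fin_num.
  move=> mA; have [M hM] := approximable_bounded (approximable_ball (0 : V) n.+1%:R).
  rewrite (@cnt_finite _ _ _ _ M)//; first exact: measurableI.
  by move=> x [_ /hM].
suff key n : measurable_fun [set: config R d] (fun g => cnt g (B `&` bl n)).
  apply: (emeasurable_fun_cvg (fun n g => cnt g (B `&` bl n))) => // g _.
  rewrite -[X in cnt g X]setIT -ball0_cvg_setT setI_bigcupr.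
  apply: nondecreasing_cvg_mu.
  - by move=> i; exact: measurableI.
  - by apply: bigcupT_measurable => i; exact: measurableI.
  - move=> i j ij; apply/subsetPset; apply: setIS; apply: le_ball.
    by rewrite ler_nat ltnS.
pose G : set (set V) := [set A | approximable A /\ open A].
have GE : @measurable _ V = <<s G >>.
  apply/seteqP; split; last first.
    apply: smallest_sub; first exact: sigma_algebra_measurable.
    by move=> A [_ oA]; exact: sub_sigma_algebra.
  apply: smallest_sub; first exact: smallest_sigma_algebra.
  move=> U /= oU; rewrite (open_bigcup_rat_ball oU) bigcup_mkcond.
  apply: (@countable_bigcupT_measurable _ (g_sigma_algebraType G)) => // k.
  case: ifPn => _; last exact: measurable0.
  apply: sub_sigma_algebra; split; first exact: approximable_ball.
  exact: ball_open.
apply: (dynkin_induction (P := fun A => measurable_fun [set: config R d] (fun g => cnt g (A `&` bl n))) GE).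
- move=> A1 A2 [a1 o1] [a2 o2]; split; [exact: approximableI|exact: openI].
- rewrite setTI.
  by apply: approximable_measurable_cnt => //; exact: approximable_ball.
- move=> A [aA oA]; apply: approximable_measurable_cnt.
    by apply: measurableI => //; exact: sub_sigma_algebra.
  by apply: approximableI => //; exact: approximable_ball.
- move=> A mA hA.
  rewrite (_ : (fun g => _) = (fun g => cnt g (bl n) - cnt g (A `&` bl n))%E).
    apply: emeasurable_funB => //.
    by apply: approximable_measurable_cnt => //; exact: approximable_ball.
  apply/funext => g; rewrite setIC -setDE measureD//.
  + by rewrite setIC.
  + rewrite -[bl n]setTI -ge0_fin_numE//; exact: fin.
- move=> F mF tF hF.
  rewrite (_ : (fun g => _) = (fun g => \sum_(i <oo) cnt g (F i `&` bl n))%E).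
    by apply: (ge0_emeasurable_sum (P := xpredT)).
  apply/funext => g; rewrite setI_bigcupl measure_bigcup//.
  + by apply: eq_eseriesl => i; rewrite in_setT.
  + by move=> i _; exact: measurableI.
  + by apply: trivIset_setIr.
- by rewrite -GE.
Qed.

End counting_measurability.

Section joint_measurability.
Context {R : realType} {d : nat} {dX : measure_display} {X : measurableType dX}.
Local Notation V := 'rV[R]_d.
Variable gm : X -> config R d.

(** The measurability proof is an argument because the kernel structure attached to this term
    depends on it. *)
Definition cnt_kernel (mgm : measurable_fun setT gm) (x : X) : {measure set V -> \bar R} :=
  cnt (gm x).

Section kernel_instance.
Hypothesis mgm : measurable_fun setT gm.

Let cnt_kernel_measurable (U : set V) : measurable U ->
  measurable_fun setT ((cnt_kernel mgm) ^~ U).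
Proof. by move=> mU; exact: (measurableT_comp (measurable_cnt mU) mgm). Qed.

HB.instance Definition _ := isKernel.Build _ _ X V R (cnt_kernel mgm) cnt_kernel_measurable.
End kernel_instance.

Hypothesis mgm : measurable_fun setT gm.

(** Counting measures can be infinite; restricted to a ball they are finite for each parameter, and
    the balls then exhaust the space. *)
Lemma measurable_cnt_xsection (A : set (X * V)) : measurable A ->
  measurable_fun setT (fun x => cnt (gm x) (xsection A x)).
Proof.
move=> mA; pose bl n := ball (0 : V) n.+1%:R.
have mbl n : measurable (bl n) by exact: measurable_ball_rV.
suff key n : measurable_fun setT (fun x => cnt (gm x) (xsection A x `&` bl n)).
  apply: (emeasurable_fun_cvg (fun n x => cnt (gm x) (xsection A x `&` bl n))) => // x _.
  rewrite -[X in cnt _ X]setIT -ball0_cvg_setT setI_bigcupr.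
  have mx : measurable (xsection A x) by exact: measurable_xsection.
  apply: nondecreasing_cvg_mu.
  - by move=> i; exact: measurableI.
  - by apply: bigcupT_measurable => i; exact: measurableI.
  - move=> i j ij; apply/subsetPset; apply: setIS; apply: le_ball.
    by rewrite ler_nat ltnS.
have bnd x : exists M, forall U, measurable U -> (mrestr (cnt_kernel mgm x) (mbl n) U < M%:E)%E.
  have [M hM] := approximable_bounded (approximable_ball (0 : V) n.+1%:R).
  exists ((#|` fset_set (points (gm x) `&` bl n)|)%:R + 1) => U mU.
  apply: (@le_lt_trans _ _ (cnt (gm x) (bl n))).
    by rewrite /mrestr; apply: le_measure; rewrite ?inE//; exact: measurableI.
  by rewrite (cnt_finite _ (mbl n) hM) lte_fin ltrDl.
by have [] := measurable_prod_subset_xsection_kernel bnd mA.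
Qed.

Import HBNNSimple.

(** The sum is an integral against the counting kernel. The parameter x may carry more than the
    configuration [gm x], which gives access to sums depending on a further point and to iterated
    sums. *)
Lemma measurable_esum (F : X * V -> \bar R) : (forall p, 0 <= F p)%E ->
  measurable_fun setT F ->
  measurable_fun setT (fun x => \esum_(y in points (gm x)) F (x, y))%E.
Proof.
move=> F0 mF.
rewrite (_ : (fun x => _) = (fun x => \int[cnt_kernel mgm x]_y F (x, y)))%E; last first.
  apply/funext => x; rewrite /cnt_kernel integral_cnt//.
  exact: measurableT_comp.
pose F_ := nnsfun_approx measurableT mF.
apply: (@measurable_fun_xsection_integral _ _ _ _ _ F _ F_).
- by move=> a b ab; exact/nd_nnsfun_approx.
- by move=> z; exact/cvg_nnsfun_approx.
- move=> n r; apply: (@measurable_cnt_xsection (F_ n @^-1` [set r])).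
  by rewrite -[X in measurable X]setTI; exact: measurable_funP.
Qed.

End joint_measurability.

(** * Mixtures of measures *)

Section mixture.
Context {d1 d2 : measure_display} {X : measurableType d1} {Z : measurableType d2} {R : realType}.
Variables (mu : {measure set X -> \bar R}) (K : X -> {measure set Z -> \bar R}).

(** Arbitrary measures [K x] are allowed, since the counting measures to be mixed can be infinite;
    the measurability proof is an argument because the measure structure attached to this term
    depends on it. *)
Definition mixture (mK : forall A, measurable A -> measurable_fun setT (K ^~ A)) (A : set Z) : \bar R :=
  (\int[mu]_x K x A)%E.

Hypothesis mK : forall A, measurable A -> measurable_fun setT (K ^~ A).
Local Notation nu := (mixture mK).

Let mixture0 : nu set0 = 0%E.
Proof. by rewrite /mixture integral0_eq. Qed.

Let mixture_ge0 A : (0 <= nu A)%E.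
Proof. exact: integral_ge0. Qed.

Let mixture_sigma_additive : semi_sigma_additive nu.
Proof.
move=> F mF tF mUF; apply: cvg_toP.
  apply: ereal_nondecreasing_is_cvgn => i j ij.
  by apply: lee_sum_nneg_natr => // n _ _; exact: mixture_ge0.
rewrite /mixture -integral_nneseries//; last by move=> n; exact: mK.
apply: eq_integral => x _.
by apply: cvg_lim => //; exact: measure_semi_sigma_additive.
Qed.

HB.instance Definition _ := isMeasure.Build _ _ _ nu mixture0 mixture_ge0 mixture_sigma_additive.

Import HBNNSimple.

Let integral_mixture_nnsfun (f : {nnsfun Z >-> R}) :
  (\int[nu]_z (f z)%:E = \int[mu]_x \int[K x]_z (f z)%:E)%E.
Proof.
rewrite integralT_nnsfun sintegralE.
under [RHS]eq_integral do rewrite integralT_nnsfun sintegralE.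
rewrite ge0_integral_fsum//.
- apply: eq_fsbigr => r /set_mem [z _ <-].
  by rewrite ge0_integralZl// ?lee_fin//; exact: mK.
- by move=> r; apply: measurable_funeM; exact: mK.
- move=> r x _; have [r0|r0] := leP 0%R r; first by rewrite mule_ge0.
  by rewrite preimage_nnfun0// measure0 mule0.
Qed.

Lemma measurable_integral_kernel (F : Z -> \bar R) : (forall z, 0 <= F z)%E ->
  measurable_fun setT F -> measurable_fun setT (fun x => \int[K x]_z F z)%E.
Proof. by move=> F0 mF; exact: measurable_fun_integral_kernel. Qed.

Lemma integral_mixture (F : Z -> \bar R) : (forall z, 0 <= F z)%E ->
  measurable_fun setT F -> (\int[nu]_z F z = \int[mu]_x \int[K x]_z F z)%E.
Proof.
move=> F0 mF; pose F_ := nnsfun_approx measurableT mF.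
have ndF z : {homo (fun n => (F_ n z)%:E) : i j / (i <= j)%N >-> (i <= j)%E}.
  by move=> i j ij; rewrite lee_fin; exact/lefP/nd_nnsfun_approx.
have limF z : limn (fun n => (F_ n z)%:E) = F z.
  by apply/cvg_lim => //; exact/cvg_nnsfun_approx.
have mF_ n : measurable_fun setT (fun z => (F_ n z)%:E) by exact/measurable_EFinP.
have intE (m : {measure set Z -> \bar R}) :
    (\int[m]_z F z = limn (fun n => \int[m]_z (F_ n z)%:E))%E.
  rewrite -monotone_convergence//; first by apply: eq_integral => z _; rewrite limF.
  by move=> n z _; rewrite lee_fin.
rewrite intE; under eq_fun do rewrite integral_mixture_nnsfun.
rewrite -monotone_convergence//.
- by apply: eq_integral => x _; rewrite intE.
- by move=> n; apply: measurable_integral_kernel => // z; rewrite lee_fin.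
- by move=> n x _; apply: integral_ge0 => z _; rewrite lee_fin.
- move=> x _ i j ij; apply: ge0_le_integral => //.
  + by move=> z _; rewrite lee_fin.
  + by move=> z _; exact: ndF.
Qed.

End mixture.

(** * A countable description of vaguely open sets; measurability of maps into configurations *)

Section countable_base.
Context {R : realType} {d : nat}.
Local Notation V := 'rV[R]_d.
Implicit Types (g : config R d) (x : V).

Definition count (B : set V) g : nat := #|` fset_set (points g `&` B)|.

(* Configurations having exactly one point in each of finitely many small balls
   and no other point in a large ball. *)
Local Notation pattern := (seq ('rV[rat]_d * nat) * nat)%type.
Definition pattern_set (P : pattern) : set (config R d) :=
  [set g | (forall b, b \in P.1 -> count (rat_ball b) g = 1%N) /\
    count (ball 0 P.2.+1%:R) g = size P.1].

Lemma finite_ball0 g (r : R) : finite_set (points g `&` ball 0 r).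
Proof.
apply: (sub_finite_set _ (finite_cball g r)) => x [gx].
by rewrite -ball_normE /= sub0r normrN => /ltW.
Qed.

(** Every configuration with such a pattern has as many points in the large ball as g, and they can
    be matched with those of g at distance less than [de]. *)
Definition adapted (de M : R) g (P : pattern) :=
  [/\ pattern_set P g, uniq P.1 /\ M < P.2.+1%:R,
    forall b c x, b \in P.1 -> c \in P.1 -> rat_ball b x -> rat_ball c x -> b = c,
    forall b, b \in P.1 -> rat_ball b `<=` (ball 0 P.2.+1%:R : set V) &
    forall b x y, b \in P.1 -> rat_ball b x -> rat_ball b y -> `|x - y| < de].

(** The disjoint small balls account for as many points as the large ball contains, so selecting the
    point of each of them enumerates the points of g there; a support radius below that of the large
    ball loses no term. *)
Lemma pattern_sum g (P : pattern) : pattern_set P g -> uniq P.1 ->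
  (forall b c x, b \in P.1 -> c \in P.1 -> rat_ball b x -> rat_ball c x -> b = c) ->
  (forall b, b \in P.1 -> rat_ball b `<=` (ball 0 P.2.+1%:R : set V)) ->
  exists xf : 'rV[rat]_d * nat -> V,
    [/\ forall b, b \in P.1 -> points g (xf b) /\ rat_ball b (xf b),
      {in P.1 &, injective xf} &
      forall f M, M < P.2.+1%:R -> supported_in f M ->
        pairing f g = \sum_(b <- P.1) f (xf b)].
Proof.
move=> [one all] uP disj sub.
have /choice[xf hxf] b : exists x, b \in P.1 -> points g x /\ rat_ball b x.
  have [bP|bP] := boolP (b \in P.1); last by exists 0.
  have := one b bP; rewrite /count => c1.
  have /fset0Pn[x] : fset_set (points g `&` rat_ball b) != fset0.
    by rewrite -cardfs_gt0 c1.
  rewrite in_fset_set; last first.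
    by apply: (sub_finite_set _ (finite_ball0 g P.2.+1%:R)); apply: setIS; exact: sub.
  by rewrite inE => -[gx bx]; exists x.
have inj : {in P.1 &, injective xf}.
  move=> b c bP cP bc; have [_ hb] := hxf b bP; have [_ hc] := hxf c cP.
  by apply: (disj b c (xf b)) => //; rewrite bc.
exists xf; split => // f M MP fM.
have um : uniq (map xf P.1) by rewrite map_inj_in_uniq.
have fin := finite_ball0 g P.2.+1%:R.
have sub2 : [fset x in map xf P.1]%fset =i fset_set (points g `&` ball 0 P.2.+1%:R).
  have cE : #|` [fset x in map xf P.1]%fset| = #|` fset_set (points g `&` ball 0 P.2.+1%:R)|.
    by rewrite card_fseq undup_id// size_map -all.
  apply/(fsubset_cardP cE)/fsubsetP => x; rewrite in_fset_set// => /=.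
  rewrite !inE => /mapP[b bP ->]; have [gx bx] := hxf b bP.
  by split=> //; exact: (sub b bP).
rewrite -(big_map xf xpredT) /pairing.
rewrite (fsbigE (map xf P.1))//.
- rewrite big_seq_cond [RHS]big_seq; apply: eq_bigl => x.
  case: (boolP (x \in map xf P.1)) => //= /mapP[b bP ->].
  by apply/mem_set; have [] := hxf b bP.
- by move=> x /mapP[b bP ->]; have [] := hxf b bP.
- move=> x gx xP; apply/eqP/negPn/negP => fx; move/negP: xP; apply.
  have := sub2 x; rewrite in_fset_set// !inE/= => ->.
  apply/mem_set; split => //; rewrite -ball_normE /= sub0r normrN.
  exact: le_lt_trans (fM x fx) MP.
Qed.

Lemma common_radius (T : eqType) (s : seq T) (Q : T -> R -> Prop) :
  (forall t e e', Q t e -> 0 < e' -> e' <= e -> Q t e') ->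
  (forall t, t \in s -> exists e, 0 < e /\ Q t e) ->
  exists e, 0 < e /\ forall t, t \in s -> Q t e.
Proof.
move=> mono; elim: s => [_|t s ih h]; first by exists 1.
have [e1 [e10 Q1]] := h t (mem_head _ _).
have [|e2 [e20 Q2]] := ih; first by move=> u us; apply: h; rewrite inE us orbT.
exists (Num.min e1 e2); split; first by rewrite lt_min e10.
move=> u; rewrite inE => /predU1P[->|us].
  by apply: (mono _ e1) => //; rewrite ?lt_min ?e10// ge_min lexx.
by apply: (mono _ e2); rewrite ?lt_min ?e10 ?ge_min ?lexx ?orbT//; exact: Q2.
Qed.

Lemma adapted_subbase f (U : set R) g0 : test_fun f -> open U -> U (pairing f g0) ->
  exists de M, 0 < de /\ forall P, adapted de M g0 P ->
    pattern_set P `<=` pairing f @^-1` U.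
Proof.
move=> /test_funP[cf [M0 fM0]] oU Ug0.
have /nbhs_ballP[e /= e0 eU] : nbhs (pairing f g0) U by exact: open_nbhs_nbhs.
(* The margin 1 exceeds the displacement of matched points: a point of [g0] beyond M0 + 1 is matched
   with a point beyond M0, and f vanishes at both. *)
pose s := fset_set (points g0 `&` cball (M0 + 1)) : seq V.
(* Continuity at the finitely many points in [s] suffices: at most [size s] terms, each bounded by e
   / (size s + 1), sum to less than e. *)
have [de [de0 hde]] : exists de, 0 < de /\ forall p, p \in s ->
    forall x, `|p - x| < de -> `|f p - f x| < e / (size s).+1%:R.
  apply: common_radius => [t e1 e2 h _ e21 x xe|p _].
    by apply: h; exact: lt_le_trans xe e21.
  have ep : 0 < e / (size s).+1%:R by rewrite divr_gt0.
  have /cvgrPdist_lt /(_ _ ep) /nbhs_ballP[r /= r0 hr] := cf p.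
  exists r; split => // x px; apply: hr.
  by rewrite -ball_normE.
exists (Num.min 1 de), M0; split; first by rewrite lt_min ltr01.
move=> P [Pg0 [uP MP] disj sub diam] g Pg.
have [xf [hx injx sumx]] := pattern_sum Pg uP disj sub.
have [pf [hp injp sump]] := pattern_sum Pg0 uP disj sub.
apply: eU; rewrite -ball_normE /=.
rewrite (sumx f M0)// (sump f M0)// -sumrB.
apply: (le_lt_trans (ler_norm_sum _ _ _)).
apply: (@le_lt_trans _ _ (\sum_(b <- P.1 | pf b \in s) e / (size s).+1%:R)).
  rewrite [leRHS]big_mkcond /= big_seq [leRHS]big_seq; apply: ler_sum => b bP.
  have [gp bp] := hp b bP; have [gx bx] := hx b bP.
  have pxd := diam b _ _ bP bp bx.
  case: ifPn => ps.
    by apply/ltW/hde => //; apply: lt_le_trans pxd _; rewrite ge_min lexx orbT.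
  have pM : M0 + 1 < `|pf b|.
    rewrite ltNge; apply: contra ps => h; rewrite /s in_fset_set; last exact: finite_cball.
    exact/mem_set.
  have fp : f (pf b) = 0.
    have [//|/fM0] := eqVneq (f (pf b)) 0.
    by rewrite leNgt (lt_trans _ pM)// ltrDl.
  have fx : f (xf b) = 0.
    have [//|/fM0 h] := eqVneq (f (xf b)) 0.
    have : `|pf b| <= `|pf b - xf b| + `|xf b| by rewrite -{1}(subrK (xf b) (pf b)) ler_normD.
    have : `|pf b - xf b| < 1 by apply: lt_le_trans pxd _; rewrite ge_min lexx.
    lra.
  by rewrite fp fx subrr normr0.
rewrite big_const_seq iter_addr addr0.
have : (seq.count (fun b => pf b \in s) P.1 <= size s)%N.
  rewrite -(count_map pf (mem s)) -size_filter; apply: uniq_leq_size.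
    by rewrite filter_uniq// map_inj_in_uniq.
  by move=> x; rewrite mem_filter => /andP[].
move=> le; apply: (@le_lt_trans _ _ ((e / (size s).+1%:R) *+ size s)).
  by apply: ler_wpMn2l => //; rewrite divr_ge0// ltW.
by rewrite -mulr_natr mulrAC ltr_pdivrMr// ltr_pM2l// ltr_nat.
Qed.

Lemma adapted_exists (de M : R) g0 : 0 < de -> exists P, adapted de M g0 P.
Proof.
move=> de0; pose O := Num.truncn `|M|.
have MO : M < O.+1%:R by apply: le_lt_trans (ler_norm M) _; exact: truncnS_gt.
have fin := finite_ball0 g0 O.+1%:R.
pose s := fset_set (points g0 `&` ball 0 O.+1%:R) : seq V.
have sP x : (x \in s) <-> points g0 x /\ `|x| < O.+1%:R.
  rewrite /s in_fset_set// inE /= -ball_normE /= sub0r normrN; split=> -[]//.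
(* With [eta] below [de], the distances to the sphere and the mutual distances, balls of radius eta
   / 2 around the points are disjoint, lie in the large ball, and are small enough. *)
have [eta [eta0 heta]] : exists eta, 0 < eta /\ forall p, p \in s ->
    [/\ eta <= de, eta <= O.+1%:R - `|p| & forall q, q \in s -> p != q -> eta <= `|p - q|].
  apply: common_radius => [t e e' [h1 h2 h3] e'0 e'e|p ps].
    by split; try exact: le_trans e'e _; move=> q qs pq; apply: le_trans e'e _; exact: h3.
  have [e1 [e10 he1]] : exists e1, 0 < e1 /\ forall q, q \in s -> p != q -> e1 <= `|p - q|.
    apply: common_radius => [t e e' h e'0 e'e pt|q qs].
      by apply: le_trans e'e _; exact: h.
    have [->|pq] := eqVneq p q; first by exists 1; split.
    by exists `|p - q|; split => //; rewrite normr_gt0 subr_eq0.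
  have [_ pO] := (sP p).1 ps.
  exists (Num.min (Num.min de (O.+1%:R - `|p|)) e1); split.
    by rewrite !lt_min de0 e10 subr_gt0 pO.
  split; rewrite ?ge_min ?lexx ?orbT//.
  by move=> q qs pq; apply: le_trans (he1 q qs pq); rewrite ge_min lexx orbT.
have kE (p : V) : exists k, rat_ball k p /\ rat_ball k `<=` ball p (eta / 2).
  have /(congr1 (fun A => A p)) := open_bigcup_rat_ball (@ball_open _ _ p (eta / 2)).
  have pp : ball p (eta / 2) p by apply: ballxx; rewrite divr_gt0.
  by move=> E; move: pp; rewrite E => -[k kb kp]; exists k.
have [k hk] := choice kE.
have near p x : rat_ball (k p) x -> `|p - x| < eta / 2.
  by move=> /(hk p).2; rewrite -ball_normE.
have diam p x y : rat_ball (k p) x -> rat_ball (k p) y -> `|x - y| < eta.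
  move=> /near px /near py; rewrite (splitr eta) (_ : x - y = - (p - x) + (p - y)); last first.
    by rewrite opprB addrA subrK.
  by apply: (le_lt_trans (ler_normD _ _)); rewrite normrN ltrD.
have disj p q x : p \in s -> q \in s -> rat_ball (k p) x -> rat_ball (k q) x -> p = q.
  move=> ps qs /near px /near qx; apply/eqP; apply: contraT => pq.
  have [_ _ /(_ q qs pq)] := heta p ps; rewrite leNgt => /negP; case.
  rewrite (splitr eta) (_ : p - q = (p - x) - (q - x)); last by rewrite opprB addrA subrK.
  by apply: (le_lt_trans (ler_normB _ _)); rewrite ltrD.
have inside p x : p \in s -> rat_ball (k p) x -> `|x| < O.+1%:R.
  move=> ps /near px; have [_ h _] := heta p ps.
  have : `|x| <= `|p - x| + `|p| by rewrite distrC -{1}(subrK p x) ler_normD.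
  move: eta0; lra.
have kinj : {in s &, injective k}.
  move=> p q ps qs kpq; apply: (disj p q p) => //; first exact: (hk p).1.
  by rewrite -kpq; exact: (hk p).1.
exists (map k s, O); split => /=.
- split => /= [b /mapP[p ps ->]|]; last by rewrite size_map.
  rewrite /count (_ : points g0 `&` _ = [set p]); first by rewrite fset_set1 cardfs1.
  apply/seteqP; split => [x [gx kx]|x /= ->]; last first.
    by split; [have [] := (sP p).1 ps|exact: (hk p).1].
  have xs : x \in s by apply/sP; split => //; exact: inside kx.
  apply/esym; apply: (disj p x x) => //; exact: (hk x).1.
- by rewrite map_inj_in_uniq// fset_uniq.
- move=> b c x /mapP[p ps ->] /mapP[q qs ->] px qx.
  by rewrite (disj p q x).
- move=> b /mapP[p ps ->] x px; rewrite -ball_normE /= sub0r normrN.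
  exact: inside px.
- move=> b x y /mapP[p ps ->] px py.
  by apply: lt_le_trans (diam p x y px py) _; have [] := heta p ps.
Qed.

(** Finitely many subbasic conditions around [g0] are met by one pattern with small enough balls and
    a large enough outer ball. Centres are rational and radii integers or their inverses, so there
    are countably many patterns. *)
Lemma pattern_base (W : set (config R d)) g0 : open W -> W g0 ->
  exists P, pattern_set P g0 /\ pattern_set P `<=` W.
Proof.
move=> [D' sD <-] [A D'A Ag0].
have [F sF FA] := sD A D'A.
have [de [M [de0 hde]]] : exists de M, 0 < de /\ forall P, adapted de M g0 P ->
    forall B, B \in (F : seq _) -> pattern_set P `<=` B.
  have : forall B, B \in (F : seq _) -> B g0 /\ vague_subbase B.
    move=> B BF; split; last by have /set_mem := sF B BF.
    by move: Ag0; rewrite -FA => /(_ B BF).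
  elim: (F : seq _) => [|B s ih] h; first by exists 1, 0.
  have [|de1 [M1 [de10 h1]]] := ih.
    by move=> C Cs; apply: h; rewrite inE Cs orbT.
  have [Bg0 [[f U] /= [tf oU] BE]] := h B (mem_head _ _).
  have [|de2 [M2 [de20 h2]]] := @adapted_subbase f U g0 tf oU; first by move: Bg0; rewrite -BE.
  exists (Num.min de1 de2), (Num.max M1 M2); split; first by rewrite lt_min de10.
  move=> P [Pg [uP MP] disj sub diam] C; rewrite inE => /predU1P[->|Cs].
    rewrite -BE; apply: h2; split => //.
      by split => //; apply: le_lt_trans MP; rewrite le_max lexx orbT.
    by move=> b x y bP bx by_; apply: lt_le_trans (diam b x y bP bx by_) _; rewrite ge_min lexx orbT.
  apply: h1 Cs; split => //.
    by split => //; apply: le_lt_trans MP; rewrite le_max lexx.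
  by move=> b x y bP bx by_; apply: lt_le_trans (diam b x y bP bx by_) _; rewrite ge_min lexx.
have [P aP] := adapted_exists M g0 de0.
exists P; split; first by case: aP.
move=> g Pg; exists A; first exact: D'A.
by change (A g); rewrite -FA => B BF; exact: hde aP B BF _ Pg.
Qed.

(** The Borel sets are generated by arbitrary open sets; each of these is a countable union of
    pattern sets, which are defined by finitely many counts in balls. *)
Lemma measurable_to_config (dX : measure_display) (X : measurableType dX)
    (h : X -> config R d) :
  (forall (q : V) (r : R), measurable_fun setT (fun x : X => cnt (h x) (ball q r))) ->
  measurable_fun setT h.
Proof.
move=> mh; apply: (@measurability _ _ _ _ _ _ (@open (config R d))) => // _ [W oW <-].
rewrite setTI (_ : W = \bigcup_(P in [set P : pattern | pattern_set P `<=` W]) pattern_set P); last first.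
  apply/seteqP; split=> [g Wg|g [P PW Pg]]; last exact: PW.
  by have [P [Pg PW]] := pattern_base oW Wg; exists P.
rewrite bigcup_mkcond preimage_bigcup.
apply: countable_bigcupT_measurable => // P; case: ifPn => _; last first.
  by rewrite preimage_set0.
have mc (q : V) (r : R) n : measurable [set x : X | count (ball q r) (h x) = n].
  rewrite (_ : [set x | _] = (fun x : X => cnt (h x) (ball q r)) @^-1` [set (n%:R : R)%:E]).
    by rewrite -[X in measurable X]setTI; exact: mh.
  have [M hM] := approximable_bounded (approximable_ball q r).
  apply/seteqP; split => x /=; rewrite (cnt_finite _ (measurable_ball_rV q r) hM) -/(count _ _).
    by move=> ->.
  by move=> [] /eqP; rewrite eqr_nat => /eqP.
rewrite (_ : h @^-1` pattern_set P = [set x : X | count (ball 0 P.2.+1%:R) (h x) = size P.1] `&`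
   \bigcap_(b in [set b | b \in P.1]) [set x : X | count (rat_ball b) (h x) = 1%N]); last first.
  by apply/seteqP; split => x /= [h1 h2]; split.
apply: measurableI; first exact: mc.
by apply: fin_bigcap_measurable => // b _; exact: mc.
Qed.

End countable_base.

(** The integral of a nonnegative function is a supremum over the simple functions below it, so
    integrands containing [energy] can be compared without establishing their measurability. *)
Lemma nonneg_integral_mono {dT : measure_display} {T : measurableType dT} {R : realType}
    (m : {measure set T -> \bar R}) (f g : T -> \bar R) :
  (forall x, 0 <= f x)%E -> (forall x, f x <= g x)%E -> (\int[m]_x f x <= \int[m]_x g x)%E.
Proof.
move=> f0 fg; have g0 x : (0 <= g x)%E by exact: le_trans (f0 x) (fg x).
rewrite !ge0_integralTE//; apply: le_ereal_sup => _ [h hf <-].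
by exists h => // x; exact: le_trans (hf x) (fg x).
Qed.

Lemma integral_indic_pinfty {dT : measure_display} {T : measurableType dT} {R : realType}
    (m : {measure set T -> \bar R}) (A : set T) : measurable A -> m A = 0%E ->
  (\int[m]_x ((\1_A x)%:E * +oo) = 0)%E.
Proof.
move=> mA A0; rewrite ge0_integralZr//.
- by rewrite integral_indic// setIT A0 mul0e.
- exact/measurable_EFinP/measurable_indic.
Qed.

Section points_null.
Context {R : realType} {d : nat}.
Local Notation V := 'rV[R]_d.
Implicit Types (g : config R d) (x : V).

Lemma measurable_rV1 x : measurable ([set x] : set V).
Proof.
rewrite (_ : [set x] = \bigcap_n ball x n.+1%:R^-1).
  by apply: bigcapT_measurable => n; exact: measurable_ball_rV.
apply/seteqP; split => [y -> n _|y h]; first by apply: ballxx; rewrite invr_gt0.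
apply/eqP; rewrite eq_sym -subr_eq0 -normr_eq0 eq_le normr_ge0 andbT leNgt.
apply/negP => xy0.
have := h (Num.truncn `|x - y|^-1) Logic.I; rewrite -ball_normE /= ltNge => /negP; apply.
rewrite -[leRHS]invrK lef_pV2 ?posrE ?invr_gt0//.
exact/ltW/truncnS_gt.
Qed.

Lemma points_nth g : points g `<=`
  \bigcup_n \bigcup_i [set nth 0 (layer_points g n) i].
Proof.
move=> x gx; exists (Num.truncn `|x|) => //.
have xs : x \in layer_points g (Num.truncn `|x|).
  by rewrite /layer_points in_fset_set; [apply/mem_set; split|exact: finite_layer].
by exists (index x (layer_points g (Num.truncn `|x|))) => //=; rewrite nth_index.
Qed.

Lemma countable_points g : countable (points g).
Proof.
apply: (sub_countable (subset_card_le (@points_nth g))).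
by apply: bigcup_countable => // n _; apply: bigcup_countable => // i _.
Qed.

Lemma measurable_points g : measurable (points g).
Proof. by apply: countable_measurable; [exact: measurable_rV1|exact: countable_points]. Qed.

Lemma lebesgue_rV1 x : (0 < d)%N -> lebesgue_rV R d [set x] = 0%E.
Proof.
move=> hd; apply/eqP; rewrite eq_le measure_ge0 andbT.
apply/lee_addgt0Pr => e e0; rewrite add0e.
(* The box of side e' has volume e'^d, at most e' because e' <= 1 and d >= 1. *)
pose e' := Num.min 1 e; have e'0 : 0 < e' by rewrite lt_min ltr01.
pose y : V := \row_i (x 0 i + e').
have box_sub : [set x] `<=` [set u : V | forall i, x 0 i <= u 0 i < y 0 i].
  by move=> _ -> i; rewrite lexx mxE ltrDl.
have mbox : measurable [set u : V | forall i, x 0 i <= u 0 i < y 0 i].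
  rewrite (_ : [set _ | _] = \bigcap_(i in [set: 'I_d])
    (fun u : V => u 0 i) @^-1` `[x 0 i, y 0 i[%classic); last first.
    apply/seteqP; split=> u /= H i; first by move=> _; rewrite /= in_itv/=.
    by have := H i Logic.I; rewrite /= in_itv.
  apply: fin_bigcap_measurable => // i _; rewrite -[X in measurable X]setTI.
  exact: measurable_coord.
apply: (@le_trans _ _ (lebesgue_rV R d [set u : V | forall i, x 0 i <= u 0 i < y 0 i])).
  by apply: le_measure; rewrite ?inE//; exact: measurable_rV1.
rewrite lebesgue_rV_box => [|i]; last by rewrite mxE lerDl ltW.
rewrite lee_fin (eq_bigr (fun=> e')) => [|i _]; last by rewrite mxE addrC addKr.
rewrite prodr_const card_ord.
apply: (@le_trans _ _ (e' ^+ 1)).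
  by apply: ler_wiXn2l; rewrite ?(ltW e'0)// ge_min lexx.
by rewrite expr1 ge_min lexx orbT.
Qed.

Lemma lebesgue_points g : (0 < d)%N -> lebesgue_rV R d (points g) = 0%E.
Proof.
move=> hd; apply: measure_negligible; first exact: measurable_points.
apply: negligibleS (@points_nth g) _.
apply: negligible_bigcup => n; apply: negligible_bigcup => i.
by apply/negligibleP; [exact: measurable_rV1|exact: lebesgue_rV1].
Qed.

Lemma measurable_diag : measurable [set p : V * V | p.1 = p.2].
Proof.
rewrite (_ : [set p | _] = \bigcap_(i in [set: 'I_d])
    (fun p : V * V => p.1 0 i - p.2 0 i) @^-1` [set 0]); last first.
  apply/seteqP; split => [[x y] /= -> i _|[x y] /= h]; first by rewrite /= subrr.
  apply/rowP => i; apply/eqP; rewrite -subr_eq0; apply/eqP.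
  exact: (h i Logic.I).
apply: fin_bigcap_measurable => // i _; rewrite -[X in measurable X]setTI.
have mf : measurable_fun setT (fun p : V * V => p.1 0 i - p.2 0 i).
  apply: measurable_funB.
    exact: measurableT_comp (measurable_coord i) measurable_fst.
  exact: measurableT_comp (measurable_coord i) measurable_snd.
by apply: mf.
Qed.

(** The count of g without x in a ball is a sum over the points y of g of a function of x and y,
    measurable because the diagonal is. *)
Lemma measurable_del_point :
  measurable_fun setT (fun p : config R d * V => del_point p.1 p.2).
Proof.
apply: measurable_to_config => q r.
pose F (t : (config R d * V) * V) : \bar R := (\1_(ball q r) t.2 * \1_(~` [set p : V * V | p.1 = p.2]) (t.1.2, t.2))%:E.
rewrite (_ : (fun p => _) = (fun p : config R d * V => \esum_(y in points p.1) F (p, y)))%E.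
  apply: (@measurable_esum _ _ _ _ fst measurable_fst F).
  - by move=> t; rewrite lee_fin mulr_ge0.
  - apply/measurable_EFinP/measurable_funM.
      by apply: measurableT_comp => //; apply: measurable_indic; exact: measurable_ball_rV.
    apply: measurableT_comp.
      by apply: measurable_indic; apply: measurableC; exact: measurable_diag.
    apply: measurable_fun_pair => //.
    exact: measurableT_comp measurable_snd measurable_fst.
apply/funext => -[g x] /=.
rewrite cntE /=; last exact: measurable_ball_rV.
rewrite /= setDE esum_mkcondr; apply: eq_esum => y _; rewrite /F /=.
rewrite [X in _ * X]indicE; case: ifPn => h.
  rewrite mem_set ?mulr1//= => xy; have := set_mem h; apply; exact/esym.
rewrite memNset ?mulr0//= => xy; move/negP: h; apply; apply/mem_set => /= yx.
by apply: xy.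
Qed.

End points_null.

(** * The Campbell measure and its null sets *)

Section campbell.
Context {R : realType} {d : nat}.
Local Notation V := 'rV[R]_d.
Local Notation conf := (config R d).
Implicit Types (g : conf) (x : V).

(** The counting measure of g, lifted to pairs whose first component is g; the Campbell measure is
    then a plain mixture over g. *)
Definition point_measure g : {measure set (conf * V) -> \bar R} :=
  mseries (fun n => msum (fun i => \d_(g, nth 0 (layer_points g n) i)) (size (layer_points g n))) 0.

Lemma integral_point_measure g (f : conf * V -> \bar R) : (forall p, 0 <= f p)%E ->
  measurable_fun setT f -> (\int[point_measure g]_p f p = \esum_(x in points g) f (g, x))%E.
Proof.
move=> f0 mf; rewrite ge0_integral_measure_series// esum_layers//.
apply: eq_eseriesr => n _; rewrite ge0_integral_measure_sum//.
rewrite (big_nth 0) big_mkord; apply: eq_bigr => i _.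
by rewrite integral_dirac// diracT mul1e.
Qed.

Lemma measurable_point_measure (A : set (conf * V)) : measurable A ->
  measurable_fun setT (point_measure ^~ A).
Proof.
move=> mA; rewrite (_ : point_measure ^~ A = (fun g => \esum_(x in points g) (\1_A (g, x))%:E))%E.
  have h := @measurable_esum R d _ conf id (@measurable_id _ _ setT) (fun p => (\1_A p)%:E).
  by apply: h; [move=> p; rewrite lee_fin|exact/measurable_EFinP/measurable_indic].
apply/funext => g.
rewrite -(@integral_point_measure g (fun p => (\1_A p)%:E)).
- by rewrite integral_indic// setIT.
- by move=> p; rewrite lee_fin.
- exact/measurable_EFinP/measurable_indic.
Qed.

Variable mu : probability conf R.

Definition campbell : {measure set (conf * V) -> \bar R} :=
  mixture mu measurable_point_measure.

Lemma integral_campbell (F : conf * V -> \bar R) : (forall p, 0 <= F p)%E ->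
  measurable_fun setT F ->
  (\int[campbell]_p F p = \int[mu]_g \esum_(x in points g) F (g, x))%E.
Proof.
move=> F0 mF; rewrite integral_mixture//; apply: eq_integral => g _.
exact: integral_point_measure.
Qed.

Variables (z : R) (phi : V -> \bar R).
Hypotheses (hd : (0 < d)%N) (hmu : gibbs z phi mu) (z0 : 0 <= z).

(* The points of a configuration are Lebesgue-null, so in the Gibbs identity
   only the values of F(g + x, x) with x outside g matter. *)
Lemma gibbs_le (F : conf * V -> \bar R) (G : conf -> V -> \bar R) :
  (forall p, 0 <= F p)%E -> measurable_fun setT F ->
  (forall g x, 0 <= G g x)%E -> (forall g, measurable_fun setT (G g)) ->
  (forall g x, ~ points g x ->
    z%:E * expeR (- energy phi x g) * F (add_point g x, x) <= G g x)%E ->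
  (\int[mu]_g (\esum_(x in points g) F (g, x)) <= \int[mu]_g \int[lebesgue_rV R d]_x G g x)%E.
Proof.
move=> F0 mF G0 mG FG; rewrite hmu//.
have zE g x : (0 <= z%:E * expeR (- energy phi x g))%E.
  by rewrite mule_ge0// ?lee_fin// expeR_ge0.
apply: nonneg_integral_mono => g.
  by apply: integral_ge0 => x _; rewrite mule_ge0.
(* The added term, +oo on the points of [g], covers the values there, about which nothing is
   assumed, and integrates to zero. *)
apply: (@le_trans _ _ (\int[lebesgue_rV R d]_x (G g x + (\1_(points g) x)%:E * +oo))%E).
  apply: nonneg_integral_mono => x; first by rewrite mule_ge0.
  have [gx|gx] := pselect (points g x).
    by rewrite indicE mem_set// mul1e addey ?leey// gt_eqF// (lt_le_trans _ (G0 g x))// ltNyr.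
  by rewrite indicE memNset// mul0e adde0 FG.
rewrite ge0_integralD//.
- by rewrite integral_indic_pinfty ?adde0//; [exact: measurable_points|exact: lebesgue_points].
- apply: emeasurable_funM => //.
  by apply/measurable_EFinP/measurable_indic; exact: measurable_points.
Qed.

Lemma campbell_fst_null (N : set conf) : measurable N -> mu N = 0%E ->
  campbell (fst @^-1` N) = 0%E.
Proof.
move=> mN N0; apply/eqP; rewrite eq_le measure_ge0 andbT.
rewrite [leLHS](_ : _ = \int[campbell]_p (\1_N p.1)%:E)%E; last first.
  rewrite (_ : (fun p : conf * V => _) = (fun p => (\1_(fst @^-1` N) p)%:E)).
    rewrite integral_indic ?setIT// -[X in measurable X]setTI.
    exact: measurable_fst.
  by apply/funext => p; rewrite !indicE; congr (_%:R%:E).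
rewrite integral_campbell.
- apply: (@le_trans _ _ (\int[mu]_g ((\1_N g)%:E * +oo))%E).
    apply: nonneg_integral_mono => g; first by apply: esum_ge0 => x _; rewrite lee_fin.
    rewrite /=; have [gN|gN] := pselect (N g).
      by rewrite indicE mem_set// mul1e leey.
    by rewrite indicE memNset// mul0e esum1// => x _; rewrite indicE memNset.
  by rewrite integral_indic_pinfty.
- by move=> p; rewrite lee_fin.
- apply/measurable_EFinP; apply: measurableT_comp => //; exact: measurable_indic.
Qed.

(** The Gibbs identity turns the mass into an integral where the point is added before it is
    deleted, which gives back g. The integrand is then supported by [N], and bounding it there by
    +oo dispenses with any estimate of the Boltzmann factor. *)
Lemma campbell_del_null (N : set conf) : measurable N -> mu N = 0%E ->
  campbell ((fun p : conf * V => del_point p.1 p.2) @^-1` N) = 0%E.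
Proof.
move=> mN N0; set del := fun p : conf * V => _.
have mdel : measurable (del @^-1` N).
  by rewrite -[X in measurable X]setTI; exact: measurable_del_point.
apply/eqP; rewrite eq_le measure_ge0 andbT.
rewrite [leLHS](_ : _ = \int[campbell]_p (\1_N (del p))%:E)%E; last first.
  rewrite (_ : (fun p : conf * V => _) = (fun p => (\1_(del @^-1` N) p)%:E)).
    by rewrite integral_indic ?setIT.
  by apply/funext => p; rewrite !indicE; congr (_%:R%:E).
have mF : measurable_fun setT (fun p => (\1_N (del p))%:E : \bar R).
  apply/measurable_EFinP; apply: measurableT_comp; first exact: measurable_indic.
  exact: measurable_del_point.
rewrite integral_campbell//.
apply: (le_trans (gibbs_le (G := fun g _ => (\1_N g)%:E * +oo)%E _ mF _ _ _)).
- by move=> p; rewrite lee_fin.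
- by move=> g x; rewrite mule_ge0// lee_fin.
- by move=> g; exact: measurable_cst.
- move=> g x gx; rewrite /del /=.
  have -> : del_point (add_point g x) x = g.
    case: g gx => A lA /= gx; rewrite /del_point /add_point /=.
    have E : (A `|` [set x]) `\ x = A.
      apply/seteqP; split => [y [[//|->] []]//|y Ay]; split; first by left.
      by move=> /= yx; apply: gx; rewrite -yx.
    by move: (locally_finiteD1 _ _); rewrite /= E => l'; congr Config; exact: Prop_irrelevance.
  have [gN|gN] := pselect (N g).
    by rewrite indicE mem_set// mul1e leey.
  by rewrite indicE memNset// mul0e mule0.
- rewrite (_ : (fun g => _) = (fun g => (\1_N g)%:E * +oo * lebesgue_rV R d setT)%E); last first.
    by apply/funext => g; rewrite integral_cst.
  rewrite ge0_integralZr// ?integral_indic_pinfty ?mul0e//.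
  by apply: emeasurable_funM => //; exact/measurable_EFinP/measurable_indic.
Qed.

End campbell.

(** * Lattice cubes and boxes *)

Section lattice.
Context {R : realType} {d : nat}.
Local Notation V := 'rV[R]_d.
Local Notation Zd := 'rV[int]_d.
Implicit Types (r s : Zd) (x : V) (g : config R d).

Definition box (N : nat) : set Zd := [set r | (lattice_norm r < N)%N].

Definition cell x : Zd := \row_i Num.floor (x 0 i + 2^-1).

Lemma unit_cubeP r x : unit_cube r x <-> cell x = r.
Proof.
split=> [h|<- i].
  apply/rowP => i; rewrite mxE; apply: floor_def.
  have /andP[h1 h2] := h i; apply/andP; split; first lra.
  by rewrite intrD; lra.
rewrite mxE; have /andP[h1 h2] := Num.Theory.floor_itv (x 0 i + 2^-1) .
rewrite intrD in h2; apply/andP; split; lra.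
Qed.

Lemma lattice_norm_lt r N : (0 < N)%N ->
  (lattice_norm r < N)%N <-> forall i, (absz (r 0 i)%R < N)%N.
Proof.
move=> N0; split=> [h i|h]; first by apply: leq_ltn_trans h; exact: leq_bigmax.
by rewrite /lattice_norm; apply: (big_ind (fun k => (k < N)%N)) => // a b aN bN; rewrite gtn_max aN.
Qed.

Lemma lattice_norm_ge r i : (absz (r 0 i)%R <= lattice_norm r)%N.
Proof. exact: leq_bigmax. Qed.

Lemma lattice_normD r s : (lattice_norm (r + s)%R <= lattice_norm r + lattice_norm s)%N.
Proof.
apply/bigmax_leqP => i _; rewrite mxE.
have := lattice_norm_ge r i; have := lattice_norm_ge s i.
by move: (r 0 i) (s 0 i) (lattice_norm r) (lattice_norm s) => u v m n; lia.
Qed.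

Lemma lattice_normN r : lattice_norm (- r)%R = lattice_norm r.
Proof. by apply: eq_bigr => i _; rewrite mxE abszN. Qed.

Lemma lattice_normB r s : lattice_norm (r - s)%R = lattice_norm (s - r)%R.
Proof. by rewrite -lattice_normN opprB. Qed.

Lemma finite_box N : finite_set (box N).
Proof.
have sub : box N `<=` (fun f : {ffun 'I_d -> 'I_(N + N).+1} => \row_i ((f i)%:Z - N%:Z)%R) @` setT.
  move=> r /= rN.
  exists [ffun i => inord (absz (r 0 i + N%:Z)%R)] => //.
  apply/rowP => i; rewrite mxE ffunE.
  have := lattice_norm_ge r i; rewrite /box /= in rN => ri.
  have ri' := leq_ltn_trans ri rN; move: (r 0 i) ri' => u uN.
  rewrite inordK; lia.
by apply: (sub_finite_set sub); apply: finite_image; exact: finite_finset.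
Qed.

(** The half-side N - 1/2 is reached by unit cubes centred at lattice points of norm at most N - 1,
    whence the strict inequality in [box]. *)
Lemma cubeP N x : (0 < N)%N -> cube N x <-> box N (cell x).
Proof.
move=> N0; rewrite /box /= lattice_norm_lt//.
have Nr : (N%:R : R) = N.-1%:R + 1 by rewrite -[in LHS](prednK N0) -natr1.
split=> h i; have := h i; rewrite mxE.
  move=> /andP[h1 h2].
  have : - (N.-1)%:Z <= Num.floor (x 0 i + 2^-1).
    rewrite floor_ge_int intrN; lra.
  have : Num.floor (x 0 i + 2^-1) < N%:Z.
    rewrite floor_lt_int; lra.
  lia.
move=> h'; have /andP[h1 h2] := Num.Theory.floor_itv (x 0 i + 2^-1).
set f := Num.floor _ in h' h1 h2.
have f1 : - (N.-1)%:Z <= f by lia.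
have f2 : f + 1 <= N%:Z by lia.
have : (- (N.-1)%:Z)%:~R <= f%:~R :> R by rewrite ler_int.
have : (f + 1)%:~R <= (N%:Z)%:~R :> R by rewrite ler_int.
rewrite intrN -!pmulrn => f2' f1'.
apply/andP; split; lra.
Qed.

Lemma cube_box N : (0 < N)%N -> cube N = \bigcup_(r in box N) (unit_cube r : set V).
Proof.
move=> N0; apply/seteqP; split => x.
  by move=> /(cubeP _ N0) h; exists (cell x) => //; exact/unit_cubeP.
by move=> [r rN /unit_cubeP xr]; apply/(cubeP _ N0); rewrite xr.
Qed.

Lemma cube_lattice_box N : (0 < N)%N -> @cube_lattice R d N = box N.
Proof.
move=> N0; apply/seteqP; split => r /=; rewrite /cube_lattice /=.
  move=> /(cubeP _ N0); rewrite (_ : cell _ = r)//.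
  by apply/unit_cubeP => i; rewrite mxE; lra.
move=> rN; apply/(cubeP _ N0); rewrite (_ : cell _ = r)//.
by apply/unit_cubeP => i; rewrite mxE; lra.
Qed.

Lemma trivIset_unit_cube (D : set Zd) : trivIset D (@unit_cube R d).
Proof. by move=> r s _ _ [x [/unit_cubeP <- /unit_cubeP <-]]. Qed.

Lemma measurable_halfopen (a b : V) :
  measurable [set u : V | forall i, a 0 i <= u 0 i < b 0 i].
Proof.
rewrite (_ : [set _ | _] = \bigcap_(i in [set: 'I_d])
  (fun u : V => u 0 i) @^-1` `[a 0 i, b 0 i[%classic); last first.
  apply/seteqP; split=> u /= H i; first by move=> _; rewrite /= in_itv/=.
  by have := H i Logic.I; rewrite /= in_itv.
apply: fin_bigcap_measurable => // i _; rewrite -[X in measurable X]setTI.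
exact: measurable_coord.
Qed.

Lemma unit_cubeE r : unit_cube r = [set u : V | forall i,
  (\row_i ((r 0 i)%:~R - 2^-1) : V) 0 i <= u 0 i < (\row_i ((r 0 i)%:~R + 2^-1) : V) 0 i].
Proof. by apply/seteqP; split => u /= h i; have := h i; rewrite !mxE. Qed.

Lemma cubeE N : cube N = [set u : V | forall i,
  (const_mx (- (N%:R - 2^-1)) : V) 0 i <= u 0 i < (const_mx (N%:R - 2^-1) : V) 0 i].
Proof. by apply/seteqP; split => u /= h i; have := h i; rewrite !mxE. Qed.

Lemma measurable_unit_cube r : measurable (unit_cube r : set V).
Proof. by rewrite unit_cubeE; exact: measurable_halfopen. Qed.

Lemma measurable_cube N : measurable (cube N : set V).
Proof. by rewrite cubeE; exact: measurable_halfopen. Qed.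

Lemma norm_le_coord x (M : R) : 0 <= M -> (forall i, `|x 0 i| <= M) -> `|x| <= M.
Proof.
move=> M0 h; rewrite (_ : `|x| = mx_norm x)// mx_normrE; apply: (big_ind (fun y => y <= M)) => //.
  by move=> a b aM bM; rewrite ge_max aM.
by move=> [i j] _ /=; rewrite (ord1 i).
Qed.

Lemma cube_bounded N : (cube N : set V) `<=` cball N%:R.
Proof.
move=> x h; apply: norm_le_coord => // i; have /andP[h1 h2] := h i.
by rewrite ler_norml; apply/andP; split; lra.
Qed.

Lemma unit_cube_bounded r : (unit_cube r : set V) `<=` cball (lattice_norm r).+1%:R.
Proof.
move=> x h; apply: norm_le_coord => // i; have /andP[h1 h2] := h i.
have h3 : `|(r 0 i)%:~R| <= (lattice_norm r)%:R :> R.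
  by rewrite -intr_norm -abszE ler_nat lattice_norm_ge.
rewrite -natr1; move: h3; rewrite !ler_norml => /andP[h3 h4]; apply/andP; split; lra.
Qed.

Lemma cball_cube (M : R) : exists2 N, (0 < N)%N & cball M `<=` (cube N : set V).
Proof.
exists (Num.truncn `|M|).+2 => // x xM i.
have xi : `|x 0 i| <= `|x|.
  by rewrite (_ : `|x| = mx_norm x)// mx_normrE; apply: (le_bigmax_cond _ (fun i => `|x i.1 i.2|) (j := (0, i))).
have hM := truncnS_gt `|M|.
have : `|x 0 i| < (Num.truncn `|M|).+1%:R.
  by apply: le_lt_trans hM; apply: (le_trans xi); apply: (le_trans xM); exact: ler_norm.
rewrite ltr_norml => /andP[h1 h2]; rewrite -[(_.+2)%:R]natr1.
by apply/andP; split; lra.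
Qed.

Lemma lebesgue_unit_cube r : lebesgue_rV R d (unit_cube r) = 1%E.
Proof.
rewrite unit_cubeE lebesgue_rV_box => [|i]; last by rewrite !mxE; lra.
by rewrite big1// => i _; rewrite !mxE; lra.
Qed.

Definition nbox N : nat := #|` fset_set (box N)|.

Lemma measure_cube (m : {measure set V -> \bar R}) N : (0 < N)%N ->
  m (cube N) = (\sum_(r \in box N) m (unit_cube r))%E.
Proof.
move=> N0; rewrite cube_box// measure_fin_bigcup//.
- exact: finite_box.
- exact: trivIset_unit_cube.
- by move=> r _; exact: measurable_unit_cube.
Qed.

Lemma lebesgue_cube N : (0 < N)%N -> lebesgue_rV R d (cube N) = (nbox N)%:R%:E.
Proof.
move=> N0; rewrite measure_cube//.
under eq_fsbigr do rewrite lebesgue_unit_cube.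
rewrite fsbig_finite; last exact: finite_box.
by rewrite sumEFin big_const_seq count_predT iter_addr addr0.
Qed.

(** The lattice points are counted through the volume of the cube, each unit cube having volume
    1. *)
Lemma nboxE N : (0 < N)%N -> (nbox N)%:R = (2 * N%:R - 1) ^+ d :> R.
Proof.
move=> N0; apply: EFin_inj; rewrite -lebesgue_cube// cubeE lebesgue_rV_box => [|i].
  rewrite (eq_bigr (fun=> 2 * N%:R - 1)) => [|i _]; last by rewrite !mxE; lra.
  by rewrite prodr_const card_ord.
rewrite !mxE; have : 1 <= N%:R :> R by rewrite ler1n.
lra.
Qed.

End lattice.

(** * Abel summation and radial weights on the lattice *)

Section esum_facts.
Context {R : realType}.
Local Open Scope ereal_scope.

Lemma exchange_esum (I J : choiceType) (D : set I) (F : set J) (a : I -> J -> \bar R) :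
  (forall i j, 0 <= a i j) ->
  \esum_(i in D) \esum_(j in F) a i j = \esum_(j in F) \esum_(i in D) a i j.
Proof.
move=> a0; rewrite !esum_esum//.
rewrite (@reindex_esum _ _ _ (F `*` D) _ (fun p => (p.2, p.1)))//=.
split => [[i j] [] //|[x y] [x' y'] _ _ [-> ->]//|[i j] [Di Fj]].
by exists (j, i).
Qed.

Lemma esumZl (I : choiceType) (D : set I) (k : R) (a : I -> \bar R) : (0 <= k)%R ->
  (forall i, 0 <= a i) -> \esum_(i in D) (k%:E * a i) = k%:E * \esum_(i in D) a i.
Proof.
move=> k0 a0; have [->|kneq] := eqVneq k 0%R.
  by rewrite mul0e esum1// => i _; rewrite mul0e.
have kpos : (0 < k)%R by rewrite lt_neqAle eq_sym kneq.
(* One inequality, applied to [k] and to its inverse, gives both. *)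
have le (c : R) (b : I -> \bar R) : (0 < c)%R -> (forall i, 0 <= b i) ->
    \esum_(i in D) (c%:E * b i) <= c%:E * \esum_(i in D) b i.
  move=> c0 b0; apply: ge_ereal_sup => _ [X [fX XD] <-].
  rewrite -ge0_mule_fsumr//; apply: lee_wpmul2l; first by rewrite lee_fin ltW.
  by apply: ereal_sup_ubound; exists X.
apply/eqP; rewrite eq_le le//=.
rewrite muleC -lee_pdivlMr// muleC.
apply: le_trans (le k^-1%R (fun i => k%:E * a i) _ _).
- by apply: le_esum => i _; rewrite muleA -EFinM mulVf// mul1e.
- by rewrite invr_gt0.
- by move=> i; rewrite mule_ge0// lee_fin ltW.
Qed.

Lemma esum_subset (I : choiceType) (A B : set I) (a : I -> \bar R) :
  (forall i, 0 <= a i) -> A `<=` B -> \esum_(i in A) a i <= \esum_(i in B) a i.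
Proof.
move=> a0 AB; rewrite esum_mkcond [leRHS]esum_mkcond; apply: le_esum => i _.
case: ifPn => iA; last by case: ifPn.
by rewrite mem_set//; apply: AB; exact: set_mem.
Qed.

Lemma esum_term_le (I : choiceType) (A : set I) (a : I -> \bar R) i :
  (forall i, 0 <= a i) -> A i -> a i <= \esum_(i in A) a i.
Proof.
move=> a0 Ai; rewrite -(esum_set1 (a0 i)); apply: esum_subset => // j ->.
exact: Ai.
Qed.

(** Layer-cake formula: a decreasing null sequence is a nonnegative combination of indicators of k
    <= n. Applied to the lattice norm it turns radial sums over the lattice into sums over boxes. *)
Lemma esum_decrements (f : nat -> R) k : (forall m n, (m <= n)%N -> (f n <= f m)%R) ->
  f n @[n --> \oo] --> (0 : R)%R ->
  \esum_(n in [set: nat]) (((f n - f n.+1) * (k <= n)%N%:R)%R)%:E = (f k)%:E.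
Proof.
move=> fd f0.
have t0 n : 0 <= (((f n - f n.+1) * (k <= n)%N%:R)%R)%:E.
  by rewrite lee_fin mulr_ge0// subr_ge0 fd.
rewrite -nneseries_esumT//; apply/cvg_lim => //.
have E n : \sum_(0 <= i < n) (((f i - f i.+1) * (k <= i)%N%:R)%R)%:E = (f k - f (maxn k n))%:E.
  elim: n => [|n ih]; first by rewrite big_geq// maxn0 subrr.
  rewrite big_nat_recr//= ih -EFinD; congr (_%:E).
  have [kn|nk] := leqP k n.
    by rewrite mulr1 (maxn_idPr (leqW kn)) addrA subrK.
  by rewrite mulr0 addr0 (maxn_idPl nk).
rewrite (_ : (fun n => _) = (fun n => (f k - f (maxn k n))%:E)); last exact/funext.
apply: cvg_EFin; first exact: nearW.
rewrite -[X in _ --> X]subr0; apply: cvgB; first exact: cvg_cst.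
apply: cvg_trans f0; apply: near_eq_cvg; exists k => // n /= kn.
by rewrite (maxn_idPr kn).
Qed.

(** For k and l the norms of two lattice points, this is the total weight of the boxes that contain
    the first point and not the second. *)
Lemma esum_decrements_lt (f : nat -> R) k l : (forall m n, (m <= n)%N -> (f n <= f m)%R) ->
  \esum_(n in [set: nat]) (((f n - f n.+1) * ((k <= n)%N && (n < l)%N)%:R)%R)%:E =
  (Num.max (f k - f l) 0)%:E.
Proof.
move=> fd.
have t0 n : 0 <= (((f n - f n.+1) * ((k <= n)%N && (n < l)%N)%:R)%R)%:E.
  by rewrite lee_fin mulr_ge0// subr_ge0 fd.
rewrite -nneseries_esumT// (nneseries_split 0 l)// add0n.
rewrite [X in _ + X](_ : _ = 0) ?adde0; last first.
  by apply: eseries0 => i li _; rewrite ltnNge li andbF mulr0.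
have [kl|lk] := leqP k l; last first.
  rewrite big_nat_cond big1 => [|i /andP[/andP[_ il] _]]; last first.
    by rewrite leqNgt (ltn_trans il lk) /= mulr0.
  by rewrite max_r// subr_le0 fd// ltnW.
rewrite max_l; last by rewrite subr_ge0 fd.
elim: l kl {t0} => [|l ih].
  by rewrite leqn0 => /eqP ->; rewrite big_geq// subrr.
rewrite leq_eqVlt => /predU1P[->|kl].
  rewrite subrr big_nat_cond big1// => i /andP[/andP[_ il] _].
  by rewrite leqNgt il /= mulr0.
rewrite ltnS in kl.
rewrite big_nat_recr//= kl ltnSn /= mulr1.
rewrite (eq_big_nat _ _ (F2 := fun i => (((f i - f i.+1) * ((k <= i)%N && (i < l)%N)%:R)%R)%:E)).
  by rewrite ih// -EFinD addrA subrK.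
by move=> i /andP[_ il]; rewrite il ltnS (ltnW il).
Qed.

End esum_facts.

Section plateau.
Context {R : realType} {d : nat}.
Local Notation Zd := 'rV[int]_d.

(* The exponent exceeds d, which makes the function summable on the lattice. *)
Definition plateau (m k : nat) : R := (m%:R / (maxn m k)%:R) ^+ d.+1.

Lemma plateau_ge0 m k : 0 <= plateau m k.
Proof. by rewrite exprn_ge0// divr_ge0. Qed.

Lemma plateau_id m k : (0 < m)%N -> (k <= m)%N -> plateau m k = 1.
Proof. by move=> m0 km; rewrite /plateau (maxn_idPl km) divff ?expr1n// pnatr_eq0 -lt0n. Qed.

(** A factor c between the arguments, truncated below at m, costs a factor c^(d+1) on the values;
    monotonicity, slow variation under shifts and the doubling bound are all instances. *)
Lemma plateau_slow m k l (c : R) : (0 < m)%N -> 0 <= c ->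
  (maxn m l)%:R <= c * (maxn m k)%:R -> plateau m k <= c ^+ d.+1 * plateau m l.
Proof.
move=> m0 c0 h; rewrite /plateau -exprMn; apply: lerXn2r.
- by rewrite nnegrE divr_ge0.
- by rewrite nnegrE mulr_ge0// divr_ge0.
have l0 : 0 < (maxn m l)%:R :> R by rewrite ltr0n leq_max m0.
have k0 : 0 < (maxn m k)%:R :> R by rewrite ltr0n leq_max m0.
rewrite ler_pdivrMr// (_ : c * _ * _ = m%:R * (c * (maxn m k)%:R) / (maxn m l)%:R); last ring.
by rewrite ler_pdivlMr// ler_wpM2l.
Qed.

Lemma plateau_decr m k l : (0 < m)%N -> (k <= l)%N -> plateau m l <= plateau m k.
Proof.
move=> m0 kl; rewrite -[leRHS]mul1r -(expr1n R d.+1); apply: plateau_slow => //.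
by rewrite mul1r ler_nat geq_max !leq_max leqnn kl orbT.
Qed.

Lemma plateau_le1 m k : (0 < m)%N -> plateau m k <= 1.
Proof. by move=> m0; rewrite -[leRHS](plateau_id (k := 0) m0)//; exact: plateau_decr. Qed.

Lemma plateau_dyadic m k : (0 < m)%N -> exists l, (k < m * 2 ^ l)%N /\
  plateau m k <= 2 ^+ d.+1 / (2 ^+ l) ^+ d.+1.
Proof.
move=> m0; have ex : exists l, (k < m * 2 ^ l)%N.
  by exists k; apply: (leq_trans (ltn_expl k (ltnSn 1))); rewrite leq_pmull.
case: (ex_minnP ex) => -[kl _|l kl mn].
  exists 0%N; split => //; apply: (le_trans (plateau_le1 _ m0)).
  by rewrite expr0 expr1n divr1 exprn_ege1// ler1n.
exists l.+1; split => //.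
rewrite -expr_div_n; apply: lerXn2r.
- by rewrite nnegrE divr_ge0.
- by rewrite nnegrE divr_ge0// exprn_ge0.
have lk : (m * 2 ^ l <= k)%N by rewrite leqNgt; apply/negP => /mn; rewrite ltnn.
have k0 : 0 < (maxn m k)%:R :> R by rewrite ltr0n leq_max m0.
rewrite exprS invfM mulrA divff// mul1r ler_pdivrMr//.
rewrite ler_pdivlMl ?exprn_gt0// -natrX -natrM ler_nat mulnC (leq_trans lk)//.
exact: leq_maxr.
Qed.

Local Open Scope ereal_scope.

Lemma esum_box (c : R) n : (0 <= c)%R ->
  \esum_(r in [set: Zd]) (c * (lattice_norm r < n)%N%:R)%:E = (c * (@nbox d n)%:R)%:E.
Proof.
move=> c0.
have -> : \esum_(r in [set: Zd]) (c * (lattice_norm r < n)%N%:R)%:E =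
    \esum_(r in (box n : set Zd)) c%:E.
  rewrite [RHS]esum_mkcond; apply: eq_esum => r _.
  case: ifPn; first by rewrite inE /box /= => ->; rewrite mulr1.
  by rewrite notin_setE /box /= => /negP; case: ltnP => // _ _; rewrite mulr0.
rewrite esum_fset//; last exact: finite_box.
rewrite fsbig_finite; last exact: finite_box.
by rewrite sumEFin big_const_seq count_predT iter_addr addr0 mulr_natr.
Qed.

(** The function is dominated by indicators of the boxes of size m 2^l with coefficients 2^(d+1)
    2^(-l(d+1)). Such a box has at most (2 m 2^l)^d points, so the l-th term is at most 2^(2d+2) m^d
    / 2^(l+1). *)
Lemma plateau_sum m : (0 < d)%N -> (0 < m)%N ->
  \esum_(r in [set: Zd]) (plateau m (lattice_norm r))%:E <=
  (2 ^+ (d + d + 2) * m%:R ^+ d)%:E.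
Proof.
move=> d0 m0; pose c l : R := (2 ^+ d.+1 / (2 ^+ l) ^+ d.+1)%R.
have c0 l : (0 <= c l)%R by rewrite divr_ge0// !exprn_ge0.
apply: (@le_trans _ _ (\esum_(r in [set: Zd]) \esum_(l in [set: nat])
    (c l * (lattice_norm r < m * 2 ^ l)%N%:R)%:E)).
  apply: le_esum => r _.
  have [l [kl hl]] := plateau_dyadic (lattice_norm r) m0.
  apply: (@le_trans _ _ (c l * (lattice_norm r < m * 2 ^ l)%N%:R)%:E).
    by rewrite kl mulr1 lee_fin.
  by apply: (esum_term_le (a := fun l => (c l * _)%:E)) => // i; rewrite lee_fin mulr_ge0.
rewrite exchange_esum => [|r l]; last by rewrite lee_fin mulr_ge0.
apply: (@le_trans _ _ (\esum_(l in [set: nat])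
    ((2 ^+ (d + d + 2) * m%:R ^+ d) / (2 ^ l.+1)%:R)%:E)).
  apply: le_esum => l _; rewrite esum_box// lee_fin.
  have ml : (0 < m * 2 ^ l)%N by rewrite muln_gt0 m0 expn_gt0.
  have h : ((@nbox d (m * 2 ^ l))%:R <= (2 * m%:R * 2 ^+ l) ^+ d :> R)%R.
    rewrite nboxE//; apply: lerXn2r; rewrite ?nnegrE.
    - by rewrite subr_ge0 -natrM ler1n muln_gt0.
    - by rewrite !mulr_ge0// exprn_ge0.
    by rewrite natrM natrX mulrA gerBl.
  apply: (le_trans (ler_wpM2l (c0 l) h)); rewrite le_eqVlt; apply/orP; left; apply/eqP.
  have l2 : ((2 : R) ^+ l != 0)%R by rewrite expf_neq0// pnatr_eq0.
  rewrite /c natrX !exprMn (exprS (2 ^+ l)%R d) !exprS !exprD expr2.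
  by field; rewrite !expf_neq0//.
rewrite -nneseries_esumT; first by apply: epsilon_trick0; rewrite mulr_ge0// exprn_ge0.
by move=> l; rewrite lee_fin divr_ge0// mulr_ge0// exprn_ge0.
Qed.

End plateau.
Arguments plateau {R} d m k.

Section radial_functions.
Context {R : realType} {d : nat}.
Local Notation Zd := 'rV[int]_d.
Hypothesis hd : (0 < d)%N.

Lemma nbox_ge n : (n <= @nbox d n.+1)%N.
Proof.
rewrite -(ler_nat R) nboxE//.
have h : 1 <= 2 * n.+1%:R - 1 :> R by rewrite -natr1; have := ler0n R n; lra.
apply: (@le_trans _ _ (2 * n.+1%:R - 1)).
  by rewrite -natr1; have := ler0n R n; lra.
by rewrite -[leLHS]expr1 ler_weXn2l.
Qed.

(** At least n lattice points have norm at most n, and f is at least [f n] there; hence n times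
    [f n] is at most the whole sum. *)
Lemma radial_summable_cvg0 (f : nat -> R) :
  (forall m n, (m <= n)%N -> f n <= f m) -> (forall n, 0 <= f n) ->
  (\esum_(r in [set: Zd]) (f (lattice_norm r))%:E < +oo)%E -> f n @[n --> \oo] --> (0 : R).
Proof.
move=> f_decr f0 f_sum.
pose T := fine (\esum_(r in [set: Zd]) (f (lattice_norm r))%:E).
have TE : (\esum_(r in [set: Zd]) (f (lattice_norm r))%:E)%E = T%:E.
  by rewrite /T fineK// ge0_fin_numE// esum_ge0// => r _; rewrite lee_fin.
have h n : f n * n%:R <= T.
  apply: (@le_trans _ _ (f n * (@nbox d n.+1)%:R)).
    by rewrite ler_wpM2l ?ler_nat ?nbox_ge.
  rewrite -lee_fin -esum_box// -TE; apply: le_esum => r _; rewrite lee_fin ltnS.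
  by case: leqP => rn; rewrite ?mulr1 ?mulr0// f_decr.
rewrite -(cvg_shiftS f).
apply: (@squeeze_cvgr _ _ _ _ (fun=> 0) (fun n => T * n.+1%:R^-1)).
- by near=> n; rewrite /= f0/= ler_pdivlMr.
- exact: cvg_cst.
- rewrite -(mulr0 T); apply: cvgM; first exact: cvg_cst.
  exact: cvg_harmonic.
Unshelve. all: by end_near. Qed.

End radial_functions.

Section slowly_varying_weight.
Context {R : realType} {d : nat}.
Local Notation Zd := 'rV[int]_d.
Variables (hd : (0 < d)%N) (a : nat -> R).
Hypothesis a_decr : forall m n, (m <= n)%N -> a n <= a m.
Hypothesis a_gt0 : forall n, 0 < a n.
Hypothesis a_sum : (\esum_(r in [set: Zd]) (a (lattice_norm r))%:E < +oo)%E.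

Let T := fine (\esum_(r in [set: Zd]) (a (lattice_norm r))%:E).

Let TE : (\esum_(r in [set: Zd]) (a (lattice_norm r))%:E)%E = T%:E.
Proof.
rewrite /T fineK// ge0_fin_numE// esum_ge0// => r _.
by rewrite lee_fin ltW.
Qed.

Lemma sumT_ge0 : 0 <= T.
Proof. by rewrite -lee_fin -TE esum_ge0// => r _; rewrite lee_fin ltW. Qed.

Lemma decay_cvg0 : a n @[n --> \oo] --> (0 : R).
Proof. by apply: (radial_summable_cvg0 hd) => // n; exact: ltW. Qed.

Let b j := a j - a j.+1.
Let b_ge0 j : 0 <= b j. Proof. by rewrite subr_ge0 a_decr. Qed.

(** The part j >= J of the lattice sum of [a], once [a] is decomposed into indicators of boxes with
    coefficients [b]; the sum over all j is [T]. *)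
Let tail J : \bar R :=
  \esum_(j in [set: nat]) (b j * (J <= j)%N%:R * (@nbox d j.+1)%:R)%:E.

Lemma tail_cvg0 : tail J @[J --> \oo] --> (0 : \bar R)%E.
Proof.
pose f j : \bar R := (b j * (@nbox d j.+1)%:R)%:E.
have f0 j : (0 <= f j)%E by rewrite lee_fin mulr_ge0.
have -> : tail = (fun J => \sum_(J <= k <oo) f k)%E.
  apply/funext => J; rewrite /tail -nneseries_esumT; last first.
    by move=> j; rewrite lee_fin !mulr_ge0.
  rewrite [RHS]eseries_cond [RHS]eseries_mkcond; apply: eq_eseriesr => j _ /=.
  by case: ifP => _; rewrite ?mulr1// mulr0 mul0r.
apply: nneseries_tail_cvg => [|j _]; last exact: f0.
rewrite nneseries_esumT// (_ : \esum_(_ in _) _ = T%:E)%E ?ltry//.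
rewrite -TE /f; under eq_esum do rewrite -esum_box//.
rewrite exchange_esum => [|j r]; last by rewrite lee_fin mulr_ge0.
apply: eq_esum => r _; rewrite -(esum_decrements (lattice_norm r) a_decr decay_cvg0).
by apply: eq_esum => j _; rewrite ltnS.
Qed.

Lemma far_sum D : (\esum_(r in [set: Zd]) (a (lattice_norm r) * (D < lattice_norm r)%N%:R)%:E <=
  tail D.+1)%E.
Proof.
rewrite /tail; under [leRHS]eq_esum do rewrite -esum_box ?mulr_ge0//.
rewrite exchange_esum => [|j r]; last by rewrite lee_fin !mulr_ge0.
apply: le_esum => r _.
case: ltnP => Dr; last by rewrite mulr0 esum_ge0// => j _; rewrite lee_fin !mulr_ge0.
rewrite mulr1 -(esum_decrements (lattice_norm r) a_decr decay_cvg0).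
apply: le_esum => j _; rewrite lee_fin ltnS.
case: (leqP (lattice_norm r) j) => rj; last by rewrite !mulr0.
by rewrite (leq_trans Dr rj) !mulr1.
Qed.

(** In the layer-cake formula for [a] the indicators of k <= j become plateaus. Width 2j + 1 makes
    the result at k dominate [a] at k/2, and discarding j < J leaves only plateaus of width at least
    2J + 1. *)
Let WE J k : \bar R :=
  \esum_(j in [set: nat]) (b j * (J <= j)%N%:R * plateau d j.*2.+1 k)%:E.
Let W J k := fine (WE J k).

Let We_term J j k : 0 <= b j * (J <= j)%N%:R * plateau d j.*2.+1 k.
Proof. by rewrite !mulr_ge0// plateau_ge0. Qed.

Lemma WE_scale J k l (c : R) : 0 <= c -> (forall j, (J <= j)%N ->
    plateau d j.*2.+1 k <= c * plateau d j.*2.+1 l :> R) -> (WE J k <= c%:E * WE J l)%E.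
Proof.
move=> c0 h; rewrite /WE -esumZl => [|//|j]; last by rewrite lee_fin.
apply: le_esum => j _; rewrite -EFinM lee_fin.
rewrite mulrCA -!mulrA; apply: ler_wpM2l => //; rewrite mulrCA.
case: (leqP J j) => Jj; last by rewrite !mul0r mulr0.
by rewrite !mul1r; exact: h.
Qed.

Lemma WE_lo J k : (k <= J.*2.+1)%N -> WE J k = (a J)%:E.
Proof.
move=> kJ; rewrite -(esum_decrements J a_decr decay_cvg0); apply: eq_esum => j _.
case: (leqP J j) => Jj; last by rewrite mulr0 mul0r.
by rewrite plateau_id ?mulr1// (leq_trans kJ)// ltnS leq_double.
Qed.

Lemma WE_decr J k l : (k <= l)%N -> (WE J l <= WE J k)%E.
Proof.
move=> kl; rewrite -[leRHS]mul1e; apply: WE_scale => // j _.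
by rewrite mul1r plateau_decr.
Qed.

Lemma WE_fin J k : WE J k = (W J k)%:E.
Proof.
rewrite fineK// ge0_fin_numE; last by apply: esum_ge0 => j _; rewrite lee_fin.
by apply: (le_lt_trans (WE_decr J (leq0n k))); rewrite WE_lo// ltry.
Qed.

Lemma W_ge0 J k : 0 <= W J k.
Proof. by rewrite fine_ge0// esum_ge0// => j _; rewrite lee_fin. Qed.

Lemma W_decr J k l : (k <= l)%N -> W J l <= W J k.
Proof. by move=> kl; rewrite -lee_fin -!WE_fin; exact: WE_decr. Qed.

Lemma W_lo J k : (k <= J.*2.+1)%N -> W J k = a J.
Proof. by move=> kJ; rewrite /W WE_lo. Qed.

Lemma W_hi J k : (J.*2.+1 <= k)%N -> a k./2 <= W J k.
Proof.
move=> Jk; rewrite -lee_fin -WE_fin -(esum_decrements k./2 a_decr decay_cvg0).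
apply: le_esum => j _; rewrite lee_fin.
case: (leqP k./2 j) => kj; last by rewrite mulr0.
rewrite plateau_id//; last by lia.
by rewrite (_ : (J <= j)%N) ?mulr1//; lia.
Qed.

(** A shift by D multiplies an argument truncated below at m >= 2J + 1 by at most 1 + D / (2J + 1),
    uniformly over the plateaus involved. *)
Lemma W_slow J D k l : (l <= k + D)%N ->
  W J k <= (1 + D%:R / J.*2.+1%:R) ^+ d.+1 * W J l.
Proof.
move=> lk; rewrite -lee_fin EFinM -!WE_fin; apply: WE_scale => [|j Jj].
  by rewrite exprn_ge0// addr_ge0// divr_ge0.
have c0 : 0 <= 1 + D%:R / J.*2.+1%:R :> R by rewrite addr_ge0// divr_ge0.
apply: plateau_slow => //.
have J0 : 0 < J.*2.+1%:R :> R by rewrite ltr0n.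
rewrite mulrDl mul1r.
apply: (@le_trans _ _ ((maxn j.*2.+1 k)%:R + D%:R)).
  by rewrite -natrD ler_nat; lia.
rewrite lerD2l mulrAC ler_pdivlMr// ler_wpM2l// ler_nat; lia.
Qed.

Lemma W_double J k l : (l <= k.*2)%N -> W J k <= 2 ^+ d.+1 * W J l.
Proof.
move=> lk; rewrite -lee_fin EFinM -!WE_fin; apply: WE_scale => [|j Jj].
  by rewrite exprn_ge0.
by apply: plateau_slow => //; rewrite -natrM ler_nat; lia.
Qed.

(** For m = 2j + 1 the factor m^d in the mass of a plateau is exactly the number of points of the
    box of size j + 1, the coefficient in [tail]. *)
Lemma W_sum J : (\esum_(r in [set: Zd]) (W J (lattice_norm r))%:E <=
  (2 ^+ (d + d + 2))%:E * tail J)%E.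
Proof.
under eq_esum do rewrite -WE_fin.
rewrite exchange_esum => [|r j]; last by rewrite lee_fin.
rewrite /tail -esumZl; last 2 first.
- by rewrite exprn_ge0.
- by move=> j; rewrite lee_fin !mulr_ge0.
apply: le_esum => j _; under eq_esum do rewrite EFinM.
rewrite esumZl; last 2 first.
- by rewrite mulr_ge0.
- by move=> r; rewrite lee_fin plateau_ge0.
apply: (le_trans (lee_wpmul2l _ (plateau_sum hd _))) => //; first by rewrite lee_fin mulr_ge0.
rewrite -!EFinM lee_fin nboxE//.
rewrite (_ : 2 * j.+1%:R - 1 = j.*2.+1%:R); last by rewrite -muln2 -!natr1 natrM; ring.
by rewrite mulrCA lexx.
Qed.

Lemma tail_lt (e : R) : 0 < e -> exists N, forall J, (N <= J)%N -> (tail J < e%:E)%E.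
Proof.
have tail0 J : (0 <= tail J)%E by apply: esum_ge0 => j _; rewrite lee_fin !mulr_ge0.
move=> e0; have /fine_cvgP[[k1 _ f1] /cvgr0Pnorm_lt h] := tail_cvg0.
have [k2 _ f2] := h e e0.
exists (maxn k1 k2) => n; rewrite geq_max => /andP[n1 n2].
have := f2 n n2; rewrite /= ger0_norm ?fine_ge0//.
by rewrite -lte_fin fineK//; exact: f1.
Qed.

Lemma slope_lt D (e : R) : 0 < e -> exists N, forall J, (N <= J)%N ->
  (1 + D%:R / J.*2.+1%:R) ^+ d.+1 < 1 + e.
Proof.
move=> e0.
have : (fun J : nat => (1 + D%:R * J.+1%:R^-1 : R) ^+ d.+1) @ \oo --> (1 + D%:R * 0 : R) ^+ d.+1.
  apply: (@cvg_comp _ _ _ (fun J : nat => 1 + D%:R * J.+1%:R^-1 : R) (fun x : R => x ^+ d.+1)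
    _ (nbhs (1 + D%:R * 0 : R))); last exact: exprn_continuous.
  apply: cvgD; first exact: cvg_cst.
  apply: cvgM; [exact: cvg_cst|exact: cvg_harmonic].
rewrite mulr0 addr0 expr1n => /cvgr_lt/(_ (1 + e)).
rewrite ltrDl => /(_ e0)[N _ hN]; exists N => J NJ.
apply: le_lt_trans (hN J NJ) => /=.
have h k : 0 <= 1 + D%:R / k.+1%:R :> R by rewrite addr_ge0// divr_ge0.
apply: lerXn2r; rewrite ?nnegrE ?h// lerD2l ler_wpM2l//.
by rewrite lef_pV2 ?posrE// ler_nat; lia.
Qed.

(** Here k, l are the norms of two lattice points and t that of their difference. One summand on the
    right suffices in each of three regimes: t <= D by slow variation; t > D and k <= 2l by the
    doubling bound; t > D and k > 2l because [a t] is then at most [W J k]. *)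
Lemma kernel_pointwise (eta : R) D J k l t : 0 <= eta ->
  (1 + D%:R / J.*2.+1%:R) ^+ d.+1 <= 1 + eta ->
  (k <= l + t)%N -> (l <= k + t)%N ->
  a t * `|W J l - W J k| <= eta * W J k * a t +
    2 ^+ d.+1 * W J k * (a t * (D < t)%N%:R) + W J k * W J l.
Proof.
move=> eta0 he klt lkt; have at0 := ltW (a_gt0 t).
have Wk := W_ge0 J k; have Wl := W_ge0 J l.
have p2 : 1 <= 2 ^+ d.+1 :> R by rewrite exprn_ege1// ler1n.
have A0 : 0 <= eta * W J k * a t by rewrite !mulr_ge0.
have B0 : 0 <= 2 ^+ d.+1 * W J k * (a t * (D < t)%N%:R).
  by rewrite !mulr_ge0// exprn_ge0.
have C0 : 0 <= W J k * W J l by rewrite mulr_ge0.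
move: B0; have [tD|Dt] := leqP t D => B0.
  suff : `|W J l - W J k| <= eta * W J k.
    move=> /(ler_wpM2l at0) h; rewrite !mulr0 addr0; apply: (le_trans h).
    by rewrite mulrC lerDl.
  have h i j : (j <= i + D)%N -> W J i <= (1 + eta) * W J j.
    by move=> ij; apply: (le_trans (W_slow J ij)); rewrite ler_wpM2r// W_ge0.
  have hl : W J l <= (1 + eta) * W J k by apply: h; lia.
  have hk : W J k <= (1 + eta) * W J l by apply: h; lia.
  rewrite ler_norml; apply/andP; split; last lra.
  have m0 : 0 <= eta * W J k by rewrite mulr_ge0.
  case: (leqP k l) => kl; last by have := W_decr J (ltnW kl); lra.
  have := W_decr J kl => lek; have : eta * W J l <= eta * W J k by rewrite ler_wpM2l.
  lra.
rewrite mulr1 in B0 *.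
have [kl|lk] := leqP k l.*2.
  have hl := W_double J kl.
  suff : a t * `|W J l - W J k| <= 2 ^+ d.+1 * W J k * a t by move=> h; lra.
  rewrite mulrC ler_wpM2r//.
  have h1 : W J k <= 2 ^+ d.+1 * W J k by rewrite ler_peMl.
  by rewrite ler_norml; apply/andP; split; lra.
suff : a t * `|W J l - W J k| <= W J k * W J l by move=> h; lra.
(* Up to 2J + 1 the weight is constant and the difference vanishes. Beyond, t >= k - l >= k/2 gives
   a(t) <= a(k/2) <= W(k). *)
have [km|mk] := leqP k J.*2.+1.
  by rewrite !W_lo ?subrr ?normr0 ?mulr0//; [rewrite -(W_lo km) mulr_ge0| lia].
have := W_decr J (leq_trans (leq_addr _ _) (leq_trans (eq_leq (addnn l)) (ltnW lk))) => lek.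
rewrite ger0_norm ?subr_ge0//; apply: ler_pM => //; first by rewrite subr_ge0.
  by apply: (le_trans _ (W_hi (ltnW mk))); apply: a_decr; lia.
by rewrite gerBl.
Qed.

(* The weights average the plateaus with the decrements of a as coefficients:
   they dominate a, which controls the far part of the convolution, and they
   vary as slowly as the widest plateaus, which controls the near part. *)
Lemma slowly_varying_weight (eps : R) (m : nat) : 0 < eps ->
  exists w : nat -> R, [/\ forall k l, (k <= l)%N -> w l <= w k, forall k, 0 <= w k,
    0 < w 0%N, forall k, (k <= m)%N -> w k = w 0%N &
    (\esum_(r in [set: Zd]) (w (lattice_norm r))%:E < +oo)%E /\
    forall r : Zd, (\esum_(s in [set: Zd]) (a (lattice_norm (r - s)) *
      `|w (lattice_norm s) - w (lattice_norm r)|)%:E <= (eps * w (lattice_norm r))%:E)%E].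
Proof.
move=> e0; have T0 := sumT_ge0.
(* A third of [eps] for each summand of [kernel_pointwise]: near part, far part, and the product
   with the total mass of the weight. *)
have e3 : 0 < eps / 3 by rewrite divr_gt0.
have p0 n : 0 < 2 ^+ n :> R by rewrite exprn_gt0.
have [D /(_ D.+1 (leqnSn _)) hD] := tail_lt (divr_gt0 e3 (p0 d.+1)).
pose eta := eps / 3 / (T + 1).
have eta0 : 0 < eta by rewrite divr_gt0//; lra.
have [J1 hJ1] := slope_lt D eta0.
have [J2 hJ2] := tail_lt (divr_gt0 e3 (p0 (d + d + 2)%N)).
(* [J1] ensures slow variation, [J2] a small total mass, and [m] the constancy of the weight up to
   [m]. *)
pose J := maxn (maxn J1 J2) m.
have {}hJ1 : (1 + D%:R / J.*2.+1%:R) ^+ d.+1 <= 1 + eta by apply/ltW/hJ1; lia.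
have {hJ2}hJ2 : (\esum_(r in [set: Zd]) (W J (lattice_norm r))%:E <= (eps / 3)%:E)%E.
  apply: (le_trans (W_sum J)); rewrite muleC -lee_pdivlMr// -EFinM.
  by apply/ltW/hJ2; lia.
have {hD}hD : (\esum_(r in [set: Zd]) (a (lattice_norm r) * (D < lattice_norm r)%N%:R)%:E <=
    (eps / 3 / 2 ^+ d.+1)%:E)%E by apply: (le_trans (far_sum D)); exact: ltW.
exists (W J); split.
- by move=> k l; exact: W_decr.
- exact: W_ge0.
- by rewrite W_lo.
- by move=> k km; rewrite !W_lo//; lia.
split; first by apply: (le_lt_trans hJ2); rewrite ltry.
move=> r; set k := lattice_norm r; have Wk := W_ge0 J k.
have shift (f : nat -> \bar R) : \esum_(s in [set: Zd]) f (lattice_norm (r - s)) =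
    \esum_(s in [set: Zd]) f (lattice_norm s).
  rewrite [RHS](@reindex_esum _ _ _ setT setT (fun s : Zd => r - s))//.
  split=> // [s t _ _ /addrI/oppr_inj //|s _].
  by exists (r - s) => //; rewrite opprB addrC subrK.
apply: (@le_trans _ _ (\esum_(s in [set: Zd])
    ((eta * W J k)%:E * (a (lattice_norm (r - s)))%:E +
     (2 ^+ d.+1 * W J k)%:E * (a (lattice_norm (r - s)) * (D < lattice_norm (r - s))%N%:R)%:E +
     (W J k)%:E * (W J (lattice_norm s))%:E))%E).
  apply: le_esum => s _; rewrite -!EFinM -!EFinD lee_fin.
  apply: kernel_pointwise => //; first exact: ltW.
    by rewrite /k -{1}(subrK s r) addnC lattice_normD.
  by rewrite /k -{1}(subrK r s) addnC lattice_normB lattice_normD.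
have c1 : 0 <= eta * W J k by rewrite mulr_ge0// ltW.
have c2 : 0 <= 2 ^+ d.+1 * W J k by rewrite mulr_ge0// ltW.
have a0 n : 0 <= a n := ltW (a_gt0 n).
have P1 s : (0 <= (eta * W J k)%:E * (a (lattice_norm (r - s)))%:E)%E.
  by rewrite -EFinM lee_fin mulr_ge0.
have P2 s : (0 <= (2 ^+ d.+1 * W J k)%:E *
    (a (lattice_norm (r - s)) * (D < lattice_norm (r - s))%N%:R)%:E)%E.
  by rewrite -EFinM lee_fin (mulr_ge0 c2)// mulr_ge0.
have P3 s : (0 <= (W J k)%:E * (W J (lattice_norm s))%:E)%E.
  by rewrite -EFinM lee_fin mulr_ge0// W_ge0.
rewrite esumD; last 2 first.
- by move=> s _; rewrite adde_ge0.
- by move=> s _; exact: P3.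
rewrite esumD; last 2 first.
- by move=> s _; exact: P1.
- by move=> s _; exact: P2.
rewrite !esumZl//; last 3 first.
- by move=> s; rewrite lee_fin W_ge0.
- by move=> s; rewrite lee_fin mulr_ge0.
- by move=> s; rewrite lee_fin.
rewrite (shift (fun n => (a n)%:E)) (shift (fun n => (a n * (D < n)%N%:R)%:E)) TE.
apply: (@le_trans _ _ ((eta * W J k)%:E * T%:E + (2 ^+ d.+1 * W J k)%:E * (eps / 3 / 2 ^+ d.+1)%:E
   + (W J k)%:E * (eps / 3)%:E)%E).
  apply: leeD; last by apply: lee_wpmul2l; rewrite ?lee_fin.
  by apply: leeD => //; apply: lee_wpmul2l; rewrite ?lee_fin.
rewrite -!EFinM -!EFinD lee_fin.
have h1 : eta * T <= eps / 3.
  rewrite /eta mulrAC ler_pdivrMr; last lra.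
  by rewrite ler_wpM2l//; [exact: ltW | lra].
have h2 : 2 ^+ d.+1 * W J k * (eps / 3 / 2 ^+ d.+1) = W J k * (eps / 3).
  by field; rewrite lt0r_neq0.
rewrite h2 mulrAC.
have := ler_wpM2r Wk h1; lra.
Qed.

End slowly_varying_weight.

(** * Boxes with small boundary sum *)

Section good_boxes.
Context {R : realType} {d : nat}.
Local Notation Zd := 'rV[int]_d.
Implicit Types (c : Zd -> R) (a : nat -> R).

Definition box_sum c N : \bar R := \esum_(r in box N) (c r)%:E.

(** With [c] the squared counts, (c r + c s) / 2 bounds the product of counts in lower regularity.
    Linearity in [c] is what makes averaging over boxes possible. *)
Definition boundary_sum a c N : \bar R :=
  \esum_(r in box N) \esum_(s in ~` box N) (a (lattice_norm (r - s)) * ((c r + c s) / 2))%:E.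

Lemma mem_box (r : Zd) N : (r \in box N) = (lattice_norm r < N)%N.
Proof. by apply/idP/idP; rewrite inE. Qed.

Lemma box_sumE c N : box_sum c N =
  \esum_(r in [set: Zd]) (c r * (lattice_norm r < N)%N%:R)%:E.
Proof.
rewrite /box_sum esum_mkcond; apply: eq_esum => r _; rewrite mem_box.
by case: ltnP; rewrite ?mulr1 ?mulr0.
Qed.

Lemma boundary_sumE a c N : boundary_sum a c N =
  \esum_(r in [set: Zd]) \esum_(s in [set: Zd]) (a (lattice_norm (r - s)) *
    ((c r + c s) / 2) * ((lattice_norm r < N) && (N <= lattice_norm s))%N%:R)%:E.
Proof.
rewrite /boundary_sum esum_mkcond; apply: eq_esum => r _; rewrite mem_box.
case: ltnP => rN /=; last by rewrite esum1// => s _; rewrite mulr0.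
rewrite esum_mkcond; apply: eq_esum => s _; rewrite in_setC mem_box -leqNgt.
by case: leqP; rewrite ?mulr1 ?mulr0.
Qed.

Lemma box_sumZ c N (k : R) : 0 <= k -> (forall r, 0 <= c r) ->
  (k%:E * box_sum c N)%E = \esum_(r in [set: Zd]) (k * (c r * (lattice_norm r < N)%N%:R))%:E.
Proof. by move=> k0 c0; rewrite box_sumE -esumZl// => r; rewrite lee_fin mulr_ge0. Qed.

Lemma boundary_sumZ a c N (k : R) : 0 <= k -> (forall r, 0 <= c r) -> (forall n, 0 <= a n) ->
  (k%:E * boundary_sum a c N)%E =
  \esum_(r in [set: Zd]) \esum_(s in [set: Zd]) (k * (a (lattice_norm (r - s)) *
    ((c r + c s) / 2) * ((lattice_norm r < N) && (N <= lattice_norm s))%N%:R))%:E.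
Proof.
move=> k0 c0 a0; have B0 r s : 0 <= a (lattice_norm (r - s)) *
    ((c r + c s) / 2) * ((lattice_norm r < N) && (N <= lattice_norm s))%N%:R.
  by rewrite !mulr_ge0// addr_ge0.
rewrite boundary_sumE -esumZl//; last by move=> r; apply: esum_ge0 => s _; rewrite lee_fin.
by apply: eq_esum => r _; rewrite -esumZl// => s; rewrite lee_fin.
Qed.

Variables (hd : (0 < d)%N) (a : nat -> R).
Hypothesis a_decr : forall m n, (m <= n)%N -> a n <= a m.
Hypothesis a_gt0 : forall n, 0 < a n.
Hypothesis a_sum : (\esum_(r in [set: Zd]) (a (lattice_norm r))%:E < +oo)%E.

(* Averaging the boxes with the decrements of a slowly varying weight w turns
   the boundary sums into convolutions of a with differences of w, which are
   negligible with respect to w itself; hence the boundary sum of some box is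
   small. *)
Lemma good_box (eps C : R) (N0 : nat) : 0 < eps -> 0 <= C ->
  exists2 M : R, 0 <= M & forall c, (forall r, 0 <= c r) ->
    (exists k : R, forall N, (0 < N)%N -> (box_sum c N <= (k * (@nbox d N)%:R)%:E)%E) ->
    (M%:E < box_sum c N0)%E ->
    exists N, [/\ (N0 <= N)%N, (0 < N)%N, (boundary_sum a c N <= eps%:E * box_sum c N)%E &
      ((C * (@nbox d N)%:R)%:E <= box_sum c N)%E].
Proof.
move=> e0 C0.
(* The weight is constant up to [N0], so its decrements vanish there and only boxes larger than [N0]
   enter the average. *)
have [w [w_decr w_ge0 w_gt0 w_lo [w_sum w_ker]]] :=
  slowly_varying_weight hd a_decr a_gt0 a_sum N0 (divr_gt0 e0 (ltr0n R 2)).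
have w_cvg := radial_summable_cvg0 hd w_decr w_ge0 w_sum.
pose w1 := fine (\esum_(r in [set: Zd]) (w (lattice_norm r))%:E).
have w1E : (\esum_(r in [set: Zd]) (w (lattice_norm r))%:E)%E = w1%:E.
  by rewrite /w1 fineK// ge0_fin_numE// esum_ge0// => r _; rewrite lee_fin.
have w1_ge0 : 0 <= w1 by rewrite -lee_fin -w1E esum_ge0// => r _; rewrite lee_fin.
(* Read off from the last step: without a good box, [w 0] times the sum over the box [N0] is at most
   2 C w1. *)
exists (2 * C * w1 / w 0%N); first by rewrite divr_ge0// !mulr_ge0.
move=> c c0 [k ck]; rewrite ltNge => /negP; apply: contra_notP => no.
pose om n := w n - w n.+1.
have om0 n : 0 <= om n by rewrite subr_ge0 w_decr.
pose Q : \bar R := \esum_(r in [set: Zd]) (c r * w (lattice_norm r))%:E.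
have S0 N : (0 <= box_sum c N)%E by apply: esum_ge0 => r _; rewrite lee_fin.
have B0 r s : 0 <= a (lattice_norm (r - s)) * ((c r + c s) / 2).
  by rewrite mulr_ge0 ?divr_ge0 ?addr_ge0// ltW.
have X0 N : (0 <= boundary_sum a c N)%E.
  by apply: esum_ge0 => r _; apply: esum_ge0 => s _; rewrite lee_fin.
have sumS : (\esum_(n in [set: nat]) ((om n)%:E * box_sum c n.+1) = Q)%E.
  under eq_esum do rewrite box_sumZ//.
  rewrite exchange_esum => [|n r]; last by rewrite lee_fin !mulr_ge0.
  apply: eq_esum => r _; rewrite EFinM -(esum_decrements (lattice_norm r) w_decr w_cvg).
  rewrite -esumZl//; last by move=> n; rewrite lee_fin mulr_ge0//; exact: om0.
  by apply: eq_esum => n _; rewrite -!EFinM ltnS mulrCA.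
have sumN : (\esum_(n in [set: nat]) ((om n * (@nbox d n.+1)%:R)%:E) = w1%:E)%E.
  rewrite -w1E; under eq_esum do rewrite -esum_box//.
  rewrite exchange_esum => [|n r]; last by rewrite lee_fin mulr_ge0.
  apply: eq_esum => r _; rewrite -(esum_decrements (lattice_norm r) w_decr w_cvg).
  by apply: eq_esum => n _; rewrite ltnS.
(* The growth bound on [c] enters here: only a finite [Q] can be absorbed in the final
   inequality. *)
have Qfin : (Q < +oo)%E.
  apply: (@le_lt_trans _ _ (`|k| * w1)%:E); last exact: ltry.
  rewrite EFinM -sumN -esumZl//; last by move=> n; rewrite lee_fin mulr_ge0.
  rewrite -sumS; apply: le_esum => n _; rewrite -EFinM mulrCA EFinM.
  apply: lee_wpmul2l; first by rewrite lee_fin.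
  apply: (le_trans (ck n.+1 _)) => //; rewrite lee_fin ler_wpM2r//; exact: ler_norm.
have Q0 : (0 <= Q)%E by apply: esum_ge0 => r _; rewrite lee_fin mulr_ge0.
(* The boxes containing r and not s have total weight the positive part of w(|r|) - w(|s|), so the
   average of the boundary sums is a convolution of [a] with differences of [w]. The terms with c r
   and with c s each contribute at most eps / 4 times [Q]. *)
have sumX : (\esum_(n in [set: nat]) ((om n)%:E * boundary_sum a c n.+1) <= (eps / 2)%:E * Q)%E.
  pose D (r s : Zd) := `|w (lattice_norm r) - w (lattice_norm s)|.
  have ad (r s : Zd) : 0 <= a (lattice_norm (r - s)) * D r s.
    by apply: mulr_ge0; [exact: ltW|exact: normr_ge0].
  apply: (@le_trans _ _ (\esum_(r in [set: Zd]) \esum_(s in [set: Zd])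
    ((c r / 2 * (a (lattice_norm (r - s)%R) * D r s))%R%:E +
     (c s / 2 * (a (lattice_norm (r - s)%R) * D r s))%R%:E))%E).
    have a0 n : 0 <= a n := ltW (a_gt0 n).
    under eq_esum do rewrite boundary_sumZ//.
    rewrite exchange_esum => [|n r]; last first.
      by apply: esum_ge0 => s _; rewrite lee_fin mulr_ge0// mulr_ge0.
    apply: le_esum => r _.
    rewrite exchange_esum => [|n s]; last by rewrite lee_fin mulr_ge0// mulr_ge0.
    apply: le_esum => s _; set k1 := lattice_norm r; set k2 := lattice_norm s.
    rewrite (_ : \esum_(_ in _) _ = ((a (lattice_norm (r - s)) * ((c r + c s) / 2)) *
        Num.max (w k1 - w k2) 0)%:E); last first.
      rewrite EFinM -esum_decrements_lt// -esumZl//; last first.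
        by move=> n; rewrite lee_fin mulr_ge0//; exact: om0.
      by apply: eq_esum => n _; rewrite -!EFinM ltnS mulrCA.
    rewrite -EFinD lee_fin -mulrDl -[X in _ <= X * _]mulrDl mulrCA mulrA.
    apply: (@le_trans _ _ ((c r + c s) / 2 * (a (lattice_norm (r - s)) * Num.max (w k1 - w k2) 0))).
      by rewrite le_eqVlt; apply/orP; left; apply/eqP; ring.
    apply: ler_wpM2l; first by rewrite divr_ge0 ?addr_ge0.
    apply: ler_wpM2l; first exact: ltW.
    by rewrite ge_max ler_norm normr_ge0.
  have half f : (forall r, (f r <= (eps / 2 * w (lattice_norm r))%:E)%E) ->
      (\esum_(r in [set: Zd]) ((c r / 2)%R%:E * f r) <= (eps / 2 / 2)%:E * Q)%E.
    move=> hf; rewrite -esumZl ?divr_ge0 ?(ltW e0)//; last first.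
      by move=> r; rewrite lee_fin mulr_ge0.
    apply: le_esum => r _; apply: (le_trans (lee_wpmul2l _ (hf r))).
      by rewrite lee_fin divr_ge0.
    by rewrite -!EFinM lee_fin le_eqVlt; apply/orP; left; apply/eqP; ring.
  have P x r s : (0 <= (c x / 2 * (a (lattice_norm (r - s)) * D r s))%R%:E)%E.
    by rewrite lee_fin mulr_ge0// divr_ge0.
  have P' x r : (0 <= \esum_(s in [set: Zd]) (c (x r s) / 2 * (a (lattice_norm (r - s)%R) * D r s))%R%:E)%E.
    by apply: esum_ge0 => s _; exact: P.
  rewrite (eq_esum (fun r _ => esumD (fun s _ => P r r s) (fun s _ => P s r s))).
  rewrite (esumD (fun r _ => P' (fun r _ => r) r) (fun r _ => P' (fun _ s => s) r)).
  rewrite (_ : eps / 2 = eps / 2 / 2 + eps / 2 / 2); last by field.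
  rewrite EFinD ge0_muleDl; last 2 first.
  - by rewrite lee_fin !divr_ge0// ltW.
  - by rewrite lee_fin !divr_ge0// ltW.
  apply: leeD.
    rewrite (_ : \esum_(r in _) _ = \esum_(r in [set: Zd]) ((c r / 2)%R%:E *
        \esum_(s in [set: Zd]) (a (lattice_norm (r - s)) * D r s)%R%:E))%E; last first.
      by apply: eq_esum => r _; rewrite -esumZl ?divr_ge0// => s; rewrite lee_fin.
    apply: half => r; apply: le_trans (w_ker r); apply: le_esum => s _.
    by rewrite /D distrC.
  rewrite exchange_esum => [|r s]; last exact: P.
  rewrite (_ : \esum_(r in _) _ = \esum_(s in [set: Zd]) ((c s / 2)%R%:E *
      \esum_(r in [set: Zd]) (a (lattice_norm (r - s)) * D r s)%R%:E))%E; last first.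
    by apply: eq_esum => r _; rewrite -esumZl ?divr_ge0// => s; rewrite lee_fin.
  apply: half => s; apply: le_trans (w_ker s); apply: le_esum => r _.
  by rewrite lattice_normB.
(* In the absence of a good box, every box larger than [N0] has a boundary sum above eps times its
   sum, or a sum below C times its volume. Adding both alternatives bounds eps times the box sum,
   and the average gives the claim. *)
have key : (eps%:E * Q <= (eps / 2)%:E * Q + (eps * C * w1)%:E)%E.
  have eC : 0 <= eps * C by rewrite mulr_ge0// ltW.
  have -> : ((eps * C * w1)%:E = \esum_(n in [set: nat]) ((eps * C)%:E *
      (om n * (@nbox d n.+1)%:R)%R%:E))%E.
    by rewrite esumZl ?sumN// => n; rewrite lee_fin mulr_ge0.
  have -> : (eps%:E * Q = \esum_(n in [set: nat]) (eps%:E * ((om n)%:E * box_sum c n.+1)))%E.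
    by rewrite esumZl ?sumS// ?(ltW e0)// => n; rewrite mule_ge0// lee_fin.
  apply: le_trans (leeD sumX (lexx _)).
  rewrite -esumD; last 2 first.
  - by move=> n _; rewrite mule_ge0// lee_fin.
  - by move=> n _; rewrite -EFinM lee_fin !mulr_ge0// ltW.
  apply: le_esum => n _.
  have [nN0|N0n] := ltnP n N0.
    have -> : om n = 0 by rewrite /om (w_lo n)// ?(w_lo n.+1) ?subrr// ltnW.
    by rewrite mul0r !mul0e mule0 add0e -EFinM mulr0.
  rewrite muleCA -EFinM mulrCA EFinM -ge0_muleDr//; last by rewrite lee_fin !mulr_ge0// ltW.
  apply: lee_wpmul2l; first by rewrite lee_fin.
  have [SX|XS] := leP (eps%:E * box_sum c n.+1)%E (boundary_sum a c n.+1).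
    by apply: (le_trans SX); rewrite leeDl// lee_fin !mulr_ge0// ltW.
  have [CS|SC] := leP (C * (@nbox d n.+1)%:R)%:E (box_sum c n.+1).
    by exfalso; apply: no; exists n.+1; split => //; [exact: leqW|exact: ltW].
  apply: (@le_trans _ _ ((eps * C * (@nbox d n.+1)%:R)%:E)); last by rewrite leeDr.
  by rewrite -mulrA EFinM lee_wpmul2l ?lee_fin ?(ltW e0)// ltW.
have {key}Qle : (Q <= (2 * C * w1)%:E)%E.
  move: key Qfin Q0; move: (Q) => -[q| |]//; rewrite -!EFinM -EFinD !lee_fin => key _ _.
  by rewrite -(ler_pM2l e0); nra.
rewrite EFinM lee_pdivlMr//; apply: le_trans Qle.
rewrite muleC box_sumZ//; apply: le_esum => r _; rewrite lee_fin mulrCA ler_wpM2l//.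
by case: ltnP => rN; rewrite ?mulr1 ?mulr0// (w_lo (lattice_norm r))// ltnW.
Qed.

End good_boxes.

(** * Energy of the points in a cube and its exponential moments *)

Section pair_energy.
Context {R : realType} {d : nat}.
Local Notation V := 'rV[R]_d.
Local Notation conf := (config R d).
Implicit Types (g : conf) (x y : V) (psi : V -> \bar R).
Local Open Scope ereal_scope.

Lemma esum_add_point g x0 (a : V -> \bar R) : (forall x, 0 <= a x) -> ~ points g x0 ->
  \esum_(x in points (add_point g x0)) a x = \esum_(x in points g) a x + a x0.
Proof.
move=> a0 gx0; rewrite (esumID (points g))//; congr (_ + _).
  by rewrite (_ : _ `&` _ = points g)//; apply/seteqP; split => [x []//|x gx]; split => //; left.
rewrite (_ : _ `&` _ = [set x0]) ?esum_set1//.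
by apply/seteqP; split => [x [[]]//|x ->]; split => //; right.
Qed.

Variables (N : nat).
Local Notation L := (cube N : set V).

(* A pair inside the cube is counted in both orders with weight 1/2, a pair
   with exactly one point inside is counted once. *)
Definition pair_weight x y : R := (\1_L x * (1 - \1_L y / 2) * (x != y)%:R)%R.

Definition pair_sum psi g : \bar R :=
  \esum_(x in points g) \esum_(y in points g) ((pair_weight x y)%:E * psi (x - y)%R).

Lemma pair_weight_ge0 x y : (0 <= pair_weight x y)%R.
Proof.
by rewrite /pair_weight !mulr_ge0// !indicE; case: (_ \in _) => /=; lra.
Qed.

Lemma pair_weight_term psi x y : (forall u, 0 <= psi u) ->
  0 <= (pair_weight x y)%:E * psi (x - y)%R.
Proof. by move=> psi0; rewrite mule_ge0// lee_fin pair_weight_ge0. Qed.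

Lemma measurable_pair_weight : measurable_fun setT (fun p : V * V => pair_weight p.1 p.2).
Proof.
have mL := @measurable_cube R d N.
apply: measurable_funM; last first.
  rewrite (_ : (fun p => _) = \1_(~` [set p : V * V | p.1 = p.2])).
    by apply: measurable_indic; apply: measurableC; exact: measurable_diag.
  apply/funext => p; rewrite indicE; case: eqVneq => h /=; first by rewrite memNset//=; apply.
  by rewrite mem_set//=; exact/eqP.
apply: measurable_funM.
  by apply: measurableT_comp => //; exact: measurable_indic.
apply: measurable_funB => //; apply: measurable_funM => //.
by apply: measurableT_comp => //; exact: measurable_indic.
Qed.

Lemma measurable_subrV : measurable_fun setT (fun p : V * V => (p.1 - p.2)%R).
Proof.
apply: (@measurability _ _ _ _ _ _ (@open V)) => // _ [U oU <-].
rewrite setTI (open_bigcup_rat_ball oU) bigcup_mkcond preimage_bigcup.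
apply: countable_bigcupT_measurable => // k; case: ifPn => _; last first.
  by rewrite preimage_set0.
rewrite (_ : _ @^-1` _ = \bigcap_(i in [set: 'I_d])
    (fun p : V * V => (p.1 0 i - p.2 0 i)%R) @^-1` ball (ratr (k.1 0%R i) : R) k.2.+1%:R^-1%R); last first.
  apply/seteqP; split=> [p [_ kp] i _|p kp].
    by have := kp 0%R i; rewrite !mxE.
  split=> [|i j]; first by rewrite /= invr_gt0.
  by rewrite !mxE (ord1 i); exact: kp.
apply: fin_bigcap_measurable => // i _; rewrite -[X in measurable X]setTI.
suff : measurable_fun setT (fun p : V * V => (p.1 0 i - p.2 0 i)%R).
  by apply => //; exact: measurable_ball.
by apply: measurable_funB;
  [exact: (measurableT_comp (measurable_coord i) measurable_fst)
  |exact: (measurableT_comp (measurable_coord i) measurable_snd)].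
Qed.

Lemma measurable_pair_sum psi : (forall u, 0 <= psi u) -> measurable_fun setT psi ->
  measurable_fun setT (pair_sum psi).
Proof.
move=> psi0 mpsi.
pose F (t : (conf * V) * V) := (pair_weight t.1.2 t.2)%:E * psi (t.1.2 - t.2)%R.
have F0 t : 0 <= F t by exact: pair_weight_term.
have m12 : measurable_fun setT (fun t : (conf * V) * V => (t.1.2, t.2)).
  apply: measurable_fun_pair => //.
  exact: measurableT_comp measurable_snd measurable_fst.
have mF : measurable_fun setT F.
  apply: emeasurable_funM.
    by apply/measurable_EFinP; apply: (measurableT_comp measurable_pair_weight m12).
  apply: measurableT_comp => //; exact: (measurableT_comp measurable_subrV m12).
have mG := @measurable_esum R d _ _ (fst : conf * V -> conf) measurable_fst F F0 mF.
apply: (@measurable_esum R d _ _ id (@measurable_id _ _ setT)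
  (fun p : conf * V => \esum_(y in points p.1) F (p, y))).
  by move=> p; exact: esum_ge0.
exact: mG.
Qed.

(** The weights of (x0, y) and (y, x0) add up to 1 in both cases: 1/2 + 1/2 for y in the cube, 1 + 0
    for y outside. *)
Lemma pair_sum_add psi g x0 : (forall u, 0 <= psi u) -> (forall u, psi (- u)%R = psi u) ->
  L x0 -> ~ points g x0 ->
  pair_sum psi (add_point g x0) = pair_sum psi g + \esum_(y in points g) psi (x0 - y)%R.
Proof.
move=> psi0 even Lx0 gx0; have k0 x y := pair_weight_term x y psi0.
rewrite /pair_sum esum_add_point//; last by move=> x; exact: esum_ge0.
under eq_esum do rewrite esum_add_point//.
rewrite esumD; last 2 first.
- by move=> x _; exact: esum_ge0.
- by move=> x _; exact: k0.
rewrite -addeA esum_add_point//.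
have -> : pair_weight x0 x0 = 0%R by rewrite /pair_weight eqxx mulr0.
rewrite mul0e adde0.
congr (_ + _); rewrite -esumD//; apply: eq_esum => y gy.
rewrite -(even (y - x0)%R) opprB -ge0_muleDl ?lee_fin ?pair_weight_ge0//.
rewrite /pair_weight -EFinD (_ : (y == x0) = false); last first.
  by apply/eqP => yx; apply: gx0; rewrite -yx.
rewrite (_ : (x0 == y) = false); last by apply/eqP => yx; apply: gx0; rewrite yx.
rewrite !indicE (mem_set Lx0) [X in X%:E](_ : _ = 1%R) ?mul1e//.
by case: (_ \in _) => /=; field.
Qed.

End pair_energy.

Section gibbs_recursion.
Context {R : realType} {d : nat}.
Local Notation V := 'rV[R]_d.
Local Notation conf := (config R d).
Implicit Types (g : conf) (x y : V).
Local Open Scope ereal_scope.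

Variables (phi : V -> \bar R) (N : nat).
Hypotheses (hphi : pair_potential phi) (N0 : (0 < N)%N).
Local Notation L := (cube N : set V).

Definition pos_part (u : V) : \bar R := maxe (phi u) 0.
Definition neg_part (u : V) : \bar R := maxe (- phi u) 0.

Lemma pos_part_ge0 u : 0 <= pos_part u. Proof. by rewrite le_max lexx orbT. Qed.
Lemma neg_part_ge0 u : 0 <= neg_part u. Proof. by rewrite le_max lexx orbT. Qed.

Lemma pos_part_even u : pos_part (- u)%R = pos_part u.
Proof. by rewrite /pos_part (potential_even hphi). Qed.

Lemma neg_part_even u : neg_part (- u)%R = neg_part u.
Proof. by rewrite /neg_part (potential_even hphi). Qed.

Lemma measurable_pos_part : measurable_fun setT pos_part.
Proof. by apply: measurable_maxe => //; exact: (potential_measurable hphi). Qed.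

Lemma measurable_neg_part : measurable_fun setT neg_part.
Proof.
apply: measurable_maxe => //; apply: measurableT_comp => //.
exact: (potential_measurable hphi).
Qed.

Definition pos_energy g := pair_sum N pos_part g.
Definition neg_energy g := pair_sum N neg_part g.

Lemma pos_energy_ge0 g : 0 <= pos_energy g.
Proof.
by apply: esum_ge0 => x _; apply: esum_ge0 => y _; apply: pair_weight_term; exact: pos_part_ge0.
Qed.

Lemma neg_energy_ge0 g : 0 <= neg_energy g.
Proof.
by apply: esum_ge0 => x _; apply: esum_ge0 => y _; apply: pair_weight_term; exact: neg_part_ge0.
Qed.

Lemma measurable_pos_energy : measurable_fun setT pos_energy.
Proof. by apply: measurable_pair_sum; [exact: pos_part_ge0|exact: measurable_pos_part]. Qed.

Lemma measurable_neg_energy : measurable_fun setT neg_energy.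
Proof. by apply: measurable_pair_sum; [exact: neg_part_ge0|exact: measurable_neg_part]. Qed.

(* The inverse Boltzmann factor of the energy of the points in the cube. It is
   infinite when that energy is not absolutely convergent, so that lower
   bounds on the energy need not address convergence. *)
Definition exp_energy g : \bar R :=
  if (pos_energy g < +oo) && (neg_energy g < +oo)
  then (expR (fine (pos_energy g) - fine (neg_energy g)))%:E else +oo.

Lemma exp_energy_ge0 g : 0 <= exp_energy g.
Proof. by rewrite /exp_energy; case: ifP => // _; rewrite lee_fin expR_ge0. Qed.

Lemma measurable_exp_energy : measurable_fun setT exp_energy.
Proof.
have mp := measurable_pos_energy; have mn := measurable_neg_energy.
apply: measurable_fun_ifT => //.
  by apply: measurable_and; apply: measurable_fun_lte.
apply/measurable_EFinP; apply: measurableT_comp => //.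
by apply: measurable_funB; apply: measurableT_comp.
Qed.

(** The Boltzmann factor of the new point cancels its contribution to the energy. When [energy] is
    infinite the factor is zero, and when the energy of [g] is not absolutely convergent the
    right-hand side is infinite. *)
Lemma exp_energy_add g x : L x -> ~ points g x ->
  expeR (- energy phi x g) * exp_energy (add_point g x) <= exp_energy g.
Proof.
move=> Lx gx; rewrite /energy; case: ifPn => [fin|_]; last by rewrite /= mul0e exp_energy_ge0.
set ep := \esum_(y in points g) maxe (phi (x - y)%R) 0.
set en := \esum_(y in points g) maxe (- phi (x - y)%R) 0.
have Ep : pos_energy (add_point g x) = pos_energy g + ep.
  by rewrite /pos_energy pair_sum_add//; [exact: pos_part_ge0|exact: pos_part_even].
have En : neg_energy (add_point g x) = neg_energy g + en.
  by rewrite /neg_energy pair_sum_add//; [exact: neg_part_ge0|exact: neg_part_even].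
have ep0 : 0 <= ep by apply: esum_ge0 => y _; exact: pos_part_ge0.
have en0 : 0 <= en by apply: esum_ge0 => y _; exact: neg_part_ge0.
have ep1 : ep < +oo.
  apply: le_lt_trans fin; apply: le_esum => y _.
  by rewrite ge_max abse_ge0 andbT lee_abs.
have en1 : en < +oo.
  apply: le_lt_trans fin; apply: le_esum => y _.
  by rewrite ge_max abse_ge0 andbT -abseN lee_abs.
rewrite {2}/exp_energy; case: ifPn => [/andP[]|_]; last exact: leey.
rewrite /exp_energy Ep En; have := pos_energy_ge0 g; have := neg_energy_ge0 g.
move: ep0 ep1 en0 en1 {fin Ep En}.
case: ep => [p| |]//; case: en => [n| |]//; move: (pos_energy g) (neg_energy g).
move=> [a| |]// [b| |]// _ _ _ _ _ _ _ _.
rewrite -EFinN -!EFinD !ltry /= -EFinM lee_fin -expRD.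
by rewrite (_ : (_ + _ = a - b)%R)//; ring.
Qed.

Definition level (k : nat) : set conf := [set g | cnt g L = k%:R%:E].

Lemma measurable_level k : measurable (level k).
Proof.
rewrite -[X in measurable X]setTI.
exact: (measurable_cnt (@measurable_cube R d N) measurableT (emeasurable_set1 k%:R%:E)).
Qed.

Lemma cnt_level g : exists k, level k g.
Proof.
eexists; apply: cnt_finite; [exact: measurable_cube|exact: cube_bounded].
Qed.

Lemma level_add g x k : L x -> ~ points g x -> level k.+1 (add_point g x) -> level k g.
Proof.
move=> Lx gx; have mL := @measurable_cube R d N; rewrite /level /= !cntE//.
rewrite esum_add_point//.
rewrite -cntE//; have [j ->] := cnt_level g.
by rewrite indicE (mem_set Lx) -EFinD => -[]; rewrite natr1 => /eqP; rewrite eqr_nat eqSS => /eqP ->.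
Qed.

Variables (z : R) (mu : probability conf R).
Hypotheses (hd : (0 < d)%N) (z0 : (0 < z)%R) (hmu : gibbs z phi mu).

(** The factor [exp_energy] compensates the Boltzmann factors of the points in the cube, so these
    integrals obey the recursion of a Poisson process. *)
Definition level_energy k : \bar R := \int[mu]_g ((\1_(level k) g)%:E * exp_energy g).

Lemma measurable_level_energy k :
  measurable_fun setT (fun g => (\1_(level k) g)%:E * exp_energy g).
Proof.
apply: emeasurable_funM; last exact: measurable_exp_energy.
by apply/measurable_EFinP/measurable_indic; exact: measurable_level.
Qed.

Lemma level_term_ge0 k g : 0 <= (\1_(level k) g)%:E * exp_energy g.
Proof. by rewrite mule_ge0 ?lee_fin ?exp_energy_ge0. Qed.

Lemma level_energy0 : level_energy 0 <= 1.
Proof.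
have mL := @measurable_cube R d N.
apply: (@le_trans _ _ (\int[mu]_g (cst 1%E g))); last first.
  by rewrite integral_cst// mul1e; exact: probability_le1.
apply: nonneg_integral_mono => g; first exact: level_term_ge0.
have [g0|g0] := pselect (level 0 g); last by rewrite indicE memNset// mul0e.
rewrite indicE mem_set// mul1e.
have out x : points g x -> ~ L x.
  move=> gx Lx; have := g0; rewrite /level /= cntE// => h.
  have h1 : (1%:E : \bar R) <= 0.
    rewrite -[0]h (_ : 1%:E = (\1_L x)%:E); last by rewrite indicE mem_set.
    by apply: (@esum_term_le R _ (points g) (fun x => (\1_L x)%:E)) => // i; rewrite lee_fin.
  by move: h1; rewrite lee_fin ler10.
have T0 psi : (forall u, 0 <= psi u) -> pair_sum N psi g = 0.
  move=> psi0; apply: esum1 => x gx; apply: esum1 => y gy.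
  by rewrite /pair_weight indicE memNset ?mul0r ?mul0e//; exact: out.
rewrite /exp_energy /pos_energy /neg_energy !T0//= ?subrr ?expR0.
- by rewrite ltry.
- exact: neg_part_ge0.
- exact: pos_part_ge0.
Qed.

(** In the Gibbs identity for [F], the sum over points produces the factor k + 1, while adding a
    point on the other side costs z times the volume of the cube. *)
Lemma level_energyS k :
  k.+1%:R%:E * level_energy k.+1 <= (z * (@nbox d N)%:R)%:E * level_energy k.
Proof.
have mL := @measurable_cube R d N.
pose F (p : conf * V) : \bar R :=
  (\1_L p.2)%:E * ((\1_(level k.+1) p.1)%:E * exp_energy p.1).
have F0 p : 0 <= F p by rewrite mule_ge0 ?lee_fin// level_term_ge0.
have mF : measurable_fun setT F.
  apply: emeasurable_funM.
    apply/measurable_EFinP; apply: measurableT_comp => //; exact: measurable_indic.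
  by apply: measurableT_comp (measurable_level_energy k.+1) measurable_fst.
pose G g x : \bar R := z%:E * ((\1_(level k) g)%:E * exp_energy g) * (\1_L x)%:E.
have c0 g : 0 <= z%:E * ((\1_(level k) g)%:E * exp_energy g).
  by rewrite mule_ge0 ?lee_fin ?(ltW z0)// level_term_ge0.
have -> : k.+1%:R%:E * level_energy k.+1 = \int[mu]_g (\esum_(x in points g) F (g, x)).
  rewrite -ge0_integralZl//; last 2 first.
  - exact: measurable_level_energy.
  - by move=> g _; exact: level_term_ge0.
  apply: eq_integral => g _; rewrite /F /=.
  have [gk|gk] := pselect (level k.+1 g); last first.
    rewrite indicE memNset// mul0e mule0 esum1// => x _.
    by rewrite mule0.
  set c := (_ * exp_energy g); have cg : 0 <= c by exact: level_term_ge0.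
  transitivity (\int[cnt g]_x ((\1_L x)%:E * c)); last first.
    rewrite integral_cnt// => [x|]; first by rewrite mule_ge0 ?lee_fin.
    by apply: emeasurable_funM => //; apply/measurable_EFinP; exact: measurable_indic.
  rewrite ge0_integralZr//; last first.
    by apply/measurable_EFinP; exact: measurable_indic.
  by rewrite integral_indic// setIT; congr (_ * _); exact/esym.
apply: (le_trans (gibbs_le hd hmu (ltW z0) F0 mF (G := G) _ _ _)).
- by move=> g x; rewrite mule_ge0// lee_fin.
- move=> g; apply: emeasurable_funM => //; apply/measurable_EFinP; exact: measurable_indic.
- move=> g x gx; rewrite /F /G /= -!muleA; apply: lee_wpmul2l; first by rewrite lee_fin ltW.
  have [Lx|Lx] := pselect (L x); last by rewrite (_ : \1_L x = 0%R) ?mule0 ?mul0e ?mule0 ?indicE ?memNset.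
  rewrite (_ : \1_L x = 1%R) ?mule1 ?mul1e ?indicE ?(mem_set Lx)//.
  have [gk|gk] := pselect (level k.+1 (add_point g x)); last first.
    by rewrite memNset// mul0e mule0 mule_ge0// ?lee_fin// exp_energy_ge0.
  rewrite mem_set// (mem_set (level_add Lx gx gk)) !mul1e.
  exact: exp_energy_add.
rewrite /G (_ : (fun g => _) = (fun g => (z * (@nbox d N)%:R)%:E *
    ((\1_(level k) g)%:E * exp_energy g))); last first.
  apply/funext => g; rewrite ge0_integralZl//; last first.
  - by apply/measurable_EFinP; exact: measurable_indic.
  by rewrite integral_indic// setIT lebesgue_cube// EFinM muleAC.
rewrite ge0_integralZl//.
- exact: measurable_level_energy.
- by move=> g _; exact: level_term_ge0.
- by rewrite lee_fin mulr_ge0// ltW.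
Qed.

(** The Poisson bound obtained by iterating the recursion; its factorial later absorbs the factors
    e^(B k). *)
Lemma level_energy_le k : level_energy k <= ((z * (@nbox d N)%:R) ^+ k / k`!%:R)%:E.
Proof.
elim: k => [|k ih]; first by rewrite expr0 fact0 divr1 level_energy0.
have : level_energy k.+1 * k.+1%:R%:E <= ((z * (@nbox d N)%:R) ^+ k.+1 / k`!%:R)%:E.
  rewrite muleC; apply: (le_trans (level_energyS k)).
  rewrite exprS -mulrA EFinM; apply: lee_wpmul2l ih.
  by rewrite lee_fin mulr_ge0// ltW.
rewrite -lee_pdivlMr// -EFinM => /le_trans; apply; rewrite lee_fin factS natrM invfM.
by rewrite -mulrA (mulrC (k.+1%:R^-1)%R).
Qed.

End gibbs_recursion.

(** * Lower bound of the energy from superstability and lower regularity *)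

Section energy_lower_bound.
Context {R : realType} {d : nat}.
Local Notation V := 'rV[R]_d.
Local Notation Zd := 'rV[int]_d.
Local Notation conf := (config R d).
Implicit Types (g : conf) (x y : V) (psi : V -> \bar R) (p : V * V).
Local Open Scope ereal_scope.

Lemma locally_finiteI g (A : set V) : locally_finite (points g `&` A).
Proof.
move=> K cK; apply: (sub_finite_set _ (@config_locally_finite _ _ g K cK)) => x [[gx _] Kx].
by split; [exact: gx|].
Qed.

Definition restrict g A : conf := Config (@locally_finiteI g A).

Definition inner_pairs N g : set (V * V) :=
  [set p | [/\ points g p.1, points g p.2, cube N p.1, cube N p.2 & p.1 != p.2]].

(** The set [A] is a cutoff of the outer points: a cube makes the set finite, as lower regularity
    requires, and [setT] gives the whole boundary interaction. *)
Definition cross_pairs N g (A : set V) : set (V * V) :=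
  [set p | [/\ points g p.1, points g p.2, cube N p.1, ~ cube N p.2 & A p.2]].

Lemma pair_sumE N psi g : (forall u, 0 <= psi u) ->
  pair_sum N psi g = (2^-1)%:E * (\esum_(p in inner_pairs N g) psi (p.1 - p.2)%R) +
    \esum_(p in cross_pairs N g setT) psi (p.1 - p.2)%R.
Proof.
move=> psi0; rewrite /pair_sum esum_esum; last by move=> x y _ _; exact: pair_weight_term.
rewrite esum_mkcond (esum_mkcond (inner_pairs N g)) (esum_mkcond (cross_pairs _ _ _)).
rewrite -esumZl//; last by move=> p; case: ifP.
rewrite -esumD; last 2 first.
- by move=> p _; case: ifP => _; rewrite ?mule0// mule_ge0// lee_fin.
- by move=> p _; case: ifP.
apply: eq_esum => -[x y] _ /=.
have [[gx gy]|gxy] := pselect (points g x /\ points g y); last first.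
  rewrite (memNset (A := inner_pairs N g)); last by move=> [? ? _ _ _]; apply: gxy.
  rewrite (memNset (A := cross_pairs N g _)); last by move=> [? ? _ _ _]; apply: gxy.
  by rewrite memNset ?mule0 ?adde0// => -[? ?]; apply: gxy.
rewrite mem_set//= /pair_weight !indicE.
have [Lx|Lx] := pselect (cube N x); last first.
  rewrite (memNset (A := inner_pairs N g)); last by move=> [].
  rewrite (memNset (A := cross_pairs N g _)); last by move=> [].
  by rewrite memNset// !mul0r mul0e mule0 adde0.
have xLx : (x \in cube N) by exact: mem_set.
have [Ly|Ly] := pselect (cube N y); last first.
  rewrite (memNset Ly) (memNset (A := inner_pairs N g)); last by move=> [].
  rewrite xLx mul0r subr0 !mul1r mule0 add0e (mem_set (A := cross_pairs N g setT))//.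
  case: eqVneq => [xy|_]; last by rewrite mul1e.
  by exfalso; apply: Ly; rewrite -xy.
have yLy : (y \in cube N) by exact: mem_set.
rewrite (memNset (A := cross_pairs N g setT)); last by move=> [].
rewrite xLx yLy adde0 !mul1r (_ : 1 - 2^-1 = 2^-1 :> R)%R; last by field.
have [xy|xy] := eqVneq x y; last first.
  by rewrite (mem_set (A := inner_pairs N g))// mulr1.
rewrite (memNset (A := inner_pairs N g)) ?mulr0 ?mul0e ?mule0// => -[_ _ _ _].
by rewrite /= xy eqxx.
Qed.

Variable phi : V -> \bar R.
Hypothesis hphi : pair_potential phi.

(** Negative part plus potential equals positive part, also where the potential is +oo. Keeping the
    two parts on opposite sides allows passing to infinite sums without subtracting infinities. *)
Lemma finite_pairs_le (P : set (V * V)) (l : R) : finite_set P ->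
  l%:E <= \sum_(p \in P) phi (p.1 - p.2)%R ->
  (\esum_(p in P) neg_part phi (p.1 - p.2)%R) + l%:E <= \esum_(p in P) pos_part phi (p.1 - p.2)%R.
Proof.
move=> fP h; rewrite !esum_fset//; last 2 first.
- by move=> p _; exact: pos_part_ge0.
- by move=> p _; exact: neg_part_ge0.
apply: (le_trans (leeD (lexx _) h)); rewrite -fsbig_split//.
rewrite le_eqVlt; apply/orP; left; apply/eqP; apply: eq_fsbigr => p _ /=.
have := potential_gtNy hphi (p.1 - p.2)%R; rewrite /neg_part /pos_part.
case: (phi _) => [r| |]//= _; last by rewrite maxNye add0e maxye.
rewrite -!EFin_max -EFinD; congr (_%:E).
by rewrite /Num.max; case: ifP; case: ifP; lra.
Qed.

Lemma cell_count g N r : (0 < N)%N -> cube_count (restrict g (cube N)) r =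
  if (lattice_norm r < N)%N then cube_count g r else 0%N.
Proof.
move=> N0; rewrite /cube_count /=; case: ltnP => rN.
  congr (#|` fset_set _|); apply/seteqP; split => x [].
    by move=> [].
  move=> gx /unit_cubeP rx; split; last exact/unit_cubeP.
  by split => //; apply/(cubeP _ N0); rewrite rx.
rewrite (_ : _ `&` _ = set0) ?fset_set0//.
apply/seteqP; split => [x [[_ /(cubeP _ N0)] h /unit_cubeP hr]|//].
by move: h; rewrite hr /box /= ltnNge rN.
Qed.

Lemma finite_cell g r : finite_set (points g `&` unit_cube r).
Proof.
apply: (sub_finite_set _ (@finite_cball _ _ g (lattice_norm r).+1%:R)) => x.
by move=> [gx /unit_cube_bounded]; split.
Qed.

Lemma count_restrict_le g (A : set V) r : (cube_count (restrict g A) r <= cube_count g r)%N.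
Proof.
have f : finite_set (points (restrict g A) `&` unit_cube r).
  by apply: (sub_finite_set _ (finite_cell g r)) => x [[]].
apply: fsubset_leq_card; apply/fsubsetP => x.
rewrite in_fset_set// in_fset_set; last exact: finite_cell.
by rewrite !inE => -[[gx _] rx]; split.
Qed.

Lemma count_restrict0 g (A : set V) r : (forall x, A x -> ~ unit_cube r x) ->
  cube_count (restrict g A) r = 0%N.
Proof.
move=> h; rewrite /cube_count (_ : _ `&` _ = set0) ?fset_set0//.
by apply/seteqP; split => [x [[_ Ax]]|//]; exact: h.
Qed.

Lemma finite_inner_pairs N g : finite_set (inner_pairs N g).
Proof.
have f : finite_set (points g `&` cube N).
  by apply: (sub_finite_set _ (@finite_cball _ _ g N%:R)) => x [gx /cube_bounded]; split.
apply: (sub_finite_set _ (finite_setX f f)).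
by move=> [x y] [gx gy Lx Ly _].
Qed.

Lemma finite_cross_pairs N g M : finite_set (cross_pairs N g (cube M)).
Proof.
have f K : finite_set (points g `&` cube K).
  by apply: (sub_finite_set _ (@finite_cball _ _ g K%:R)) => x [gx /cube_bounded]; split.
apply: (sub_finite_set _ (finite_setX (f N) (f M))).
by move=> [x y] [gx gy Lx Ly Ay].
Qed.

Lemma inner_energy_le (A B : R) N g : (0 < N)%N ->
  (forall (N : nat) g, (0 < N)%N -> points g `<=` cube N ->
      (\sum_(r \in [set: Zd])
          (A * (cube_count g r)%:R ^+ 2 - B * (cube_count g r)%:R))%R%:E <=
       (2^-1)%:E * (\sum_(p \in [set p : V * V |
            [/\ points g p.1, points g p.2 & p.1 != p.2]]) phi (p.1 - p.2)%R)) ->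
  (2^-1)%:E * (\esum_(p in inner_pairs N g) neg_part phi (p.1 - p.2)%R) +
    (\sum_(r \in (box N : set Zd)) (A * (cube_count g r)%:R ^+ 2 - B * (cube_count g r)%:R))%R%:E <=
  (2^-1)%:E * (\esum_(p in inner_pairs N g) pos_part phi (p.1 - p.2)%R).
Proof.
move=> N0 /(_ N (restrict g (cube N)) N0); set l := (\sum_(r \in box N) _)%R.
have -> : (\sum_(r \in [set: Zd]) (A * (cube_count (restrict g (cube N)) r)%:R ^+ 2 -
    B * (cube_count (restrict g (cube N)) r)%:R))%R = l.
  rewrite -(fsbig_widen (box N)) => [|//|r [_ /=]]; last first.
    by rewrite cell_count// /box /= => /negP/negbTE ->; rewrite expr0n !mulr0 subrr.
  by apply: eq_fsbigr => r; rewrite inE cell_count// /box /= => ->.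
rewrite (_ : [set p | _] = inner_pairs N g); last first.
  by apply/seteqP; split => -[x y] /= => [[[? ?] [? ?] ?]|[? ? ? ? ?]]; split.
move=> /(_ (@subIsetr _ _ _)); rewrite muleC -lee_pdivrMr ?invr_gt0// -EFinM => h.
have := finite_pairs_le (finite_inner_pairs N g) h.
move=> /(lee_wpmul2l (x := (2^-1)%:E)); rewrite lee_fin invr_ge0 ler0n => /(_ isT).
rewrite muleDr// ?fin_num_adde_defl// -EFinM mulrCA.
by rewrite (_ : (2^-1 * 2^-1^-1 = 1)%R) ?mulr1//; field.
Qed.

(** Lower regularity concerns finite unions of cubes, so it is applied to the points of a cube of
    size M outside the given one. The resulting bound does not depend on M, and every finite set of
    outer points lies in some such cube. *)
Lemma cross_energy_le (a : nat -> R) N g : (0 < N)%N -> (forall n, 0 < a n)%R ->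
  (forall (I' I'' : set Zd) (g' g'' : conf),
        finite_set I' -> finite_set I'' ->
        let L' := \bigcup_(r in I') unit_cube r in
        let L'' := \bigcup_(r in I'') unit_cube r in
        L' `&` L'' = set0 -> points g' `<=` L' -> points g'' `<=` L'' ->
        (- \sum_(p \in [set: Zd * Zd]) (a (lattice_norm (p.1 - p.2)) *
             (cube_count g' p.1)%:R * (cube_count g'' p.2)%:R))%R%:E <=
         \sum_(p \in points g' `*` points g'') phi (p.1 - p.2)%R) ->
  \esum_(p in cross_pairs N g setT) neg_part phi (p.1 - p.2)%R <=
  \esum_(p in cross_pairs N g setT) pos_part phi (p.1 - p.2)%R +
    boundary_sum a (fun r => (cube_count g r)%:R ^+ 2)%R N.
Proof.
move=> N0 a0 LR; pose c (r : Zd) : R := ((cube_count g r)%:R ^+ 2)%R; set X := boundary_sum a _ N.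
have c0 r : (0 <= c r)%R by rewrite /c exprn_ge0.
have B0 (r t : Zd) : (0 <= a (lattice_norm (r - t)) * ((c r + c t) / 2))%R.
  by apply: mulr_ge0; [exact: ltW|rewrite divr_ge0// addr_ge0].
have X0 : 0 <= X.
  by apply: esum_ge0 => r _; apply: esum_ge0 => s _; rewrite lee_fin; exact: B0.
have key M : (0 < M)%N -> \esum_(p in cross_pairs N g (cube M)) neg_part phi (p.1 - p.2)%R <=
    \esum_(p in cross_pairs N g (cube M)) pos_part phi (p.1 - p.2)%R + X.
  move=> M0; pose IM : set Zd := box M `\` box N.
  have := LR (box N) IM (restrict g (cube N)) (restrict g (cube M `\` cube N))
    (finite_box N) (finite_setD _ (finite_box M)).
  rewrite -cube_box//.
  have -> : \bigcup_(r in IM) (unit_cube r : set V) = cube M `\` cube N.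
    apply/seteqP; split => [x [r [rM rN] /unit_cubeP xr]|x [/(cubeP _ M0) xM xN]].
      by split; [apply/(cubeP _ M0); rewrite xr|move=> /(cubeP _ N0); rewrite xr].
    exists (cell x); last exact/unit_cubeP.
    by split => //= xN'; apply: xN; exact/(cubeP _ N0).
  move=> /= /(_ _ (@subIsetr _ _ _) (@subIsetr _ _ _)) h.
  have {}h : _ <= _ := h ltac:(by rewrite setDE setICA setICr setI0).
  have E : (points g `&` cube N) `*` (points g `&` (cube M `\` cube N)) =
      cross_pairs N g (cube M).
    by apply/seteqP; split => -[x y] /= => [[[? ?] [? [? ?]]]|[? ? ? ? ?]]; split.
  move: h; rewrite E.
  set s := (\sum_(p \in setT) _)%R => h.
  have sX : s%:E <= X.
    rewrite /s -(fsbig_widen (box N `*` IM)) => [|//|[r t] [_ /= h']]; last first.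
      have [rN|rN] := pselect (box N r); last first.
        by rewrite cell_count// (_ : (lattice_norm r < N)%N = false) ?mulr0 ?mul0r//; exact/negP.
      rewrite [in X in (_ * X)%R]count_restrict0 ?mulr0// => x [xM xN] xt; apply: h'; split => //.
      move/unit_cubeP: xt => xt; split => /=.
        by rewrite -xt; exact/(cubeP _ M0).
      by rewrite -xt => /(cubeP _ N0).
    have fD : finite_set (box N `*` IM : set (Zd * Zd)).
      by apply: finite_setX; [exact: finite_box|exact/finite_setD/finite_box].
    rewrite -fsumEFin// -esum_fset//; last by move=> p _; rewrite lee_fin !mulr_ge0// ltW.
    rewrite /X /boundary_sum esum_esum; last first.
      by move=> r t _ _; rewrite lee_fin; exact: B0.
    apply: (@le_trans _ _ (\esum_(p in box N `*` IM)
        (a (lattice_norm (p.1 - p.2)%R) * ((c p.1 + c p.2) / 2))%R%:E)).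
      apply: le_esum => -[r t] _ /=; rewrite lee_fin -mulrA; apply: ler_wpM2l; first exact: ltW.
      have h1 := count_restrict_le g (cube N) r.
      have h2 := count_restrict_le g (cube M `\` cube N) t.
      apply: (@le_trans _ _ ((cube_count g r)%:R * (cube_count g t)%:R)%R).
        by apply: ler_pM; rewrite ?ler_nat.
      rewrite /c; move: (_%:R)%R (_%:R)%R => u v.
      have := sqr_ge0 (u - v)%R; rewrite sqrrB; lra.
    apply: esum_subset; last by move=> [r t] [? []].
    by move=> p; rewrite lee_fin; exact: B0.
  have := finite_pairs_le (finite_cross_pairs N g M) h.
  rewrite EFinN leeBlDr// => h'; apply: (le_trans h'); exact: leeD.
apply: ge_ereal_sup => _ [S [fS SC] <-].
pose s : seq (V * V) := fset_set S.
pose M := (\max_(p <- s) lattice_norm (cell p.2)).+1.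
have SM : S `<=` cross_pairs N g (cube M).
  move=> p Sp; have [? ? ? ? _] := SC p Sp; split => //.
  apply/(cubeP _ (ltn0Sn _)); rewrite /box /= ltnS.
  by apply: (@leq_bigmax_seq _ s xpredT (fun p : V * V => lattice_norm (cell p.2))) => //; rewrite in_fset_set ?inE.
have neg0 p : 0 <= neg_part phi (p.1 - p.2)%R by exact: neg_part_ge0.
rewrite -esum_fset//.
apply: (le_trans (esum_subset _ SM)) => //; apply: (le_trans (key M _)) => //.
apply: leeD => //; apply: esum_subset; first by move=> p; exact: pos_part_ge0.
by move=> p [].
Qed.

Lemma level_count N g k : (0 < N)%N -> level N k g ->
  (\sum_(r \in (box N : set Zd)) ((cube_count g r)%:R : R) = k%:R)%R.
Proof.
move=> N0 gk; apply: EFin_inj; rewrite -fsumEFin; last exact: finite_box.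
rewrite -gk measure_cube//; apply: eq_fsbigr => r _.
by rewrite (cnt_finite _ (@measurable_unit_cube R d r) (@unit_cube_bounded R d r)).
Qed.

(** With s the box sum, superstability gives A s - B k and the boundary takes away at most A s / 2.
    Of the remaining A s / 2, one half pays for the threshold C <= s and yields the factor exp(-A C
    / 4); the other bounds s itself through A s / 4 <= exp(A s / 4). *)
Lemma exp_energy_lower (A B : R) (a : nat -> R) (C : R) N g k :
  (0 < N)%N -> (0 < A)%R -> (forall n, 0 < a n)%R ->
  (forall (N : nat) g, (0 < N)%N -> points g `<=` cube N ->
      (\sum_(r \in [set: Zd])
          (A * (cube_count g r)%:R ^+ 2 - B * (cube_count g r)%:R))%R%:E <=
       (2^-1)%:E * (\sum_(p \in [set p : V * V |
            [/\ points g p.1, points g p.2 & p.1 != p.2]]) phi (p.1 - p.2)%R)) ->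
  (forall (I' I'' : set Zd) (g' g'' : conf),
        finite_set I' -> finite_set I'' ->
        let L' := \bigcup_(r in I') unit_cube r in
        let L'' := \bigcup_(r in I'') unit_cube r in
        L' `&` L'' = set0 -> points g' `<=` L' -> points g'' `<=` L'' ->
        (- \sum_(p \in [set: Zd * Zd]) (a (lattice_norm (p.1 - p.2)) *
             (cube_count g' p.1)%:R * (cube_count g'' p.2)%:R))%R%:E <=
         \sum_(p \in points g' `*` points g'') phi (p.1 - p.2)%R) ->
  let c r := ((cube_count g r)%:R ^+ 2)%R in
  level N k g -> boundary_sum a c N <= (A / 2)%:E * box_sum c N -> C%:E <= box_sum c N ->
  box_sum c N <= (4 / A * expR (- (A / 4 * C)) * expR B ^+ k)%:E * exp_energy phi N g.
Proof.
move=> N0 A0 a0 SS LR c gk BX CS.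
have [s sE] : exists s : R, box_sum c N = s%:E.
  rewrite /box_sum esum_fset; [|exact: finite_box|by move=> r _; rewrite lee_fin exprn_ge0].
  by rewrite fsumEFin; [eexists|exact: finite_box].
rewrite sE in BX CS *; rewrite lee_fin in CS.
have X0 : 0 <= boundary_sum a c N.
  apply: esum_ge0 => r _; apply: esum_ge0 => t _; rewrite lee_fin.
  by apply: mulr_ge0; [exact: ltW|rewrite divr_ge0// addr_ge0// exprn_ge0].
rewrite /exp_energy; case: ifPn => [/andP[]|_]; last first.
  by rewrite gt0_muley ?leey// lte_fin !mulr_gt0 ?exprn_gt0 ?expR_gt0 ?invr_gt0.
have h : neg_energy phi N g + (A * s - B * k%:R)%:E <=
    pos_energy phi N g + boundary_sum a c N.
  rewrite /neg_energy /pos_energy !pair_sumE; last 2 first.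
  - exact: pos_part_ge0.
  - exact: neg_part_ge0.
  rewrite addeAC -addeA.
  have := leeD (@inner_energy_le A B N g N0 SS) (@cross_energy_le a N g N0 a0 LR).
have -> : (\sum_(r \in (box N : set Zd)) (A * (cube_count g r)%:R ^+ 2 - B * (cube_count g r)%:R) =
      A * s - B * k%:R)%R.
    rewrite -(level_count N0 gk); apply: EFin_inj; rewrite EFinB !EFinM -sE.
    rewrite /box_sum esum_fset; [|exact: finite_box|by move=> r _; rewrite lee_fin exprn_ge0].
    have fb := @finite_box d N.
    rewrite fsumEFin// -!EFinM -EFinB; congr (_%:E).
    rewrite !fsbig_finite//= !mulr_sumr -sumrB; apply: eq_bigr => r _; rewrite /c; ring.
  by move=> h; rewrite -[in leRHS]addeA addeA; exact: h.
have := pos_energy_ge0 phi N g; have := neg_energy_ge0 phi N g.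
move: h BX X0; move: (pos_energy phi N g) (neg_energy phi N g) (boundary_sum a c N).
move=> [p| |]// [n| |]// [x| |]//; rewrite -?EFinM -?EFinD ?lee_fin// => h BX x0 n0 p0 _ _.
rewrite /= -expRM_natr -!mulrA -!expRD mulrA.
set e := (_ + _)%R; have he : (A / 4 * s <= e)%R by rewrite /e; nra.
have := expR_ge1Dx e => h1.
have h2 : (A / 4 * s <= expR e)%R by lra.
by rewrite -ler_pdivrMl ?divr_gt0// invf_div.
Qed.

End energy_lower_bound.

(** * Finite expected number of points in a cube *)

Section finite_intensity.
Context {R : realType} {d : nat}.
Local Notation V := 'rV[R]_d.
Local Notation Zd := 'rV[int]_d.
Local Notation conf := (config R d).
Implicit Types (g : conf) (x : V).
Local Open Scope ereal_scope.
Variables (phi : V -> \bar R) (z : R) (mu : probability conf R).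
Hypotheses (hd : (0 < d)%N) (hphi : pair_potential phi) (z0 : (0 < z)%R).

Lemma nneseries_exp (x : R) : (0 <= x)%R ->
  \sum_(k <oo) (x ^+ k / k`!%:R)%:E = (expR x)%:E.
Proof.
move=> x0; rewrite /expR -EFin_lim; last exact: is_cvg_series_exp_coeff.
by apply/congr_lim/funext => n /=; rewrite sumEFin.
Qed.

(* The sum over k is exp(B n) times exp_energy, where n is the number of points
   in the cube. *)
Definition weighted_energy (B : R) N g : \bar R :=
  \sum_(k <oo) (expR B ^+ k)%:E * ((\1_(level N k) g)%:E * exp_energy phi N g).

Lemma weighted_term_ge0 B N k g :
  0 <= (expR B ^+ k)%:E * ((\1_(level N k) g)%:E * exp_energy phi N g).
Proof. by rewrite mule_ge0 ?level_term_ge0// lee_fin exprn_ge0// expR_ge0. Qed.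

Lemma measurable_weighted_term B N k : measurable_fun setT
  (fun g => (expR B ^+ k)%:E * ((\1_(level N k) g)%:E * exp_energy phi N g)).
Proof. by apply: emeasurable_funM => //; exact: measurable_level_energy. Qed.

Lemma weighted_energy_ge0 B N g : 0 <= weighted_energy B N g.
Proof. by apply: nneseries_ge0 => k _ _; exact: weighted_term_ge0. Qed.

Lemma measurable_weighted_energy B N : measurable_fun setT (weighted_energy B N).
Proof.
apply: (ge0_emeasurable_sum (P := xpredT)) => k *; first exact: weighted_term_ge0.
exact: measurable_weighted_term.
Qed.

Lemma weighted_energy_level B N k g : level N k g ->
  (expR B ^+ k)%:E * exp_energy phi N g <= weighted_energy B N g.
Proof.
move=> gk; rewrite /weighted_energy nneseries_esumT => [|j]; last exact: weighted_term_ge0.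
apply: le_trans (esum_term_le (i := k) _ _) => //.
  by rewrite indicE mem_set// mul1e.
by move=> j; exact: weighted_term_ge0.
Qed.

(** The Poisson bounds for the levels sum to an exponential, the weights e^(B k) replacing the
    activity z by z e^B. *)
Lemma integral_weighted_energy B N : (0 < N)%N -> gibbs z phi mu ->
  \int[mu]_g weighted_energy B N g <= (expR (z * expR B * (@nbox d N)%:R))%:E.
Proof.
move=> N0 hmu; rewrite integral_nneseries//; last 2 first.
- by move=> k; exact: measurable_weighted_term.
- by move=> k g _; exact: weighted_term_ge0.
rewrite -nneseries_exp; last by rewrite !mulr_ge0 ?expR_ge0// ltW.
apply: lee_nneseries => [k _ _|k _]; first by apply: integral_ge0 => g _; exact: weighted_term_ge0.
rewrite ge0_integralZl//; last 2 first.
- exact: measurable_level_energy.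
- by move=> g _; exact: level_term_ge0.
have := level_energy_le hphi N0 hd z0 hmu k; rewrite /level_energy => h.
apply: (le_trans (lee_wpmul2l _ h)); first by rewrite lee_fin exprn_ge0// expR_ge0.
by rewrite -EFinM lee_fin mulrA -exprMn mulrA (mulrC (expR B)).
Qed.

Lemma tempered_box_sum n g : tempered_level n g ->
  exists k : R, forall N, (0 < N)%N ->
    box_sum (fun r => (cube_count g r)%:R ^+ 2)%R N <= (k * (@nbox d N)%:R)%:E.
Proof.
move=> gn; exists (n%:R ^+ 2)%R => N N0; have := gn N N0.
rewrite cube_lattice_box// -/(nbox N) => h; rewrite /box_sum esum_fset; last 2 first.
- exact: finite_box.
- by move=> r _; rewrite lee_fin exprn_ge0.
by rewrite fsumEFin ?lee_fin//; exact: finite_box.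
Qed.

Lemma cnt_cube_le N g : (0 < N)%N ->
  cnt g (cube N) <= box_sum (fun r => (cube_count g r)%:R ^+ 2)%R N.
Proof.
move=> N0; rewrite /box_sum esum_fset; last 2 first.
- exact: finite_box.
- by move=> r _; rewrite lee_fin exprn_ge0.
rewrite measure_cube//; apply: lee_fsum => [|r _]; first exact: finite_box.
rewrite (cnt_finite _ (@measurable_unit_cube R d r) (@unit_cube_bounded R d r)) lee_fin.
by rewrite -natrX ler_nat -/(cube_count g r); case: (cube_count g r) => // k; rewrite expnS leq_pmulr// expn_gt0.
Qed.

Lemma superstable_finite_intensity N : (0 < N)%N -> superstable phi -> lower_regular phi ->
  tempered_gibbs z phi mu -> \int[mu]_g cnt g (cube N) < +oo.
Proof.
move=> N0 [A [B [A0 B0 SS]]] [a [a_decr a0 a_sum LR]] [hmu temp].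
have A2 : (0 < A / 2)%R by rewrite divr_gt0.
(* A / 4 times C is z e^B + 1: the first term cancels the growth of the exponential moment, the
   second leaves exp(-n) on a box of n cells. *)
pose C := (4 / A * (z * expR B + 1))%R.
have C0 : (0 <= C)%R by rewrite !mulr_ge0 ?invr_ge0 ?addr_ge0 ?mulr_ge0 ?expR_ge0 ?(ltW A0) ?(ltW z0).
have [M M0 good] := good_box hd a_decr a0 a_sum N A2 C0.
pose K n : R := (4 / A * expR (- (A / 4 * (C * (@nbox d n)%:R))))%R.
have K0 n : (0 <= K n)%R by rewrite mulr_ge0 ?expR_ge0// divr_ge0// ltW.
pose f n g : \bar R := (K n.+1)%:E * weighted_energy B n.+1 g.
have f0 n g : 0 <= f n g by rewrite mule_ge0 ?lee_fin ?K0// weighted_energy_ge0.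
have mf n : measurable_fun setT (f n).
  by apply: emeasurable_funM => //; exact: measurable_weighted_energy.
have s0 g : 0 <= \sum_(n <oo) f n g by apply: nneseries_ge0 => n _ _; exact: f0.
have ms : measurable_fun setT (fun g => \sum_(n <oo) f n g).
  by apply: (ge0_emeasurable_sum (P := xpredT)) => n *; [exact: f0|exact: mf].
(* The good box depends on the configuration, so the bounds for all sizes are added; configurations
   with few points near the origin are covered by [M]. *)
apply: (@le_lt_trans _ _ (\int[mu]_g (M%:E + \sum_(n <oo) f n g))).
  apply: ae_ge0_le_integral => //.
  - by apply: measurable_cnt; exact: measurable_cube.
  - by move=> g _; rewrite adde_ge0 ?lee_fin.
  - exact: emeasurable_funD.
  apply: filterS temp => g [n _ gn] _.
  pose c r : R := ((cube_count g r)%:R ^+ 2)%R.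
  apply: (le_trans (cnt_cube_le g N0)).
  have [le|lt] := leP (box_sum c N) M%:E; first by rewrite (le_trans le)// leeDl.
  have [n' [Nn n0 X S]] := good c (fun r => exprn_ge0 _ (ler0n _ _)) (tempered_box_sum gn) lt.
  have [k gk] := cnt_level n' g.
  apply: (@le_trans _ _ (box_sum c n')).
    apply: esum_subset; first by move=> r; rewrite lee_fin exprn_ge0.
    by move=> r; rewrite /box /= => /leq_trans; apply.
  apply: (le_trans (exp_energy_lower hphi n0 A0 a0 SS LR gk X S)).
  rewrite -/(K n') EFinM -muleA.
  apply: (@le_trans _ _ (f n'.-1 g)).
    rewrite /f prednK//; apply: lee_wpmul2l; first by rewrite lee_fin K0.
    exact: weighted_energy_level.
  rewrite nneseries_esumT//; apply: le_trans (leeDr _ _); last by rewrite lee_fin.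
  exact: esum_term_le.
rewrite ge0_integralD//.
rewrite integral_cst// integral_nneseries//.
(* The n-th integral is at most (4 / A) 2^-n, because the box of size n + 1 has at least n cells and
   e >= 2; these bounds sum to (4 / A) 2. *)
apply: (@le_lt_trans _ _ (M%:E * 1 + (4 / A * 2)%:E)).
  apply: leeD; first by apply: lee_wpmul2l; rewrite ?lee_fin//; exact: probability_le1.
  apply: le_trans (epsilon_trick0 xpredT _); last by rewrite mulr_ge0// divr_ge0// ltW.
  apply: lee_nneseries => [n _ _|n _]; first by apply: integral_ge0 => g _; exact: f0.
  rewrite ge0_integralZl//; last 3 first.
  - exact: measurable_weighted_energy.
  - by move=> g _; exact: weighted_energy_ge0.
  - by rewrite lee_fin K0.
  apply: (le_trans (lee_wpmul2l _ (integral_weighted_energy _ _ hmu))) => //.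
    by rewrite lee_fin K0.
  rewrite -EFinM lee_fin /K -[leLHS]mulrA -expRD -[leRHS]mulrA; apply: ler_wpM2l; first by rewrite divr_ge0// ltW.
  set e := (_ + _)%R; have -> : e = (- (@nbox d n.+1)%:R)%R.
    by rewrite /e /C; field; rewrite gt_eqF.
  rewrite natrX exprS invfM mulrA divff// mul1r expRN.
  rewrite lef_pV2 ?posrE ?expR_gt0 ?exprn_gt0//.
  apply: (@le_trans _ _ (expR 1 ^+ n)%R).
    apply: lerXn2r; rewrite ?nnegrE ?expR_ge0//.
    by have := expR_ge1Dx (1 : R)%R; lra.
  by rewrite -expRM_natr mul1r ler_expR ler_nat; exact: nbox_ge.
by rewrite mule1 -EFinD ltry.
Qed.

(** For a nonnegative potential the Boltzmann factor is at most 1, so the Gibbs identity bounds the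
    intensity by that of a Poisson process of activity z. *)
Lemma repulsive_finite_intensity N : (0 < N)%N -> repulsive phi -> gibbs z phi mu ->
  \int[mu]_g cnt g (cube N) < +oo.
Proof.
move=> N0 rep hmu; have mL := @measurable_cube R d N.
pose F (p : conf * V) : \bar R := (\1_(cube N) p.2)%:E.
have F0 p : 0 <= F p by rewrite lee_fin.
have mF : measurable_fun setT F.
  by apply/measurable_EFinP; apply: measurableT_comp => //; exact: measurable_indic.
rewrite (_ : (fun g => _) = (fun g => \esum_(x in points g) F (g, x))); last first.
  by apply/funext => g; rewrite cntE.
apply: (le_lt_trans (gibbs_le hd hmu (ltW z0) F0 mF
  (G := fun _ x => z%:E * (\1_(cube N) x)%:E) _ _ _)).
- by move=> g x; rewrite mule_ge0 ?lee_fin ?(ltW z0).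
- by move=> g; apply: emeasurable_funM => //; apply/measurable_EFinP; exact: measurable_indic.
- move=> g x gx; rewrite /F /= -muleA; apply: lee_wpmul2l; first by rewrite lee_fin ltW.
  rewrite -[leRHS]mul1e; apply: lee_wpmul2r; first by rewrite lee_fin.
  rewrite -expeR0 lee_expeR oppe_le0 /energy; case: ifP => // _.
  rewrite (esum1 (a := fun y => maxe (- phi (x - y)%R) 0)) ?sube0.
    by apply: esum_ge0 => y _; rewrite le_max lexx orbT.
  by move=> y _; apply/max_idPr; rewrite oppe_le0.
have -> : \int[lebesgue_rV R d]_x (z%:E * (\1_(cube N) x)%:E) = (z * (@nbox d N)%:R)%:E.
  rewrite ge0_integralZl//; last 2 first.
  - by apply/measurable_EFinP; exact: measurable_indic.
  - by rewrite lee_fin ltW.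
  by rewrite integral_indic// setIT lebesgue_cube// -EFinM.
rewrite integral_cst//.
apply: (@le_lt_trans _ _ ((z * (@nbox d N)%:R)%:E * 1)); last by rewrite mule1 ltry.
by apply: lee_wpmul2l; rewrite ?lee_fin ?mulr_ge0 ?(ltW z0)//; exact: probability_le1.
Qed.

End finite_intensity.

(** * Algebras of smooth bounded functions *)

Section function_algebras.
Context {R : realType} {N : nat}.
Local Notation V := 'rV[R]_N.
Implicit Types (f g h : V -> R).

Lemma derive_comp f (u : R -> R) x v (du : R) : differentiable f x ->
  is_derive (f x) (1 : R) u du ->
  differentiable (u \o f) x /\ 'D_v (u \o f) x = du * 'D_v f x.
Proof.
move=> df [u1 uE]; have du' : differentiable u (f x) by exact/derivable1_diffP.
have dc := differentiable_comp df du'; split => //.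
rewrite !deriveE// diff_comp//= (diff1E du') derive1E uE.
by rewrite [LHS]mulrC.
Qed.

(** If the partial derivatives of the generators lie in the algebra, it is closed under
    differentiation. Smoothness and boundedness of all derivatives then follow from properties of
    the generators, without formulas for higher derivatives. *)
Inductive generated (B : set (V -> R)) : (V -> R) -> Prop :=
| gen_base b of B b : generated B b
| gen_cst c : generated B (fun=> c)
| gen_add f g of generated B f & generated B g : generated B (fun x => f x + g x)
| gen_mul f g of generated B f & generated B g : generated B (fun x => f x * g x).

Lemma gen_scale (B : set (V -> R)) c f : generated B f -> generated B (fun x => c * f x).
Proof. by move=> Bf; apply: gen_mul Bf; exact: gen_cst. Qed.

Variable B : set (V -> R).
Hypothesis B_diff : forall b, B b -> forall x, differentiable b x.
Hypothesis B_bnd : forall b, B b -> exists M, forall x, `|b x| <= M.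
Hypothesis B_derive : forall b i, B b ->
  exists2 g, generated B g & forall x, 'D_(delta_mx 0 i) b x = g x.

Lemma generated_diff f : generated B f -> forall x, differentiable f x.
Proof.
elim=> {f} [b Bb x|c x|f g _ df _ dg x|f g _ df _ dg x].
- exact: B_diff.
- exact: differentiable_cst.
- exact: (differentiableD (df x) (dg x)).
- exact: (differentiableM (df x) (dg x)).
Qed.

Lemma generated_bounded f : generated B f -> exists M, forall x, `|f x| <= M.
Proof.
elim=> {f} [b Bb|c|f g _ [M1 h1] _ [M2 h2]|f g _ [M1 h1] _ [M2 h2]].
- exact: B_bnd.
- by exists `|c|.
- by exists (M1 + M2) => x; apply: (le_trans (ler_normD _ _)); exact: lerD.
- by exists (M1 * M2) => x; rewrite normrM; exact: ler_pM.
Qed.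

Lemma generated_derive f i : generated B f ->
  exists2 g, generated B g & forall x, 'D_(delta_mx 0 i) f x = g x.
Proof.
move=> Bf; elim: Bf => {f} [b Bb|c|f g Bf [f' Bf' hf] Bg [g' Bg' hg]|f g Bf [f' Bf' hf] Bg [g' Bg' hg]].
- exact: B_derive.
- by exists (fun=> 0) => [|x]; [exact: gen_cst|exact: derive_cst].
- exists (fun x => f' x + g' x) => [|x]; first exact: gen_add.
  by rewrite (deriveD (f := f) (g := g)) ?hf ?hg//; apply: diff_derivable; exact: generated_diff.
- exists (fun x => f x * g' x + g x * f' x) => [|x].
    by apply: gen_add; exact: gen_mul.
  by rewrite (deriveM (f := f) (g := g)) ?hf ?hg//; apply: diff_derivable; exact: generated_diff.
Qed.

Lemma generated_smooth f : generated B f -> smooth_bounded f.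
Proof.
move=> Bf s; have Bs : generated B (iter_partial s f).
  elim: s => [//|i s ih] /=.
  have [g Bg hg] := generated_derive i ih.
  by rewrite (_ : (fun x => _) = g)//; exact/funext.
by split; [exact: generated_diff|exact: generated_bounded].
Qed.

End function_algebras.

Section smooth_operations.
Context {R : realType}.

Lemma smooth_cst N (c : R) : smooth_bounded (fun _ : 'rV[R]_N => c).
Proof. by apply: (generated_smooth (B := set0)) => //; exact: gen_cst. Qed.

Section linear_substitution.
Variables (m n : nat) (L : {linear 'rV[R]_m -> 'rV[R]_n}).
Hypothesis L_le : forall x, `|L x| <= `|x|.

Lemma contraction_continuous : continuous L.
Proof.
move=> x A /nbhs_ballP[e /= e0 eA]; apply/nbhs_ballP; exists e => //= y xy.
apply: eA; move: xy; rewrite -!ball_normE /= -linearB; exact: le_lt_trans.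
Qed.

Lemma differentiable_linear f x : differentiable f (L x) -> differentiable (f \o L : _ -> R) x.
Proof.
by apply: differentiable_comp; apply: linear_differentiable; exact: contraction_continuous.
Qed.

Lemma derive_linear (f : 'rV[R]_n -> R) x v : differentiable f (L x) ->
  'D_v (f \o L) x = 'D_(L v) f (L x).
Proof.
move=> df; have dL : differentiable L x by apply: linear_differentiable; exact: contraction_continuous.
rewrite !deriveE//; last exact: differentiable_comp.
by rewrite diff_comp//= diff_lin//; exact: contraction_continuous.
Qed.

End linear_substitution.

Lemma lsubmx_le m n (x : 'rV[R]_(m + n)) : `|lsubmx x| <= `|x|.
Proof.
apply: norm_le_coord => // i; rewrite mxE (_ : `|x| = mx_norm x)// mx_normrE.
exact: (le_bigmax_cond _ (fun i => `|x i.1 i.2|) (j := (0, lshift n i))).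
Qed.

Lemma rsubmx_le m n (x : 'rV[R]_(m + n)) : `|rsubmx x| <= `|x|.
Proof.
apply: norm_le_coord => // i; rewrite mxE (_ : `|x| = mx_norm x)// mx_normrE.
exact: (le_bigmax_cond _ (fun i => `|x i.1 i.2|) (j := (0, rshift m i))).
Qed.

Section two_blocks.
Variables (m n : nat) (h1 : 'rV[R]_m -> R) (h2 : 'rV[R]_n -> R).
Hypotheses (s1 : smooth_bounded h1) (s2 : smooth_bounded h2).

(** All iterated partial derivatives are taken as generators, so that differentiating one gives
    another or zero. *)
Definition block_base : set ('rV[R]_(m + n) -> R) :=
  [set b | (exists s, b = iter_partial s h1 \o lsubmx) \/
           (exists s, b = iter_partial s h2 \o rsubmx)].

Lemma block_smooth f : generated block_base f -> smooth_bounded f.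
Proof.
apply: generated_smooth.
- move=> _ [[s ->]|[s ->]] x.
    apply: (differentiable_linear (L := lsubmx)); [exact: lsubmx_le|exact: (s1 s).1].
  apply: (differentiable_linear (L := rsubmx)); [exact: rsubmx_le|exact: (s2 s).1].
- move=> _ [[s ->]|[s ->]].
    by have [M hM] := (s1 s).2; exists M => x; exact: hM.
  by have [M hM] := (s2 s).2; exists M => x; exact: hM.
- move=> _ i [[s ->]|[s ->]].
    case: (split_ordP i) => j ->.
      exists (iter_partial (j :: s) h1 \o lsubmx) => [|x]; first by apply: gen_base; left; exists (j :: s).
      rewrite (derive_linear (L := lsubmx)) /=; [|exact: lsubmx_le|exact: (s1 s).1].
      by congr ('D__ _ _); apply/rowP => k; rewrite !mxE eq_lshift.
    exists (fun=> 0) => [|x]; first exact: gen_cst.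
    rewrite (derive_linear (L := lsubmx)) /=; [|exact: lsubmx_le|exact: (s1 s).1].
    rewrite deriveE; last exact: (s1 s).1.
    rewrite (_ : lsubmx (delta_mx _ _) = 0) ?linear0//.
    by apply/rowP => k; rewrite !mxE eq_lrshift andbF.
  case: (split_ordP i) => j ->.
    exists (fun=> 0) => [|x]; first exact: gen_cst.
    rewrite (derive_linear (L := rsubmx)) /=; [|exact: rsubmx_le|exact: (s2 s).1].
    rewrite deriveE; last exact: (s2 s).1.
    rewrite (_ : rsubmx (delta_mx _ _) = 0) ?linear0//.
    by apply/rowP => k; rewrite !mxE eq_rlshift andbF.
  exists (iter_partial (j :: s) h2 \o rsubmx) => [|x]; first by apply: gen_base; right; exists (j :: s).
  rewrite (derive_linear (L := rsubmx)) /=; [|exact: rsubmx_le|exact: (s2 s).1].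
  by congr ('D__ _ _); apply/rowP => k; rewrite !mxE eq_rshift.
Qed.

Lemma block_left : generated block_base (fun x => h1 (lsubmx x)).
Proof. by apply: gen_base; left; exists [::]. Qed.

Lemma block_right : generated block_base (fun x => h2 (rsubmx x)).
Proof. by apply: gen_base; right; exists [::]. Qed.

Lemma smooth_lin (a : R) : smooth_bounded (fun x => a * h1 (lsubmx x) + h2 (rsubmx x)).
Proof.
by apply: block_smooth; apply: gen_add block_right; apply: gen_scale; exact: block_left.
Qed.

Lemma smooth_mul : smooth_bounded (fun x => h1 (lsubmx x) * h2 (rsubmx x)).
Proof. by apply: block_smooth; exact: gen_mul block_left block_right. Qed.

End two_blocks.

Section smooth_absolute_value.
Variables (N : nat) (h : 'rV[R]_N -> R) (e : R).
Hypotheses (sh : smooth_bounded h) (e0 : 0 < e).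

(** This is (t^2 + e^2)^(-1/2). It is bounded and its derivative is a polynomial in t and itself,
    which suits a generator; the square root is recovered as (t^2 + e^2) times it. *)
Definition inv_sqrt (t : R) : R := expR (- 2^-1 * ln (t ^+ 2 + e ^+ 2)).

Let pos t : 0 < t ^+ 2 + e ^+ 2.
Proof. by rewrite ltr_wpDl ?sqr_ge0// exprn_gt0. Qed.

Lemma inv_sqrtE t : Num.sqrt (t ^+ 2 + e ^+ 2) = (t * t + e ^+ 2) * inv_sqrt t.
Proof.
rewrite -expr2 -powR12_sqrt; last exact: ltW.
rewrite /powR gt_eqF// -[X in _ = X * _]lnK ?posrE// /inv_sqrt -expRD; congr expR.
by field.
Qed.

Lemma is_derive_inv_sqrt t : is_derive t (1 : R) inv_sqrt (- t * inv_sqrt t ^+ 3).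
Proof.
have hl := is_derive1_ln (pos t).
have hu : is_derive t (1 : R) (fun t : R => t ^+ 2 + e ^+ 2) (2 * t).
  have h' := is_deriveD (is_deriveM (is_derive_id t (1 : R)) (is_derive_id t (1 : R)))
    (is_derive_cst (e ^+ 2) t (1 : R)).
  rewrite (_ : (fun t : R => _) = (id * id + cst (e ^+ 2) : R -> R)); last exact/funext.
  apply: (is_derive_eq h').
  by rewrite addr0 /= [_ *: _]mulr1; ring.
have hc := is_derive1_comp (g := fun t : R => t ^+ 2 + e ^+ 2) hl hu.
have hm : is_derive t (1 : R) (fun t => - 2^-1 * ln (t ^+ 2 + e ^+ 2))
    (- 2^-1 * ((t ^+ 2 + e ^+ 2)^-1 * (2 * t))).
  exact: (is_deriveZ (- 2^-1) hc).
have he := is_derive1_comp (g := fun t => - 2^-1 * ln (t ^+ 2 + e ^+ 2)) (is_derive_expR _) hm.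
apply: (is_derive_eq (f := inv_sqrt) he).
have E : inv_sqrt t ^+ 2 = (t ^+ 2 + e ^+ 2)^-1.
  rewrite /inv_sqrt -expRM_natr -[in RHS](lnK (pos t)) -expRN; congr expR; by field.
rewrite -/(inv_sqrt t) [inv_sqrt t ^+ 3]exprS E; field; exact: lt0r_neq0 (pos t).
Qed.

Lemma inv_sqrt_bounded t : `|inv_sqrt t| <= expR (- 2^-1 * ln (e ^+ 2)).
Proof.
rewrite ger0_norm ?expR_ge0// ler_expR ler_nM2l ?oppr_lt0 ?invr_gt0//.
by rewrite ler_ln ?posrE ?pos ?exprn_gt0// lerDr sqr_ge0.
Qed.

Lemma smooth_sqrt : smooth_bounded (fun x => Num.sqrt (h x ^+ 2 + e ^+ 2)).
Proof.
pose B := [set b : 'rV[R]_N -> R | (exists s, b = iter_partial s h) \/ b = inv_sqrt \o h].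
have Bs s : generated B (iter_partial s h) by apply: gen_base; left; exists s.
have Bw : generated B (inv_sqrt \o h) by apply: gen_base; right.
have dh := (sh [::]).1.
suff : generated B (fun x => (h x * h x + e ^+ 2) * (inv_sqrt \o h) x).
  move=> Bf; rewrite (_ : (fun x => _) = (fun x => (h x * h x + e ^+ 2) * (inv_sqrt \o h) x)).
    apply: generated_smooth Bf.
    - move=> _ [[s ->]|->] x; first exact: (sh s).1.
      exact: (derive_comp 0 (dh x) (is_derive_inv_sqrt (h x))).1.
    - move=> _ [[s ->]|->]; first exact: (sh s).2.
      by exists (expR (- 2^-1 * ln (e ^+ 2))) => x; exact: inv_sqrt_bounded.
    - move=> _ i [[s ->]|->]; first by exists (iter_partial (i :: s) h).
      exists (fun x => (- 1 * h x * (inv_sqrt (h x) * (inv_sqrt (h x) * inv_sqrt (h x)))) *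
          iter_partial [:: i] h x) => [|x].
        apply: gen_mul (Bs [:: i]); apply: gen_mul; first exact: gen_scale (Bs [::]).
        by apply: (gen_mul Bw); exact: (gen_mul Bw Bw).
      rewrite (derive_comp (delta_mx 0 i) (dh x) (is_derive_inv_sqrt (h x))).2 /=.
      by rewrite mulN1r !exprS expr0 mulr1.
  by apply/funext => x; rewrite inv_sqrtE.
by apply: gen_mul Bw; apply: gen_add; [exact: gen_mul (Bs [::]) (Bs [::])|exact: gen_cst].
Qed.

End smooth_absolute_value.
Section smooth_logistic.
Variables (c b : R).

(** A smooth step whose derivative is a polynomial in itself, so that it generates an algebra closed
    under differentiation. *)
Definition logistic (t : R) : R := (1 + expR (- (c * t + b)))^-1.

Lemma logistic_ge0 t : 0 <= logistic t.
Proof. by rewrite invr_ge0 addr_ge0// expR_ge0. Qed.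

Lemma logistic_le1 t : logistic t <= 1.
Proof. by rewrite invf_le1 ?lerDl ?expR_ge0// addr_gt0// expR_gt0. Qed.

Lemma is_derive_logistic t :
  is_derive t (1 : R) logistic (c * (logistic t * (1 - logistic t))).
Proof.
have n0 : 1 + expR (- (c * t + b)) != 0 by rewrite lt0r_neq0// addr_gt0// expR_gt0.
have hl : is_derive t (1 : R) (fun t : R => - (c * t + b)) (- c).
  have h := is_deriveN (is_deriveD (is_deriveZ c (is_derive_id t (1 : R))) (is_derive_cst b t (1 : R))).
  apply: (is_derive_eq (f := fun t : R => - (c * t + b)) h).
  by rewrite addr0 [_ *: _]mulr1.
have he := is_derive1_comp (g := fun t : R => - (c * t + b)) (is_derive_expR _) hl.
have h1 : is_derive t (1 : R) (fun t : R => 1 + expR (- (c * t + b))) (expR (- (c * t + b)) * - c).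
  have h := is_deriveD (is_derive_cst (1 : R) t (1 : R)) he.
  by apply: (is_derive_eq (f := fun t : R => 1 + expR (- (c * t + b))) h); rewrite add0r.
have hv := is_deriveV (f := fun t : R => 1 + expR (- (c * t + b))) n0 h1.
apply: (is_derive_eq (f := logistic) hv).
by rewrite /logistic [_ *: _]mulrC; field.
Qed.

Lemma derive_coord (x v : 'rV[R]_1) : 'D_v (fun x : 'rV[R]_1 => x 0 0 : R) x = v 0 0.
Proof.
rewrite /derive; apply: cvg_lim => //; apply: cvg_near_cst; near=> k.
rewrite /= !mxE addrK [LHS]mulrA mulVf ?mul1r//.
by near: k; exact: nbhs_dnbhs_neq.
Unshelve. all: by end_near. Qed.

Lemma smooth_logistic : smooth_bounded (fun x : 'rV[R]_1 => logistic (x 0 0)).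
Proof.
pose B := [set f : 'rV[R]_1 -> R | f = logistic \o (fun x : 'rV[R]_1 => x 0 0 : R)].
have Bl : generated B (fun x => logistic (x 0 0)) by exact: gen_base.
have dc (x : 'rV[R]_1) : differentiable (fun x : 'rV[R]_1 => x 0 0 : R) x := differentiable_coord _ _ _.
apply: (generated_smooth (B := B)) (Bl).
- by move=> _ -> x; exact: (derive_comp 0 (dc x) (is_derive_logistic (x 0 0))).1.
- by move=> _ ->; exists 1 => x; rewrite ger0_norm ?logistic_ge0 ?logistic_le1.
move=> _ i ->; exists (fun x => c * (logistic (x 0 0) * (1 + -1 * logistic (x 0 0)))) => [|x].
  apply: gen_scale; apply: (gen_mul Bl); apply: gen_add; first exact: gen_cst.
  exact: gen_scale.
rewrite (derive_comp (delta_mx 0 i) (dc x) (is_derive_logistic (x 0 0))).2 mulN1r.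
rewrite derive_coord (ord1 i) mxE !eqxx mulr1.
by [].
Qed.

End smooth_logistic.
End smooth_operations.

(** * Cylinder functions *)

Section cylinder_functions.
Context {R : realType} {d : nat}.
Local Notation V := 'rV[R]_d.
Local Notation conf := (config R d).
Implicit Types (g : conf) (x : V) (F G : conf -> R).

Lemma test_fun0 : test_fun (fun _ : V => 0 : R).
Proof.
apply/test_funP; split; first exact: cst_continuous.
by exists 0 => x; rewrite eqxx.
Qed.

Definition block_funs m n (f1 : 'I_m -> V -> R) (f2 : 'I_n -> V -> R) (i : 'I_(m + n)%N) : V -> R :=
  match fintype.split i with inl j => f1 j | inr j => f2 j end.

Lemma block_funs_test m n (f1 : 'I_m -> V -> R) (f2 : 'I_n -> V -> R) :
  (forall i, test_fun (f1 i)) -> (forall i, test_fun (f2 i)) ->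
  forall i, test_fun (block_funs f1 f2 i).
Proof. by move=> t1 t2 i; rewrite /block_funs; case: fintype.split. Qed.

Lemma lsubmx_block m n (f1 : 'I_m -> V -> R) (f2 : 'I_n -> V -> R) g :
  lsubmx (\row_(i < m + n) pairing (block_funs f1 f2 i) g) = \row_(i < m) pairing (f1 i) g.
Proof.
by apply/rowP => i; rewrite !mxE /block_funs (unsplitK (inl i)).
Qed.

Lemma rsubmx_block m n (f1 : 'I_m -> V -> R) (f2 : 'I_n -> V -> R) g :
  rsubmx (\row_(i < m + n) pairing (block_funs f1 f2 i) g) = \row_(i < n) pairing (f2 i) g.
Proof.
by apply/rowP => i; rewrite !mxE /block_funs (unsplitK (inr i)).
Qed.

Lemma FCb_cst (a : R) : FCb (cst a : conf -> R).
Proof.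
exists 1%N; split => //; exists (fun _ _ => 0), (fun=> a); split => //.
- by move=> _; exact: test_fun0.
- exact: smooth_cst.
Qed.

Lemma FCb_lin (a : R) F G : FCb F -> FCb G -> FCb (fun g => a * F g + G g).
Proof.
move=> [m [m0 [f1 [h1 [t1 s1 E1]]]]] [n [n0 [f2 [h2 [t2 s2 E2]]]]].
exists (m + n)%N; split; first by rewrite addn_gt0 m0.
exists (block_funs f1 f2), (fun x : 'rV[R]_(m + n)%N => a * h1 (lsubmx x) + h2 (rsubmx x)); split.
- exact: block_funs_test.
- exact: smooth_lin.
- by move=> g; rewrite lsubmx_block rsubmx_block E1 E2.
Qed.

Lemma FCb_mul F G : FCb F -> FCb G -> FCb (fun g => F g * G g).
Proof.
move=> [m [m0 [f1 [h1 [t1 s1 E1]]]]] [n [n0 [f2 [h2 [t2 s2 E2]]]]].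
exists (m + n)%N; split; first by rewrite addn_gt0 m0.
exists (block_funs f1 f2), (fun x : 'rV[R]_(m + n)%N => h1 (lsubmx x) * h2 (rsubmx x)); split.
- exact: block_funs_test.
- exact: smooth_mul.
- by move=> g; rewrite lsubmx_block rsubmx_block E1 E2.
Qed.

Lemma FCb_logistic (f : V -> R) (c b : R) : test_fun f ->
  FCb (fun g => logistic c b (pairing f g)).
Proof.
move=> tf; exists 1%N; split => //; exists (fun=> f), (fun x : 'rV[R]_1 => logistic c b (x 0 0)); split => //.
- exact: smooth_logistic.
- by move=> g; rewrite mxE.
Qed.

(** With a, b the roots and u, v the absolute values, (a - b) (a + b) = (u - v) (u + v), while a + b
    is at least u + v. *)
Lemma sqrt_lipschitz (e s t : R) : 0 < e ->
  `|Num.sqrt (s ^+ 2 + e ^+ 2) - Num.sqrt (t ^+ 2 + e ^+ 2)| <= `|s - t|.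
Proof.
move=> e0; wlog ts : s t / `|t| <= `|s|.
  by move=> h; have [/h//|/ltW/h] := leP `|t| `|s|; rewrite distrC (distrC t).
have ge u : `|u| <= Num.sqrt (u ^+ 2 + e ^+ 2).
  by rewrite -sqrtr_sqr ler_sqrt ?lerDl ?sqr_ge0// addr_ge0 ?sqr_ge0.
have sq u : Num.sqrt (u ^+ 2 + e ^+ 2) ^+ 2 = `|u| ^+ 2 + e ^+ 2.
  by rewrite sqr_sqrtr ?addr_ge0 ?sqr_ge0// real_normK ?num_real.
apply: le_trans (ler_dist_dist s t); rewrite [leRHS]ger0_norm ?subr_ge0//.
have e2 : 0 < e ^+ 2 by rewrite exprn_gt0.
have pos u : 0 < Num.sqrt (u ^+ 2 + e ^+ 2) by rewrite sqrtr_gt0 ltr_wpDl ?sqr_ge0.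
move: (ge s) (ge t) (sq s) (sq t) (pos s) (pos t) (normr_ge0 t) ts.
move: (Num.sqrt _) (Num.sqrt _) `|s| `|t| => b a u v ua vb sa sb a0 b0 v0 vu.
have u0 := le_trans v0 vu.
have ab : b <= a by rewrite -ler_sqr ?nnegrE ?(ltW a0) ?(ltW b0)// sa sb lerD2r ler_sqr ?nnegrE.
rewrite ger0_norm ?subr_ge0//.
have [->|ne] := eqVneq a b; first by rewrite subrr subr_ge0.
have uv : (a - b) * (a + b) = (u - v) * (u + v) by rewrite -!subr_sqr sa sb; ring.
have ab0 : 0 < a + b by rewrite addr_gt0.
rewrite -(ler_pM2r ab0) uv ler_wpM2l ?subr_ge0//; lra.
Qed.

(** The function sqrt(F^2 + e^2) with e = 2^-k lies between |F| and |F| + e and is a 1-Lipschitz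
    function of F, so it increases no difference. *)
Lemma FCb_abs F : FCb F -> exists G : nat -> conf -> R,
  [/\ forall k, FCb (G k), forall k g, `|G k g - `|F g| | <= 2^-1 ^+ k &
    forall k g g', `|G k g - G k g'| <= `|F g - F g'|].
Proof.
move=> [m [m0 [f [h [t s E]]]]].
have e0 k : 0 < (2^-1 : R) ^+ k by rewrite exprn_gt0 ?invr_gt0.
exists (fun k g => Num.sqrt (F g ^+ 2 + (2^-1 ^+ k) ^+ 2)); split => [k|k g|k g g'].
- exists m; split => //; exists f, (fun x : 'rV[R]_m => Num.sqrt (h x ^+ 2 + (2^-1 ^+ k) ^+ 2)); split => //.
    exact: smooth_sqrt.
  by move=> g; rewrite E.
- set e := _ ^+ k; have e0' : 0 < e by exact: e0.
  have h1 : `|F g| <= Num.sqrt (F g ^+ 2 + e ^+ 2).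
    by rewrite -sqrtr_sqr ler_sqrt ?lerDl ?sqr_ge0// addr_ge0 ?sqr_ge0.
  rewrite ger0_norm ?subr_ge0// lerBlDl -[leRHS]ger0_norm ?addr_ge0 ?(ltW e0')//.
  rewrite -sqrtr_sqr ler_sqrt ?sqr_ge0// sqrrD real_normK ?num_real//.
  by rewrite -addrA lerD2l lerDr mulrn_wge0// mulr_ge0// ltW.
- exact: sqrt_lipschitz.
Qed.

Lemma FCb_bounded F : FCb F -> exists M, forall g, `|F g| <= M.
Proof.
move=> [m [m0 [f [h [t s E]]]]]; have [M hM] := (s [::]).2.
by exists M => g; rewrite E; exact: hM.
Qed.

Lemma measurable_row N (f : 'I_N -> V -> R) : (forall i, test_fun (f i)) ->
  measurable_fun setT (fun g => \row_i pairing (f i) g : 'rV[R]_N).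
Proof.
move=> tf; apply: (@measurability _ _ _ _ _ _ (@open 'rV[R]_N)) => // _ [U oU <-].
rewrite setTI (open_bigcup_rat_ball oU) bigcup_mkcond preimage_bigcup.
apply: countable_bigcupT_measurable => // k; case: ifPn => _; last first.
  by rewrite preimage_set0.
rewrite (_ : _ @^-1` _ = \bigcap_(i in [set: 'I_N])
    (pairing (f i)) @^-1` ball (ratr (k.1 0 i) : R) k.2.+1%:R^-1); last first.
  apply/seteqP; split=> [p [_ kp] i _|p kp].
    by have := kp 0 i; rewrite !mxE.
  split=> [|i j]; first by rewrite /= invr_gt0.
  by rewrite !mxE (ord1 i); exact: kp.
apply: fin_bigcap_measurable => // i _; rewrite -[X in measurable X]setTI.
by apply: (measurable_pairing (tf i)) => //; exact: measurable_ball.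
Qed.

Lemma FCb_measurable F : FCb F -> measurable_fun setT F.
Proof.
move=> [m [m0 [f [h [t s E]]]]].
rewrite (_ : F = h \o (fun g => \row_i pairing (f i) g)); last exact/funext.
apply: measurableT_comp (measurable_row t).
apply: (measurability _ (RGenOpens.measurableE R)) => _ [_ [a [b ->] <-]].
rewrite setTI; apply: sub_sigma_algebra.
apply: open_comp; last exact: interval_open.
by move=> x _; apply: differentiable_continuous; exact: (s [::]).1.
Qed.

Lemma pairing_del (f : V -> R) M g x : supported_in f M -> ~ cball M x ->
  pairing f (del_point g x) = pairing f g.
Proof.
move=> fM xM; rewrite !(pairingE _ fM); congr (\sum_(_ <- fset_set _) _).
apply/seteqP; split => y /= [gy My]; first by split => //; case: gy.
by split => //; split => // yx; apply: xM; rewrite -yx.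
Qed.

Lemma FCb_local F : FCb F -> exists M, forall g x, ~ cball M x -> F (del_point g x) = F g.
Proof.
move=> [m [m0 [f [h [t s E]]]]].
have /choice[M hM] : forall i, exists M, supported_in (f i) M.
  by move=> i; have /test_funP[_] := t i.
exists (\sum_i `|M i|) => g x xM; rewrite !E; congr h; apply/rowP => i; rewrite !mxE.
apply: pairing_del xM; apply: supported_inW (hM i).
by rewrite (bigD1 i)//=; apply: (le_trans (ler_norm _)); rewrite lerDl sumr_ge0.
Qed.

End cylinder_functions.

(** * Density of cylinder functions in L^2 *)

Section density.
Context {R : realType} {d : nat}.
Local Notation V := 'rV[R]_d.
Local Notation conf := (config R d).
Implicit Types (g : conf) (x : V) (F G : conf -> R).
Variable mu : probability conf R.
Local Notation N2 f := ('N[mu]_2%:E [EFin \o f%R])%E.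

Lemma bounded_L2 F (M : R) : measurable_fun setT F -> (forall g, `|F g| <= M) -> L2 mu F.
Proof.
move=> mF hM; have M0 : 0 <= M := le_trans (normr_ge0 _) (hM point).
have lM : L2 mu (cst M).
  apply/L2P; split=> //; rewrite L2norm_lty /= integral_cst//.
  apply: (@le_lt_trans _ _ ((M ^+ 2)%:E * 1)%E); last by rewrite mule1 ltry.
  by apply: lee_wpmul2l; [rewrite lee_fin sqr_ge0|exact: probability_le1].
by apply: (L2_le mF lM _).1 => g; rewrite (ger0_norm M0).
Qed.

Lemma FCb_L2 F : FCb F -> L2 mu F.
Proof.
by move=> CF; have [M hM] := FCb_bounded CF; apply: bounded_L2 hM; exact: FCb_measurable.
Qed.

Definition FCb_limit F := L2 mu F /\
  forall e : R, 0 < e -> exists2 G, FCb G & (N2 (F \- G) < e%:E)%E.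

Lemma L2_closed F (G : nat -> conf -> R) : L2 mu F -> (forall k, FCb_limit (G k)) ->
  (N2 (G k \- F) @[k --> \oo] --> 0)%E -> FCb_limit F.
Proof.
move=> lF lG /L2cvg_lt cG; split => // e e0; have e2 : 0 < e / 2 by rewrite divr_gt0.
have [k hk] := cG _ e2; have [lGk /(_ _ e2)[H CH hH]] := lG k.
exists H => //; apply: (le_lt_trans (L2_triangle mu (L2_measurable lF) (L2_measurable lGk)
  (FCb_measurable CH))).
by apply: lte_half => //; rewrite L2normB; exact: hk.
Qed.

Lemma L2_limit F (G : nat -> conf -> R) h : L2 mu h -> measurable_fun setT F ->
  (forall g, `|F g| <= `|h g|) -> (forall k, FCb_limit (G k)) ->
  (forall k g, `|G k g| <= `|h g|) -> (forall g, G k g @[k --> \oo] --> F g) -> FCb_limit F.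
Proof.
move=> lh mF Fh lG Gh cG; apply: (L2_closed (G := G)) => //; first exact: (L2_le mF lh Fh).1.
apply: (L2_dominated_cvg (H := fun=> h) (h := h)) => //.
- by move=> k; exact: L2_measurable (lG k).1.
- by move=> _; exact: L2_measurable lh.
- move=> k; rewrite (_ : h \- h = cst 0); last by apply/funext => g /=; rewrite subrr.
  rewrite L2norm_lt ?fast_gt0//= integral_cst// expr0n mul0e lte_fin exprn_gt0//.
  exact: fast_gt0.
- by apply: aeW.
Qed.

Lemma FCb_limitW F : FCb F -> FCb_limit F.
Proof.
move=> CF; split; first exact: FCb_L2.
move=> e e0; exists F => //; rewrite (_ : F \- F = cst 0); last by apply/funext => g /=; rewrite subrr.
by rewrite L2norm_lt//= integral_cst// expr0n mul0e lte_fin exprn_gt0.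
Qed.

Lemma FCb_limit_lin (a : R) F G : FCb_limit F -> FCb_limit G -> FCb_limit (fun g => a * F g + G g).
Proof.
move=> [lF hF] [lG hG]; split; first exact: L2_lin.
move=> e e0.
have c0 : 0 < e / 2 / (`|a| + 1) by rewrite !divr_gt0// ltr_wpDl.
have /choice[F' hF'] : forall k, exists F', FCb F' /\ (N2 (F \- F') < ((2^-1 : R) ^+ k)%:E)%E.
  move=> k; have k0 : 0 < (2^-1 : R) ^+ k by rewrite exprn_gt0 ?invr_gt0.
  by have [F' ? ?] := hF _ k0; exists F'.
have /choice[G' hG'] : forall k, exists G', FCb G' /\ (N2 (G \- G') < ((2^-1 : R) ^+ k)%:E)%E.
  move=> k; have k0 : 0 < (2^-1 : R) ^+ k by rewrite exprn_gt0 ?invr_gt0.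
  by have [G' ? ?] := hG _ k0; exists G'.
have half0 (H : conf -> R) H' : (forall k, (N2 (H \- H' k) < ((2^-1 : R) ^+ k)%:E)%E) ->
    (N2 (H' k \- H) @[k --> \oo] --> 0)%E.
  move=> hH; apply/L2cvg_lt => c c0'.
  have : (fun k => (2^-1 : R) ^+ k) @ \oo --> (0 : R).
    by apply: cvg_expr; rewrite ger0_norm ?invr_ge0// invf_lt1// ltr1n.
  move=> /cvgr_lt/(_ c c0')[K _ hK]; exists K => n Kn; rewrite L2normB.
  by apply: (lt_trans (hH n)); rewrite lte_fin; exact: hK.
have := L2cvg_lin a (fun k => FCb_L2 (hF' k).1) (fun k => FCb_L2 (hG' k).1) lF lG
  (half0 _ _ (fun k => (hF' k).2)) (half0 _ _ (fun k => (hG' k).2)).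
move=> /L2cvg_lt/(_ e e0)[k hk]; exists (fun g => a * F' k g + G' k g).
  exact: FCb_lin (hF' k).1 (hG' k).1.
by rewrite L2normB; exact: hk.
Qed.

Lemma FCb_prod n (F : 'I_n -> conf -> R) : (forall i, FCb (F i)) ->
  FCb (fun g => \prod_(i < n) F i g).
Proof.
elim: n F => [|n ih] F CF.
  by rewrite (_ : (fun g => _) = cst 1); [exact: FCb_cst|apply/funext => g; rewrite big_ord0].
rewrite (_ : (fun g => _) = (fun g => F ord0 g * \prod_(i < n) F (lift ord0 i) g)).
  by apply: FCb_mul => //; exact: ih.
by apply/funext => g; rewrite big_ord_recl.
Qed.

Lemma cvg_prod_ord n (u : 'I_n -> nat -> R) (l : 'I_n -> R) :
  (forall i, u i k @[k --> \oo] --> l i) ->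
  \prod_(i < n) u i k @[k --> \oo] --> \prod_(i < n) l i.
Proof.
elim: n u l => [|n ih] u l h.
  by under eq_fun do rewrite big_ord0; rewrite big_ord0; exact: cvg_cst.
under eq_fun do rewrite big_ord_recl; rewrite big_ord_recl.
by apply: cvgM => //; exact: ih.
Qed.

(** The argument of the exponential is k^2 (t - a) - k up to sign: the quadratic term decides for t
    different from a, and the shift by k gives the limit 0 at t = a. For t > a it exceeds k as soon
    as k >= 2 / (t - a). *)
Lemma logistic_step (a : R) (t : R) :
  (fun k : nat => logistic (k%:R ^+ 2) (- (k%:R ^+ 2 * a) - k%:R) t) @ \oo --> ((a < t)%R%:R : R).
Proof.
apply/cvgrPdist_le => e e0.
have [K hK] : exists K : nat, forall k : nat, (K <= k)%N -> k.+1%:R^-1 <= e.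
  have := @cvg_harmonic R => /cvgr_le/(_ e e0)[K _ hK]; exists K => k Kk; exact: hK.
have bnd (k : nat) : (expR k%:R)^-1 <= k.+1%:R^-1 :> R.
  by rewrite lef_pV2 ?posrE ?expR_gt0// -natr1 addrC; exact: expR_ge1Dx.
have [at_|ta] := ltP a t; last first.
  exists K => //= k Kk; rewrite sub0r normrN ger0_norm ?logistic_ge0//.
  apply: le_trans (hK k Kk); rewrite /logistic lef_pV2 ?posrE ?addr_gt0 ?expR_gt0//.
  rewrite -natr1 addrC lerD2l.
  have h : k%:R <= - (k%:R ^+ 2 * t + (- (k%:R ^+ 2 * a) - k%:R)) :> R.
    by have := ler_wpM2l (sqr_ge0 (k%:R : R)) ta; lra.
  apply: le_trans (le_trans (expR_ge1Dx k%:R) _); first by rewrite lerDr.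
  by rewrite ler_expR.
pose K2 := Num.truncn (2 / (t - a)).
exists (maxn K K2.+1) => // k /=; rewrite geq_max => /andP[Kk K2k].
have v1 := logistic_le1 (k%:R ^+ 2) (- (k%:R ^+ 2 * a) - k%:R) t.
rewrite ger0_norm ?subr_ge0//; apply: le_trans (hK k Kk).
apply: le_trans (bnd k); rewrite /logistic.
set w := _ ^+ 2 * t + _; have w0 : k%:R <= w.
  have h2 : 2 / (t - a) <= k%:R.
    by apply: (le_trans (ltW (truncnS_gt _))); rewrite ler_nat.
  rewrite ler_pdivrMr ?subr_gt0// in h2.
  have := ler_wpM2l (ler0n R k) h2; rewrite /w; lra.
have E0 := expR_gt0 (- w).
rewrite -[X in X - _](divff (lt0r_neq0 (addr_gt0 ltr01 E0))) -[X in _ - X]mul1r -mulrBl.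
rewrite addrAC subrr add0r ler_pdivrMr ?addr_gt0//.
have E1 : expR (- w) <= (expR k%:R)^-1 by rewrite -expRN ler_expR lerN2.
by apply: (le_trans E1); rewrite ler_peMr ?invr_ge0 ?expR_ge0// lerDl ltW.
Qed.

Definition cylinder : set (set conf) := [set A | exists n (f : 'I_n -> V -> R) (a : 'I_n -> R),
  (forall i, test_fun (f i)) /\ A = [set g | forall i, a i < pairing (f i) g]].

Lemma cylinderI : setI_closed cylinder.
Proof.
move=> _ _ [m [f1 [a1 [t1 ->]]]] [n [f2 [a2 [t2 ->]]]].
exists (m + n)%N, (block_funs f1 f2),
  (fun i => match fintype.split i with inl j => a1 j | inr j => a2 j end).
split; first exact: block_funs_test.
apply/seteqP; split => g /=.
  by move=> [g1 g2] i; rewrite /block_funs; case: fintype.split.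
move=> h; split => i.
  by have := h (lshift n i); rewrite /block_funs (unsplitK (inl i)).
by have := h (rshift m i); rewrite /block_funs (unsplitK (inr i)).
Qed.

Lemma cylinder_measurable A : cylinder A -> measurable A.
Proof.
move=> [n [f [a [tf ->]]]].
rewrite (_ : [set g | _] = \bigcap_(i in [set: 'I_n]) (pairing (f i) @^-1` `]a i, +oo[%classic)).
  apply: fin_bigcap_measurable => // i _; rewrite -[X in measurable X]setTI.
  exact: (measurable_pairing (tf i)).
apply/seteqP; split => g /= h i; first by move=> _; rewrite /= in_itv/= h.
by have := h i Logic.I; rewrite /= in_itv/= andbT.
Qed.

(** Products of logistic functions of pairings are cylinder functions bounded by 1, and they
    converge pointwise to the indicator. *)
Lemma cylinder_limit A : cylinder A -> FCb_limit (\1_A : conf -> R).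
Proof.
move=> cA; have mA := cylinder_measurable cA; move: cA => [n [f [a [tf AE]]]].
pose G (k : nat) g := \prod_(i < n)
  logistic (k%:R ^+ 2) (- (k%:R ^+ 2 * a i) - k%:R) (pairing (f i) g).
apply: (L2_limit (G := G) (h := cst 1)).
- by apply: (bounded_L2 (M := 1)) => // g; rewrite normr1.
- exact: measurable_indic.
- by move=> g; rewrite indicE normr1; case: (_ \in _); rewrite ?normr1 ?normr0.
- by move=> k; apply: FCb_limitW; apply: FCb_prod => i; exact: FCb_logistic.
- move=> k g; rewrite /= normr1 ger0_norm; last by apply: prodr_ge0 => i _; exact: logistic_ge0.
  by apply: prodr_ile1 => i _; rewrite logistic_ge0 logistic_le1.
- move=> g; rewrite (_ : \1_A g = \prod_(i < n) (a i < pairing (f i) g)%R%:R).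
    by apply: cvg_prod_ord => i; exact: logistic_step.
  rewrite indicE AE; have [h|h] := pselect (forall i, a i < pairing (f i) g).
    by rewrite mem_set// big1// => i _; rewrite h.
  rewrite memNset//; move/existsNP: h => [i /negP/negbTE h].
  by rewrite (bigD1 i)//= h mul0r.
Qed.

(* Point counts in balls are limits of pairings, and the Borel sets of the
   configuration space are generated by point counts. *)
Lemma measurable_cylinder : @measurable _ conf = <<s cylinder >>.
Proof.
apply/seteqP; split => A; last first.
  by apply: smallest_sub; [exact: sigma_algebra_measurable|exact: cylinder_measurable].
move=> mA; pose X := g_sigma_algebraType cylinder.
have mp (f : V -> R) : test_fun f -> measurable_fun [set: X] (pairing f : X -> R).
  move=> tf; apply: (measurability _ (RGenOInfty.measurableE R)) => _ [_ [a ->] <-].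
  rewrite setTI; apply: sub_sigma_algebra; exists 1%N, (fun=> f), (fun=> a); split => //.
  by apply/seteqP; split => g /=; rewrite in_itv/= andbT => // /(_ ord0).
have mid : measurable_fun [set: X] (fun g : X => g : conf).
  apply: measurable_to_config => q r.
  have [f [M [cf sf hf]]] := @approximable_ball R d q r.
  have cM := @cnt_approx R d ^~ (ball q r).
  apply: (emeasurable_fun_cvg (fun k (g : X) => (pairing (f k) g)%:E)).
    move=> k; apply/measurable_EFinP; apply: mp; apply/test_funP; split; first exact: cf.
    by exists M.
  by move=> g _; apply: cM hf => //; exact: measurable_ball_rV.
by have := mid measurableT A mA; rewrite setTI.
Qed.

(** Limits of cylinder functions are stable under complements and countable disjoint unions, the
    partial sums of the latter being dominated by 1; Dynkin's theorem passes from cylinder sets to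
    Borel sets. *)
Lemma indic_limit A : measurable A -> FCb_limit (\1_A : conf -> R).
Proof.
have l1 : L2 mu (cst 1 : conf -> R) by apply: (bounded_L2 (M := 1)) => // g; rewrite normr1.
have := @measurable_cylinder => mc; rewrite [X in X A]mc => mA; move: A mA.
apply: (dynkin_induction (G := cylinder) (P := fun A => FCb_limit (\1_A : conf -> R))).
- exact: mc.
- exact: cylinderI.
- by rewrite indicT; apply: FCb_limitW; exact: FCb_cst.
- exact: cylinder_limit.
- move=> S mS lS; rewrite (_ : \1_(~` S) = (fun g => -1 * \1_S g + cst 1 g)).
    by apply: FCb_limit_lin => //; apply: FCb_limitW; exact: FCb_cst.
  by apply/funext => g; rewrite !indicE in_setC mulN1r /=; case: (_ \in _); rewrite ?addNr ?oppr0 ?add0r.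
move=> F mF tF lF.
pose G k g : R := \sum_(i < k) \1_(F i) g.
have disj i j g : F i g -> F j g -> i = j by move=> Fi Fj; apply: tF => //; exists g.
have inE i g k : F i g -> G k g = (i < k)%:R.
  move=> Fi; rewrite /G; case: ltnP => ik.
    rewrite (bigD1 (Ordinal ik))//= indicE mem_set// big1 ?addr0// => j ji.
    rewrite indicE memNset// => Fj; move/eqP: ji; apply; apply: val_inj.
    by rewrite /= (disj _ _ _ Fj Fi).
  rewrite big1// => j _; rewrite indicE memNset// => Fj.
  by have := ltn_ord j; rewrite (disj _ _ _ Fj Fi) ltnNge ik.
have outE g k : ~ (\bigcup_k F k) g -> G k g = 0.
  by move=> h; rewrite /G big1// => j _; rewrite indicE memNset// => Fj; apply: h; exists j.
have mU : measurable (\bigcup_k F k) by exact: bigcupT_measurable.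
apply: (L2_limit (G := G) (h := cst 1)) => //.
- by move=> g; rewrite indicE normr1; case: (_ \in _); rewrite ?normr1 ?normr0.
- elim=> [|k ih].
    rewrite (_ : G 0%N = cst 0); last by apply/funext => g; rewrite /G big_ord0.
    by apply: FCb_limitW; exact: FCb_cst.
  rewrite (_ : G k.+1 = (fun g => 1 * G k g + \1_(F k) g)).
    exact: FCb_limit_lin.
  by apply/funext => g; rewrite /G big_ord_recr /= mul1r.
- move=> k g; rewrite normr1; have [[i _ Fi]|h] := pselect ((\bigcup_k F k) g).
    by rewrite (inE i)//; case: ltnP; rewrite ?normr1 ?normr0.
  by rewrite outE// normr0.
- move=> g; have [[i _ Fi]|h] := pselect ((\bigcup_k F k) g).
    rewrite indicE mem_set; last by exists i.
    by apply: cvg_near_cst; exists i.+1 => //= k ik; rewrite (inE i)// ik.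
  rewrite indicE memNset//; apply: cvg_near_cst; exists 0%N => // k _.
  exact: outE.
Qed.

Lemma L2_density F : L2 mu F -> FCb_limit F.
Proof.
apply: (L2_induction (P := FCb_limit)).
- by apply: FCb_limitW; exact: FCb_cst.
- exact: indic_limit.
- exact: FCb_limit_lin.
- by move=> F' G h; exact: L2_limit.
Qed.

End density.

(** * The Glauber form as a difference form *)

Section glauber_form_as_difference_form.
Context {R : realType} {d : nat}.
Local Notation V := 'rV[R]_d.
Local Notation conf := (config R d).
Implicit Types (g : conf) (x : V) (F G : conf -> R).
Variable mu : probability conf R.

(** Vanishing outside a ball makes the inner sum finite, so it splits into the sums of the positive
    and negative parts, to which the Campbell formula for nonnegative functions applies
    separately. *)
Lemma Rintegral_campbell (f : conf * V -> R) M : measurable_fun setT f ->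
  (forall g x, ~ cball M x -> f (g, x) = 0) ->
  (campbell mu).-integrable setT (EFin \o f) ->
  (\int[campbell mu]_p f p = \int[mu]_g \sum_(x \in points g) f (g, x))%R.
Proof.
move=> mf f0 fi.
pose fp p := Num.max (f p) 0; pose fn p := Num.max (- f p) 0.
have fp0 p : 0 <= fp p by rewrite le_max lexx orbT.
have fn0 p : 0 <= fn p by rewrite le_max lexx orbT.
have mp : measurable_fun setT fp by exact: measurable_maxr.
have mn : measurable_fun setT fn by apply: measurable_maxr => //; exact: measurableT_comp.
have ip : (\int[campbell mu]_p (fp p)%:E < +oo)%E.
  have /integrableP[_] := integrable_funepos measurableT fi.
  apply: le_lt_trans; apply: nonneg_integral_mono => p; first by rewrite lee_fin fp0.
  have -> : (fp p)%:E = ((EFin \o f)^\+)%E p.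
    by rewrite /fp EFin_max; first [reflexivity | by rewrite ?funeposE ?funenegE | by rewrite /funepos /funeneg | by rewrite unlock].
  exact: lee_abs.
have in_ : (\int[campbell mu]_p (fn p)%:E < +oo)%E.
  have /integrableP[_] := integrable_funeneg measurableT fi.
  apply: le_lt_trans; apply: nonneg_integral_mono => p; first by rewrite lee_fin fn0.
  have -> : (fn p)%:E = ((EFin \o f)^\-)%E p.
    by rewrite /fn EFin_max; first [reflexivity | by rewrite ?funeposE ?funenegE | by rewrite /funepos /funeneg | by rewrite unlock].
  exact: lee_abs.
have fin (h : conf * V -> R) g : (forall p, 0 <= h p) -> (forall x, ~ cball M x -> h (g, x) = 0) ->
    (\esum_(x in points g) (h (g, x))%:E)%E =
    (\sum_(x <- fset_set (points g `&` cball M)) h (g, x))%:E.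
  move=> h0 hM; have fA := @finite_cball R d g M.
  transitivity (\esum_(x in points g `&` cball M) (h (g, x))%:E)%E.
    rewrite esum_mkcondr; apply: eq_esum => x _.
    by case: ifPn => // xM; rewrite hM// => /mem_set; exact/negP.
  by rewrite esum_fset ?fsbig_finite ?sumEFin// => x _; rewrite lee_fin.
have fpM g x : ~ cball M x -> fp (g, x) = 0 by move=> xM; rewrite /fp f0// maxxx.
have fnM g x : ~ cball M x -> fn (g, x) = 0 by move=> xM; rewrite /fn f0// oppr0 maxxx.
pose Sp g := \sum_(x <- fset_set (points g `&` cball M)) fp (g, x).
pose Sn g := \sum_(x <- fset_set (points g `&` cball M)) fn (g, x).
have SE g : \sum_(x \in points g) f (g, x) = Sp g - Sn g.
  have fA := @finite_cball R d g M.
  rewrite -(fsbig_widen (points g `&` cball M)) => [|x []//|x [gx xM]]; last first.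
    by apply: f0 => Mx; apply: xM.
  rewrite fsbig_finite// -sumrB; apply: eq_bigr => x _.
  by rewrite /fp /fn /Num.max; case: ltP => h1; case: ltP => h2; lra.
have esumE (h : conf * V -> R) : (forall p, 0 <= h p) -> measurable_fun setT h ->
    (forall g x, ~ cball M x -> h (g, x) = 0) ->
    (\int[campbell mu]_p (h p)%:E = \int[mu]_g
      (\sum_(x <- fset_set (points g `&` cball M)) h (g, x))%:E)%E /\
    measurable_fun setT (fun g => (\sum_(x <- fset_set (points g `&` cball M)) h (g, x))%:E).
  move=> h0 mh hM; have mEh : measurable_fun setT (EFin \o h) by exact/measurable_EFinP.
  have E : (fun g => \esum_(x in points g) (EFin \o h) (g, x))%E =
      (fun g => (\sum_(x <- fset_set (points g `&` cball M)) h (g, x))%:E).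
    by apply/funext => g; rewrite fin// => x; exact: hM.
  split; last first.
    rewrite -E; apply: (@measurable_esum R d _ _ id (@measurable_id _ _ setT) (EFin \o h)) => //.
  transitivity (\int[mu]_g (\esum_(x in points g) (EFin \o h) (g, x)))%E.
    by apply: (integral_campbell mu (F := EFin \o h)) => // p; rewrite lee_fin.
  by apply: eq_integral => g _; rewrite fin// => x; exact: hM.
have [Ep mSp] := esumE fp fp0 mp fpM; have [En mSn] := esumE fn fn0 mn fnM.
have Sp0 g : 0 <= Sp g by apply: sumr_ge0.
have Sn0 g : 0 <= Sn g by apply: sumr_ge0.
have iSp : mu.-integrable setT (EFin \o Sp).
  apply/integrableP; split; first exact: mSp.
  by under eq_integral do rewrite gee0_abs ?lee_fin//; rewrite -Ep.
have iSn : mu.-integrable setT (EFin \o Sn).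
  apply/integrableP; split; first exact: mSn.
  by under eq_integral do rewrite gee0_abs ?lee_fin//; rewrite -En.
rewrite /Rintegral; congr fine.
rewrite integralE; under [RHS]eq_integral do rewrite SE EFinB.
rewrite (integralB_EFin measurableT iSp iSn) -Ep -En.
by congr (_ - _)%E; apply: eq_integral => p _; rewrite ?funeposE ?funenegE /fp /fn EFin_max.
Qed.

Variables (hd : (0 < d)%N).
Hypothesis intensity : forall N, (0 < N)%N -> (\int[mu]_g cnt g (cube N) < +oo)%E.

(** The difference is at most twice the bound of F and vanishes unless the deleted point lies in a
    fixed cube, so its squared norm is at most 4 K^2 times the expected number of points there. *)
Lemma FCb_diff_L2 F : FCb F ->
  L2 (campbell mu) (diff_op (fun p : conf * V => del_point p.1 p.2) fst F).
Proof.
move=> CF; have [K hK] := FCb_bounded CF; have [M hM] := FCb_local CF.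
have [N N0 MN] := @cball_cube R d M.
have mF := FCb_measurable CF.
have mD : measurable_fun setT (diff_op (fun p : conf * V => del_point p.1 p.2) fst F).
  by apply: measurable_D => //; exact: measurable_del_point.
have mL := @measurable_cube R d N.
have K0 : 0 <= K := le_trans (normr_ge0 _) (hK point).
apply/L2P; split => //; rewrite L2norm_lty.
apply: (@le_lt_trans _ _ (\int[campbell mu]_p (((2 * K) ^+ 2)%:E * (\1_(cube N) p.2)%:E))%E).
  apply: nonneg_integral_mono => -[g x]; first by rewrite lee_fin sqr_ge0.
  rewrite -EFinM lee_fin /diff_op /=; have [xM|xM] := pselect (cball M x); last first.
    by rewrite hM// subrr expr0n mulr_ge0// sqr_ge0.
  rewrite indicE mem_set ?mulr1; last exact: MN.
  rewrite -real_normK ?num_real//; apply: lerXn2r; rewrite ?nnegrE ?mulr_ge0//.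
  apply: (le_trans (ler_normB _ _)).
  by have := hK (del_point g x); have := hK g; lra.
have mI : measurable_fun setT (fun p : conf * V => (\1_(cube N) p.2)%:E : \bar R).
  by apply/measurable_EFinP; apply: measurableT_comp => //; exact: measurable_indic.
rewrite ge0_integralZl//; last by rewrite lee_fin sqr_ge0.
rewrite (integral_campbell mu (F := fun p => (\1_(cube N) p.2)%:E))//.
rewrite (_ : (fun g => _) = (fun g => cnt g (cube N))); last by apply/funext => g; rewrite cntE.
by rewrite lte_mul_pinfty ?lee_fin ?sqr_ge0//; exact: intensity.
Qed.

Lemma pre_formE F G : FCb F -> FCb G -> pre_form mu F G = L2form (campbell mu)
  (diff_op (fun p : conf * V => del_point p.1 p.2) fst F)
  (diff_op (fun p : conf * V => del_point p.1 p.2) fst G).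
Proof.
move=> CF CG; have [M hM] := FCb_local CF.
have lF := FCb_diff_L2 CF; have lG := FCb_diff_L2 CG.
rewrite /L2form (Rintegral_campbell (M := M)) //.
- by apply: measurable_funM; [exact: L2_measurable lF|exact: L2_measurable lG].
- by move=> g x xM; rewrite /diff_op /= hM// subrr mul0r.
- exact: L2_prod_int.
Qed.

End glauber_form_as_difference_form.

Theorem lemma3p2 (R : realType) (d : nat) (hd : (0 < d)%N)
    (phi : 'rV[R]_d -> \bar R) (z : R) (mu : probability (config R d) R)
    (hphi : pair_potential phi) (hz : 0 < z)
    (hmu : [/\ mayer_integrable phi, superstable phi, lower_regular phi
             & tempered_gibbs z phi mu]
           \/ [/\ repulsive phi, mayer_integrable phi & gibbs z phi mu]) :
  dirichlet_form mu (glauber_dom mu) (glauber_form mu).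
Proof.
have gmu : gibbs z phi mu by case: hmu => [[_ _ _ []]|[]].
have intensity N : (0 < N)%N -> (\int[mu]_g cnt g (cube N) < +oo)%E.
  move=> N0; case: hmu => [[_ ss lr tg]|[rep _ _]].
    exact: (superstable_finite_intensity hd hphi hz N0 ss lr tg).
  exact: (repulsive_finite_intensity hd hz N0 rep gmu).
(* For these two maps [diff_op] is [Dminus]. *)
apply: (@closure_dirichlet _ _ _ _ _ mu (campbell mu) (fun p => del_point p.1 p.2) fst).
- exact: measurable_del_point.
- exact: measurable_fst.
- by move=> N mN N0; exact: (campbell_del_null hd gmu (ltW hz) mN N0).
- by move=> N mN N0; exact: campbell_fst_null.
- exact: FCb_lin.
- exact: FCb_cst.
- exact: FCb_L2.
- exact: FCb_diff_L2.
- exact: pre_formE.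
- by move=> F /L2_density[].
- exact: FCb_abs.
Qed.
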